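(* Let $N\ge 3$, $0<\lambda\le\Lambda$, and let $\mathcal{M}$ denote either $\mathcal{M}^+_{\lambda,\Lambda}$ or $\mathcal{M}^-_{\lambda,\Lambda}$ (the same operator in both equations). Let $p,q>0$ with $pq>1$, and consider the system $$\mathcal{M}(D^2u)+v^p=0,\qquad \mathcal{M}(D^2v)+u^q=0,\qquad u,v>0\quad\text{in }\Omega. \tag{S}$$ Then: (i) System (S) with $\Omega=\mathbb{R}^N$ has at most one radial positive regular solution up to the scaling $(u,v)\mapsto(u_\gamma,v_\gamma)$, $\gamma>0$. Moreover, if such a solution exists, the set of shooting parameters $(\xi,\eta)$, $\xi,\eta>0$, for which the initial value problem (IVP) given in the context admits a positive radial solution in $\mathbb{R}^N$ (i.e. a solution defined and positive on $[0,\infty)$) is the graph of a simple smooth curve $\eta=c\,\xi^{\frac{q+1}{p+1}}$, where $c$ is a constant. (ii) For $R>0$, system (S) with $\Omega=B_R$ and $u=v=0$ on $\partial B_R$ has at most one positive solution $(u,v)$, which is radial. Further, given $\bar R>0$, any other solution pair $(\bar u,\bar v)$ of the Dirichlet problem in $B_{\bar R}$ is obtained from $(u,v)$ by rescaling, i.e. $(\bar u,\bar v)=(u_\gamma,v_\gamma)$ for some $\gamma>0$ with $R=\gamma\bar R$.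
   Context: Pucci operators: for a symmetric $N\times N$ matrix $A$ with eigenvalues $e_1,\dots,e_N$, $\mathcal{M}^+_{\lambda,\Lambda}(A)=\Lambda\sum_{e_i>0}e_i+\lambda\sum_{e_i<0}e_i$ and $\mathcal{M}^-_{\lambda,\Lambda}(A)=\lambda\sum_{e_i>0}e_i+\Lambda\sum_{e_i<0}e_i$. $B_R\subset\mathbb{R}^N$ is the ball of radius $R$ centered at the origin. Solutions are classical ($C^2$). A radial solution pair is written $u(x)=u(r)$, $v(x)=v(r)$, $r=|x|$, and is called regular if $u$ and $v$, together with their derivatives, are continuously defined at $x=0$. Scaling: with $\alpha=\frac{2(p+1)}{pq-1}$, $\beta=\frac{2(q+1)}{pq-1}$, set $u_\gamma(r)=\gamma^\alpha u(\gamma r)$, $v_\gamma(r)=\gamma^\beta v(\gamma r)$ for $\gamma>0$. (IVP): for $\xi,\eta>0$, $$u''=M_\pm\big(-r^{-1}(N-1)m_\pm(u')-|v|^{p-1}v\big),\quad u(0)=\xi,\ u'(0)=0,$$ $$v''=M_\pm\big(-r^{-1}(N-1)m_\pm(v')-|u|^{q-1}u\big),\quad v(0)=\eta,\ v'(0)=0,$$ with sign $+$ for $\mathcal{M}^+$ and $-$ for $\mathcal{M}^-$, where $m_+(s)=\lambda s$ if $s\le0$, $\Lambda s$ if $s>0$; $M_+(s)=s/\lambda$ if $s\le0$, $s/\Lambda$ if $s>0$; $m_-(s)=\Lambda s$ if $s\le0$, $\lambda s$ if $s>0$; $M_-(s)=s/\Lambda$ if $s\le 0$, $s/\lambda$ if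 $s>0$. *)

(* Defs.v *)
From HB Require Import structures.
From mathcomp Require Import all_boot all_order all_algebra.
From mathcomp Require Import all_classical all_reals all_analysis.

Set Implicit Arguments.
Unset Strict Implicit.
Unset Printing Implicit Defensive.

Import Order.TTheory GRing.Theory Num.Theory.
Import numFieldNormedType.Exports.

Local Open Scope classical_set_scope.
Local Open Scope ring_scope.

(* The library norm `|x| on row vectors is the sup norm, hence this one. *)
Definition enorm (R : realType) (N : nat) (x : 'rV[R]_N) : R :=
  Num.sqrt (\sum_(i < N) x ord0 i ^+ 2).

Definition eball (R : realType) (N : nat) (r : R) : set 'rV[R]_N :=
  [set x | enorm x < r].

Definition ecball (R : realType) (N : nat) (r : R) : set 'rV[R]_N :=
  [set x | enorm x <= r].

Definition esphere (R : realType) (N : nat) (r : R) : set 'rV[R]_N :=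
  [set x | enorm x = r].

Definition partial (R : realType) (N : nat) (i : 'I_N) (u : 'rV[R]_N -> R) :
    'rV[R]_N -> R :=
  'D_(delta_mx ord0 i) u.

Definition hessian (R : realType) (N : nat) (u : 'rV[R]_N -> R)
    (x : 'rV[R]_N) : 'M[R]_N :=
  \matrix_(i, j) partial j (partial i u) x.

(* Meant for an open set D, so that the partial derivatives near a point of D
   only involve values of u in D. *)
Definition C2_on (R : realType) (N : nat) (D : set 'rV[R]_N)
    (u : 'rV[R]_N -> R) : Prop :=
  forall x, D x ->
    {for x, continuous u} /\
    (forall i : 'I_N,
      derivable u x (delta_mx ord0 i) /\
      {for x, continuous (partial i u)} /\
      (forall j : 'I_N,
        derivable (partial i u) x (delta_mx ord0 j) /\
        {for x, continuous (partial j (partial i u))})).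

(* The eigenvalues of A listed with multiplicity, in an unspecified order.
   Such a list exists whenever A is symmetric, is unique up to permutation,
   and has size N.  The default [::] is used only when char_poly A does not
   split over R, which cannot happen for the Hessian of a C^2 function. *)
Definition eigenvalues (R : realType) (N : nat) (A : 'M[R]_N) : seq R :=
  xget [::] [set s : seq R | char_poly A = \prod_(e <- s) ('X - e%:P)].

Inductive pucci_sign : Type := PucciPlus | PucciMinus.

Definition pucci (R : realType) (sgn : pucci_sign) (lam Lam : R) (N : nat)
    (A : 'M[R]_N) : R :=
  let pos := \sum_(e <- eigenvalues A | 0 < e) e in
  let neg := \sum_(e <- eigenvalues A | e < 0) e in
  match sgn with
  | PucciPlus => Lam * pos + lam * neg
  | PucciMinus => lam * pos + Lam * neg
  end.

Definition solves_system (R : realType) (sgn : pucci_sign) (lam Lam p q : R)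
    (N : nat) (D : set 'rV[R]_N) (u v : 'rV[R]_N -> R) : Prop :=
  C2_on D u /\ C2_on D v /\
  (forall x, D x ->
    0 < u x /\ 0 < v x /\
    pucci sgn lam Lam (hessian u x) + v x `^ p = 0 /\
    pucci sgn lam Lam (hessian v x) + u x `^ q = 0).

Definition radial_on (R : realType) (N : nat) (D : set 'rV[R]_N)
    (u : 'rV[R]_N -> R) : Prop :=
  exists f : R -> R, forall x, D x -> u x = f (enorm x).

Definition regular_at0 (R : realType) (N : nat) (u : 'rV[R]_N -> R) : Prop :=
  {for 0, continuous u} /\
  (forall i : 'I_N,
    (\forall x \near (0 : 'rV[R]_N), derivable u x (delta_mx ord0 i)) /\
    {for 0, continuous (partial i u)}).

Definition radial_regular_entire_solution (R : realType) (sgn : pucci_sign)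
    (lam Lam p q : R) (N : nat) (u v : 'rV[R]_N -> R) : Prop :=
  solves_system sgn lam Lam p q setT u v /\
  radial_on setT u /\ radial_on setT v /\
  regular_at0 u /\ regular_at0 v.

(* Classical Dirichlet problem: C^2 in the open ball, continuous up to the
   boundary; the values of u and v outside the closed ball are irrelevant. *)
Definition dirichlet_solution (R : realType) (sgn : pucci_sign)
    (lam Lam p q : R) (N : nat) (r : R) (u v : 'rV[R]_N -> R) : Prop :=
  solves_system sgn lam Lam p q (@eball R N r) u v /\
  {within @ecball R N r, continuous u} /\
  {within @ecball R N r, continuous v} /\
  (forall x, @esphere R N r x -> u x = 0 /\ v x = 0).

Definition alpha (R : realType) (p q : R) : R := 2 * (p + 1) / (p * q - 1).
Definition beta (R : realType) (p q : R) : R := 2 * (q + 1) / (p * q - 1).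

Definition rescale (R : realType) (N : nat) (a gamma : R)
    (u : 'rV[R]_N -> R) : 'rV[R]_N -> R :=
  fun x => gamma `^ a * u (gamma *: x).

Definition m_fun (R : realType) (sgn : pucci_sign) (lam Lam s : R) : R :=
  match sgn with
  | PucciPlus => if s <= 0 then lam * s else Lam * s
  | PucciMinus => if s <= 0 then Lam * s else lam * s
  end.

Definition M_fun (R : realType) (sgn : pucci_sign) (lam Lam s : R) : R :=
  match sgn with
  | PucciPlus => if s <= 0 then s / lam else s / Lam
  | PucciMinus => if s <= 0 then s / Lam else s / lam
  end.

(* w(0) = a and w'(0) = 0 for a function w considered on [0, +oo[ only: the
   derivative at 0 is one-sided, and w and w' are continuous at 0. *)
Definition initial_data (R : realType) (w : R -> R) (a : R) : Prop :=
  w 0 = a /\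
  w r @[r --> 0^'+] --> a /\
  (w r - w 0) / r @[r --> 0^'+] --> (0 : R) /\
  derive1 w r @[r --> 0^'+] --> (0 : R).

(* The equations are singular at r = 0 and are required for r > 0. *)
Definition positive_ivp_solution (R : realType) (sgn : pucci_sign)
    (lam Lam p q : R) (N : nat) (xi eta : R) (u v : R -> R) : Prop :=
  initial_data u xi /\ initial_data v eta /\
  (forall r : R, 0 <= r -> 0 < u r /\ 0 < v r) /\
  (forall r : R, 0 < r ->
    derivable u r 1 /\ derivable (derive1 u) r 1 /\
    derivable v r 1 /\ derivable (derive1 v) r 1 /\
    derive1 (derive1 u) r =
      M_fun sgn lam Lam
        (- (r^-1 * (N%:R - 1) * m_fun sgn lam Lam (derive1 u r))
         - `|v r| `^ (p - 1) * v r) /\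
    derive1 (derive1 v) r =
      M_fun sgn lam Lam
        (- (r^-1 * (N%:R - 1) * m_fun sgn lam Lam (derive1 v r))
         - `|u r| `^ (q - 1) * u r)).

Definition shooting_set (R : realType) (sgn : pucci_sign)
    (lam Lam p q : R) (N : nat) : set (R * R) :=
  [set xe | 0 < xe.1 /\ 0 < xe.2 /\
    exists u v : R -> R,
      positive_ivp_solution sgn lam Lam p q N xe.1 xe.2 u v].

Definition smooth_on (R : realType) (I : set R) (f : R -> R) : Prop :=
  forall (n : nat) (t : R), I t -> derivable (derive1n n f) t 1.

Definition simple_smooth_curve (R : realType) (I : set R) (g : R -> R * R) :
    Prop :=
  let g1 := fun t => (g t).1 in
  let g2 := fun t => (g t).2 in
  (forall s t, I s -> I t -> g s = g t -> s = t) /\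
  smooth_on I g1 /\ smooth_on I g2 /\
  (forall t, I t -> (derive1 g1 t, derive1 g2 t) <> (0, 0)).

(* Main.v *)
(** On radial pairs the system is a singular ODE system in [r = |x|], and two
    solutions with [u(0) = U(0)], [v(0) < V(0)] stay ordered: [u > U],
    [v < V], and the differences move apart.  In a ball this contradicts the
    boundary condition of whichever solution vanishes first; on the whole space
    it keeps [u] away from [0], so that the equation for [v] drives [v] below
    [0].  Hence [u(0)] determines [v(0)], and then the whole solution, while the
    scaling makes [u(0)] arbitrary.

    Dirichlet solutions are radial by moving planes.  The difference of a
    solution and its reflection is a supersolution of the minimal Pucci
    operator with a right-hand side that is only [O(d^(th - 1))] in the distance
    [d] to the sphere (the powers may be smaller than one, but Hopf's lemma
    gives [u, v >= c d]); the barrier [1 + L d - K d^(1 + th)] absorbs it. *)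
Require Import Defs.
From HB Require Import structures.
From mathcomp Require Import all_boot all_order all_algebra.
From mathcomp Require Import all_classical all_reals all_analysis.
From mathcomp Require Import ring lra complex spectral.
Import Order.TTheory GRing.Theory Num.Theory.
Import numFieldNormedType.Exports.
Local Open Scope classical_set_scope.
Local Open Scope ring_scope.


Set Implicit Arguments.
Unset Strict Implicit.
Unset Printing Implicit Defensive.

(** * The radial system *)

(** Two features rule out standard arguments: exponents may be below one, so the powers are
    Lipschitz only away from zero, and the coefficient [1 / r] is unbounded at the centre. In the
    comparison of two radial solutions both are met by monotonicity: [m] and [M] are increasing, so
    the singular term always has the favourable sign, and local uniqueness is invoked only where [u]
    and [v] are positive.

    The Pucci operators are not linear. A difference is handled through a finite family of vectors
    [k i] with [lam |h|^2 <= sum_i (h . k i)^2 <= Lam |h|^2], which may depend on the point and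
    along which second derivatives are summed. This is a linear elliptic operator that involves only
    second derivatives along lines, so no Hessian of a reflected function or of a barrier has to be
    formed.

    The planes move down to the centre: strict order is available only for [mu > 0], the plane
    [mu = 0] is a limit, and the directions [e] and [- e] together give invariance under every
    reflection through the origin. *)

Section OneVariable.
Variable R : realType.
Implicit Types (f g : R -> R) (a b x y d l : R).

Lemma near_right_oo a b : a < b -> \forall x \near a^'+, a < x < b.
Proof.
move=> ab; near=> x; apply/andP; split; near: x.
  exact: nbhs_right_gt.
exact: nbhs_right_lt.
Unshelve. all: by end_near. Qed.

Lemma near_right_ex (P : R -> Prop) a : (\forall r \near a^'+, P r) ->
  exists2 e, a < e & forall r, a < r < e -> P r.
Proof.
move=> /nbhs_ballP[e /= e0 H]; exists (a + e); first by rewrite ltrDl.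
move=> r /andP[ar re]; apply: H => //.
by rewrite /ball/= ltr0_norm ?subr_lt0// opprB ltrBlDl.
Qed.

Lemma near_left_oo a b : a < b -> \forall x \near b^'-, a < x < b.
Proof.
move=> ab; near=> x; apply/andP; split; near: x.
  exact: nbhs_left_gt.
exact: nbhs_left_lt.
Unshelve. all: by end_near. Qed.

Lemma is_derive1B f g x (df dg : R) : is_derive x 1 f df -> is_derive x 1 g dg ->
  is_derive x 1 (fun t => f t - g t) (df - dg).
Proof. exact: (@is_deriveB _ _ _ f g). Qed.

Lemma is_derive1D f g x (df dg : R) : is_derive x 1 f df -> is_derive x 1 g dg ->
  is_derive x 1 (fun t => f t + g t) (df + dg).
Proof. exact: (@is_deriveD _ _ _ f g). Qed.

Lemma is_derive1N f x (df : R) : is_derive x 1 f df ->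
  is_derive x 1 (fun t => - f t) (- df).
Proof. exact: (@is_deriveN _ _ _ f). Qed.

Lemma is_derive1Zl f x (df c : R) : is_derive x 1 f df ->
  is_derive x 1 (fun t => c * f t) (c * df).
Proof. exact: (@is_deriveZ _ _ _ f c). Qed.

Lemma is_derive1_affine (c y x : R) : is_derive x 1 (fun t => c * (t - y)) c.
Proof.
have := is_derive1Zl c (is_derive1B (is_derive_id x 1) (is_derive_cst y x 1)).
by rewrite subr0 mulr1.
Qed.

Lemma cvg_right_affine (c a : R) : c * (t - a) @[t --> a^'+] --> (0 : R).
Proof.
have -> : 0 = c * (a - a) :> R by rewrite subrr mulr0.
apply: cvgM; first exact: cvg_cst.
by apply: cvgB; [exact/cvg_at_right_filter/cvg_id|exact: cvg_cst].
Qed.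

Lemma cvg_right_opp0 f a : f r @[r --> a^'+] --> (0 : R) ->
  - f r @[r --> a^'+] --> (0 : R).
Proof. by move=> fl; rewrite -oppr0; exact: cvgN. Qed.

Lemma is_derive_gt0_near f x d : is_derive x 1 f d -> 0 < d ->
  (\forall y \near x^'+, f x < f y) /\ (\forall y \near x^'-, f y < f x).
Proof.
move=> fd d0.
have /cvgrPdist_lt/(_ d d0) : h^-1 *: (f (h *: 1 + x) - f x) @[h --> 0^'] --> d.
  by have [ex <-] := fd; exact: ex.
move=> /nbhs_ballP[e /= e0 H].
have K h : h != 0 -> `|h| < e -> 0 < h^-1 * (f (h + x) - f x).
  move=> h0 he; have := H h; rewrite /ball/= sub0r normrN => /(_ he h0).
  rewrite /GRing.scale/= mulr1 ltr_norml => /andP[_]; lra.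
split; near=> y.
  have xy : x < y by near: y; exact: nbhs_right_gt.
  have ye : y < x + e by near: y; apply: nbhs_right_lt; rewrite ltrDl.
  have := K (y - x); rewrite subr_eq0 gt_eqF// => /(_ isT).
  rewrite gtr0_norm ?subr_gt0// subrK pmulr_rgt0 ?invr_gt0 ?subr_gt0//.
  by apply; lra.
have xy : y < x by near: y; exact: nbhs_left_lt.
have ye : x - e < y by near: y; apply: nbhs_left_gt; rewrite ltrBlDr ltrDl.
have := K (y - x); rewrite subr_eq0 lt_eqF// => /(_ isT).
rewrite ltr0_norm ?subr_lt0// subrK nmulr_rgt0 ?invr_lt0 ?subr_lt0//.
by apply; lra.
Unshelve. all: by end_near. Qed.

Lemma is_derive_continuous f x d : is_derive x 1 f d -> {for x, continuous f}.
Proof.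
by case=> fx _; apply/differentiable_continuous/derivable1_diffP.
Qed.

Lemma oo_within_continuous f (f' : R -> R) a b x y : a < x -> y < b ->
  (forall r, a < r < b -> is_derive r 1 f (f' r)) ->
  {within `[x, y], continuous f}.
Proof.
move=> ax yb H; apply: continuous_in_subspaceT => z /set_mem /=.
rewrite in_itv/= => /andP[xz zy].
have zab : a < z < b by rewrite (lt_le_trans ax)//= (le_lt_trans zy).
exact: is_derive_continuous (H z zab).
Qed.

Lemma oo_MVT f (f' : R -> R) a b x y : a < x -> x < y -> y < b ->
  (forall r, a < r < b -> is_derive r 1 f (f' r)) ->
  exists2 c, x < c < y & f y - f x = f' c * (y - x).
Proof.
move=> ax xy yb H.
have Dxy z : z \in `]x, y[ -> is_derive z 1 f (f' z).
  rewrite in_itv/= => /andP[xz zy]; apply: H.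
  by rewrite (lt_trans ax)//= (lt_trans zy).
have [c] := MVT xy Dxy (oo_within_continuous ax yb H).
by rewrite in_itv/= => cxy ->; exists c.
Qed.

(* At an interior minimum with [g <= 0] the derivative would vanish, so a
   nonpositive value of [g] forces [g] to be increasing and negative all the
   way down to [a]. *)
Lemma pos_from_left g (g' : R -> R) a b l :
  (forall r, a < r < b -> is_derive r 1 g (g' r)) ->
  g r @[r --> a^'+] --> l -> 0 <= l ->
  (forall r, a < r < b -> g r <= 0 -> 0 < g' r) ->
  forall r, a < r < b -> 0 < g r.
Proof.
move=> Dg gl l0 Hg r0 /andP[ar0 r0b]; rewrite ltNge; apply/negP => gr0.
have neg s : a < s < r0 -> g s < 0.
  move=> /andP[as_ sr0]; rewrite ltNge; apply/negP => gs.
  have [c] := EVT_min (ltW sr0) (oo_within_continuous as_ r0b Dg).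
  rewrite in_itv/= => /andP[sc cr0] cmin.
  have r0ab : a < r0 < b by rewrite ar0.
  have [_ lft] := is_derive_gt0_near (Dg r0 r0ab) (Hg r0 r0ab gr0).
  near r0^'- => t.
  have /andP[st tr0] : s < t < r0 by near: t; exact: near_left_oo.
  have gt : g t < g r0 by near: t.
  have gcr : g c < g r0.
    apply: le_lt_trans gt; apply: cmin; by rewrite in_itv/= !ltW.
  have cr0' : c < r0.
    by rewrite lt_neqAle cr0 andbT; apply: contraTneq gcr => ->; rewrite ltxx.
  have sc' : s < c.
    rewrite lt_neqAle sc andbT; apply: contraTneq gcr => <-.
    by rewrite -leNgt (le_trans gr0).
  have cab : a < c < b by rewrite (lt_trans as_)//= (lt_trans cr0').
  have [_ gc0] : is_derive c 1 g 0.
    apply: (derive1_at_min (ltW sr0)) => [t0||t0]; rewrite in_itv/= ?sc'//.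
      move=> /andP[h1 h2].
      have t0ab : a < t0 < b by rewrite (lt_trans as_)//= (lt_trans h2).
      by have [] := Dg t0 t0ab.
    by move=> /andP[h1 h2]; apply: cmin; rewrite in_itv/= !ltW.
  have := Hg c cab (ltW (lt_le_trans gcr gr0)).
  by have [_ <-] := Dg c cab; rewrite gc0 ltxx.
pose s0 := (a + r0) / 2.
have [as0 s0r] : a < s0 /\ s0 < r0 by rewrite /s0; split; lra.
have gs0 : g s0 < 0 by apply: neg; rewrite as0.
suff : l <= g s0 by apply/negP; rewrite -ltNge (lt_le_trans gs0).
have cg : ProperFilter (at_right a) by typeclasses eauto.
rewrite -(cvg_lim (@Rhausdorff R) gl); apply: limr_le.
  by apply/cvg_ex; exists l.
near=> t.
have /andP[at_ ts0] : a < t < s0 by near: t; exact: near_right_oo.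
have [c /andP[tc cs0]] := oo_MVT at_ ts0 (lt_trans s0r r0b) Dg.
move=> E; rewrite -subr_ge0 E mulr_ge0 ?subr_ge0 ?(ltW ts0)// ltW//.
have [ac cr0] : a < c /\ c < r0.
  by rewrite (lt_trans at_)// (lt_trans cs0).
by apply: Hg; [rewrite ac (lt_trans cr0)|apply/ltW/neg; rewrite ac].
Unshelve. all: by end_near. Qed.

End OneVariable.

(** * Continuation arguments, estimates of powers, and the functions [m] and [M] *)

Section RadialODE.
Variable R : realType.
Implicit Types (f g : R -> R) (a b x y d l r t : R).

(** A continuation argument: at the infimum [t] of the points with [g <= 0], positivity before [t]
    gives [0 < g t] by hypothesis, and continuity at [t] then keeps those points away from it. *)
Lemma pos_propagates g (g' : R -> R) a b l :
  (forall r, a < r < b -> is_derive r 1 g (g' r)) ->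
  g r @[r --> a^'+] --> l -> 0 < l ->
  (forall t, a < t < b -> (forall s, a < s < t -> 0 < g s) -> 0 < g t) ->
  forall r, a < r < b -> 0 < g r.
Proof.
move=> Dg gl l0 Hg r1 /andP[ar1 r1b]; rewrite ltNge; apply/negP => gr1.
have [e e0 He] : exists2 e, a < e & forall s, a < s < e -> 0 < g s.
  have /cvgrPdist_lt/(_ l l0)/nbhs_ballP[e /= e0 H] := gl.
  exists (a + e); first by rewrite ltrDl.
  move=> s /andP[as_ se]; have := H s.
  rewrite /ball/= ltr0_norm ?subr_lt0// opprB ltrBlDl se => /(_ isT as_).
  by rewrite ltr_norml => /andP[_]; lra.
pose A := [set s | a < s <= r1 /\ g s <= 0].
have A0 : nonempty A by exists r1; rewrite /A/= ar1 lexx.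
have lbA : lbound A e.
  move=> s [/andP[as_ _] gs]; rewrite leNgt; apply/negP => se.
  by have := He s; rewrite as_ se => /(_ isT); rewrite ltNge gs.
have hA : has_inf A by split => //; exists e.
pose t := inf A.
have et : e <= t by exact: lb_le_inf.
have tr1 : t <= r1 by apply: ge_inf; [exists e|rewrite /A/= ar1 lexx].
have tab : a < t < b by rewrite (lt_le_trans e0)// (le_lt_trans tr1).
have gt0 : 0 < g t.
  apply: Hg => // s /andP[as_ st]; rewrite ltNge; apply/negP => gs.
  have : A s by rewrite /A/= as_ gs ltW// (lt_le_trans st).
  by move=> /(ge_inf (ex_intro _ e lbA)); rewrite leNgt st.
have /is_derive_continuous/cvgrPdist_lt/(_ _ gt0)/nbhs_ballP[d /= d0 H] := Dg t tab.
have [s [/andP[as_ sr1] gs] std] := inf_adherent d0 hA.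
have ts : t <= s by apply: ge_inf; [exists e|rewrite /A/= as_].
have := H s; rewrite /ball/= ler0_norm ?subr_le0// opprB ltrBlDl std => /(_ isT).
by rewrite ltr_norml => /andP[_]; lra.
Qed.

Lemma incr_from_left g (g' : R -> R) a b l :
  (forall r, a < r < b -> is_derive r 1 g (g' r)) ->
  g r @[r --> a^'+] --> l ->
  (forall r, a < r < b -> 0 <= g' r) ->
  forall r, a < r < b -> l <= g r.
Proof.
move=> Dg gl g'0 r /andP[ar rb].
have cg : ProperFilter (at_right a) by typeclasses eauto.
rewrite -(cvg_lim (@Rhausdorff R) gl); apply: limr_le.
  by apply/cvg_ex; exists l.
near=> t.
have /andP[at_ tr] : a < t < r by near: t; exact: near_right_oo.
have [c /andP[tc cr]] := oo_MVT at_ tr rb Dg.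
move=> E; rewrite -subr_ge0 E mulr_ge0 ?subr_ge0 ?(ltW tr)//.
by apply: g'0; rewrite (lt_trans at_)//= (lt_trans cr).
Unshelve. all: by end_near. Qed.

Lemma sincr_from_left g (g' : R -> R) a b l :
  (forall r, a < r < b -> is_derive r 1 g (g' r)) ->
  g r @[r --> a^'+] --> l ->
  (forall r, a < r < b -> 0 < g' r) ->
  forall r, a < r < b -> l < g r.
Proof.
move=> Dg gl g'0 r /andP[ar rb].
pose s := (a + r) / 2.
have [as_ sr] : a < s /\ s < r by rewrite /s; split; lra.
have [c /andP[sc cr] E] := oo_MVT as_ sr rb Dg.
have : l <= g s.
  apply: (incr_from_left Dg gl _ (r := s)) => [r0 h|].
    exact/ltW/g'0.
  by rewrite as_ (lt_trans sr).
move=> /le_lt_trans; apply.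
rewrite -subr_gt0 E mulr_gt0 ?subr_gt0//.
by apply: g'0; rewrite (lt_trans as_)//= (lt_trans cr).
Qed.

(** For [1 <= p] this is the mean value theorem; for [p < 1], with [z = y / x < 1], it follows from
    [z <= z ^ p]. The slope is taken at the larger point [x], so [y] may be [0]; this is what admits
    exponents below one in the moving plane estimate. *)
Lemma powR_sub_le p x y : 0 < p -> 0 < x -> 0 <= y -> y <= x ->
  x `^ p - y `^ p <= (1 + p) * x `^ (p - 1) * (x - y).
Proof.
move=> p0 x0 y0 yx.
have xp : x `^ p = x `^ (p - 1) * x by rewrite mulrC mulr_powRB1// ltW.
have xp0 : 0 < x `^ (p - 1) by exact: powR_gt0.
have [->|yN0] := eqVneq y 0.
  rewrite powR0 ?gt_eqF// !subr0 xp -mulrA ler_peMl ?mulr_ge0 ?(ltW x0)// ?ltW//.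
  lra.
have y0' : 0 < y by rewrite lt_neqAle eq_sym yN0.
have [<-|yNx] := eqVneq y x; first by rewrite !subrr mulr0.
have yx' : y < x by rewrite lt_neqAle yNx.
have [p1|p1] := leP 1 p.
  have D r : 0 < r < x + 1 -> is_derive r 1 (@powR R ^~ p) (p * r `^ (p - 1)).
    by move=> /andP[r0 _]; exact: is_derive1_powR.
  have [c /andP[yc cx] ->] : exists2 c, y < c < x &
      x `^ p - y `^ p = p * c `^ (p - 1) * (x - y).
    by apply: (oo_MVT y0' yx' _ D); rewrite ltrDl.
  rewrite ler_wpM2r ?subr_ge0//.
  have : c `^ (p - 1) <= x `^ (p - 1).
    have c0 := lt_trans y0' yc.
    by rewrite ge0_ler_powR ?subr_ge0 ?nnegrE ?(ltW c0) ?(ltW x0) ?(ltW cx).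
  have := powR_ge0 c (p - 1); nra.
have -> : y `^ p = x `^ p * (y / x) `^ p.
  by rewrite -powRM ?divr_ge0 ?ltW// mulrC divfK ?gt_eqF.
have : y / x <= (y / x) `^ p.
  apply: ger1_powR; last exact: ltW.
  by rewrite divr_gt0//= ler_pdivrMr// mul1r.
have : y = y / x * x by rewrite divfK ?gt_eqF.
set z := y / x => -> zz; rewrite xp.
have : 0 < x `^ (p - 1) * x by rewrite mulr_gt0.
set X := x `^ (p - 1); set Z := z `^ p in zz * => Xx.
have : (1 - Z) * (X * x) <= (1 - z) * (X * x) by rewrite ler_wpM2r ?(ltW Xx)//; lra.
have : 0 <= p * ((1 - z) * (X * x)).
  by rewrite !mulr_ge0 ?(ltW p0) ?(ltW xp0) ?(ltW x0)// subr_ge0 ler_pdivrMr// mul1r.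
by move=> h1 h2; rewrite -subr_ge0; nra.
Qed.

(** The slope [x ^ (p - 1)] is monotone in one direction or the other; the sum of its values at [c]
    and [C] bounds it in both cases. *)
Lemma powR_lipschitz p (c C : R) : 0 < p -> 0 < c ->
  exists2 L, 0 < L & forall x y, c <= x <= C -> c <= y <= C ->
    `|x `^ p - y `^ p| <= L * `|x - y|.
Proof.
move=> p0 c0; exists ((1 + p) * (c `^ (p - 1) + C `^ (p - 1))).
  by rewrite mulr_gt0 ?(addr_gt0 ltr01 p0)// ltr_wpDr ?powR_gt0 ?powR_ge0.
have H x y : c <= x <= C -> c <= y <= C -> y <= x ->
    x `^ p - y `^ p <= (1 + p) * (c `^ (p - 1) + C `^ (p - 1)) * (x - y).
  move=> /andP[cx xC] /andP[cy _] yx.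
  have x0 : 0 < x by rewrite (lt_le_trans c0).
  have C0 : 0 < C by rewrite (lt_le_trans x0).
  have y0 : 0 < y by rewrite (lt_le_trans c0).
  apply: (le_trans (powR_sub_le p0 x0 (ltW y0) yx)).
  rewrite ler_wpM2r ?subr_ge0// ler_wpM2l ?addr_ge0 ?(ltW p0)//.
  have [p1|/ltW p1] := leP 0 (p - 1).
    by rewrite -[leLHS]add0r lerD ?powR_ge0// ge0_ler_powR ?nnegrE ?(ltW x0) ?(ltW C0).
  rewrite -[leLHS]addr0 lerD ?powR_ge0//.
  have -> : p - 1 = - (1 - p) by rewrite opprB.
  rewrite (powRN x) (powRN c) lef_pV2 ?posrE ?powR_gt0//.
  by rewrite ge0_ler_powR ?nnegrE ?(ltW x0) ?(ltW c0)// -oppr_le0 opprB.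
move=> x y hx hy; have [yx|/ltW xy] := leP y x.
  rewrite !ger0_norm ?subr_ge0//; first exact: H.
  move/andP: hx hy => [cx _] /andP[cy _].
  by rewrite ge0_ler_powR ?nnegrE ?(ltW p0) ?(le_trans (ltW c0) cx) ?(le_trans (ltW c0) cy).
rewrite distrC (distrC x) !ger0_norm ?subr_ge0//; first exact: H.
move/andP: hx hy => [cx _] /andP[cy _].
by rewrite ge0_ler_powR ?nnegrE ?(ltW p0) ?(le_trans (ltW c0) cx) ?(le_trans (ltW c0) cy).
Qed.

Lemma piecewise_linear_lt (c d x y : R) : 0 < c -> 0 < d -> x < y ->
  (if x <= 0 then x * c else x * d) < (if y <= 0 then y * c else y * d).
Proof.
move=> c0 d0 xy; case: (leP x 0) => x0; case: (leP y 0) => y0.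
- by rewrite ltr_pM2r.
- by rewrite (@le_lt_trans _ _ 0) ?mulr_gt0// mulr_le0_ge0// ltW.
- by have := lt_trans x0 (lt_le_trans xy y0); rewrite ltxx.
- by rewrite ltr_pM2r.
Qed.

Variables (sgn : pucci_sign) (lam Lam : R).
Hypotheses (lam0 : 0 < lam) (lamLam : lam <= Lam).
Let m := m_fun sgn lam Lam.
Let M := M_fun sgn lam Lam.

Let Lam0 : 0 < Lam. Proof. exact: lt_le_trans lamLam. Qed.
Let iL0 : 0 < Lam^-1. Proof. by rewrite invr_gt0. Qed.
Let iLl : Lam^-1 <= lam^-1. Proof. by rewrite lef_pV2. Qed.

Lemma m_fun_le : {homo m : x y / x <= y}.
Proof.
move=> x y; rewrite le_eqVlt => /predU1P[->//|xy]; apply: ltW.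
by rewrite /m /m_fun !(mulrC lam) !(mulrC Lam); case: sgn;
  exact: piecewise_linear_lt.
Qed.

Lemma m_fun_ge x : x <= 0 -> Lam * x <= m x.
Proof. by move=> x0; rewrite /m /m_fun x0; case: sgn => //; rewrite ler_wnM2r. Qed.

Lemma m_funZ (c x : R) : 0 < c -> m (c * x) = c * m x.
Proof.
by move=> c0; rewrite /m /m_fun pmulr_rle0//; case: sgn; case: ifP => _; rewrite mulrCA.
Qed.

Lemma M_funZ (c x : R) : 0 < c -> M (c * x) = c * M x.
Proof.
by move=> c0; rewrite /M /M_fun pmulr_rle0//; case: sgn; case: ifP => _; rewrite mulrA.
Qed.

Lemma M_fun_lt : {homo M : x y / x < y}.
Proof.
have il0 : 0 < lam^-1 by rewrite invr_gt0.
by move=> x y; rewrite /M /M_fun; case: sgn; exact: piecewise_linear_lt.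
Qed.

Lemma M_fun_lip x y : y <= x -> M x - M y <= (x - y) / lam.
Proof.
move=> yx.
suff H c d : c <= lam^-1 -> d <= lam^-1 ->
    (if x <= 0 then x * c else x * d) - (if y <= 0 then y * c else y * d) <=
    (x - y) / lam by rewrite /M /M_fun; case: sgn; exact: H.
set i := lam^-1 => ci di; case: (leP x 0) => x0; case: (leP y 0) => y0.
- by rewrite -mulrBl ler_wpM2l// subr_ge0.
- by have := lt_le_trans y0 (le_trans yx x0); rewrite ltxx.
- have : x * d <= x * i by rewrite ler_wpM2l// ltW.
  by have : y * i <= y * c by [rewrite ler_wnM2l]; rewrite mulrBl; lra.
- by rewrite -mulrBl ler_wpM2l// subr_ge0.
Qed.

Lemma M_fun_neg x : x <= 0 -> M x <= x / Lam.
Proof. by move=> x0; rewrite /M /M_fun x0; case: sgn => //; rewrite ler_wnM2l. Qed.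

(** This is what solves the radial Pucci equation for the second derivative. *)
Lemma M_mK x : M (m x) = x.
Proof.
have L0 := Lam0.
by rewrite /M /m /M_fun /m_fun; case: sgn; case: (leP x 0) => x0;
  rewrite ?pmulr_rle0// ?x0 ?(lt_geF x0) ?pmulr_rle0// ?x0 ?(lt_geF x0) mulrC mulKf ?gt_eqF.
Qed.

End RadialODE.

(** * Ordering of two radial solutions *)

Section RadialSystem.
Variables (R : realType) (sgn : pucci_sign) (lam Lam k p q : R).
Hypotheses (lam0 : 0 < lam) (lamLam : lam <= Lam) (k0 : 0 <= k).
Hypotheses (p0 : 0 < p) (q0 : 0 < q).
Implicit Types (u v U V f : R -> R) (a b r s t d l xi eta : R).

Let m := m_fun sgn lam Lam.
Let M := M_fun sgn lam Lam.

(** A single equation with its exponent as a parameter: the system is [radial_eq p u v] and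
    [radial_eq q v u], so each statement serves both components. [k] stands for [N - 1], and [v ^ s]
    replaces [|v|^(s - 1) v] since only positive [v] occur. *)
Definition radial_eq s u v r := [/\ derivable u r 1, derivable (derive1 u) r 1 &
  derive1 (derive1 u) r = M (- (r^-1 * k * m (derive1 u r)) - v r `^ s)].

Definition radial_sol s1 s2 a b u v := forall r, a < r < b ->
  [/\ 0 < u r, 0 < v r, radial_eq s1 u v r & radial_eq s2 v u r].

Lemma derivable1_is_derive f r : derivable f r 1 -> is_derive r 1 f (derive1 f r).
Proof. by move=> /derivableP; rewrite -derive1E. Qed.

Lemma radial_sol_sub s1 s2 a b c d u v : a <= c -> d <= b ->
  radial_sol s1 s2 a b u v -> radial_sol s1 s2 c d u v.
Proof.
by move=> ac db H r /andP[cr rd]; apply: H; rewrite (le_lt_trans ac)//= (lt_le_trans rd).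
Qed.

Lemma radial_eq_is_deriveB s u v U V r : radial_eq s u v r -> radial_eq s U V r ->
  is_derive r 1 (fun r => u r - U r) (derive1 u r - derive1 U r) /\
  is_derive r 1 (fun r => derive1 u r - derive1 U r) (derive1 (derive1 u) r - derive1 (derive1 U) r).
Proof.
move=> [u1 u2 _] [U1 U2 _].
split; [exact: (is_derive1B (derivable1_is_derive u1) (derivable1_is_derive U1))|].
exact: (is_derive1B (derivable1_is_derive u2) (derivable1_is_derive U2)).
Qed.

Lemma coefM_le a b r x y : 0 <= a -> a < r < b -> x <= y ->
  - (r^-1 * k * m y) <= - (r^-1 * k * m x).
Proof.
move=> a0 /andP[ar _] xy; rewrite lerN2 ler_wpM2l ?mulr_ge0 ?invr_ge0//.
  by rewrite ltW// (le_lt_trans a0).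
exact: m_fun_le.
Qed.

(** Where [u' <= U'], the singular term of [u] is at least that of [U], and [v < V] makes the other
    term strictly larger, so [u'' > U''] as [M] is increasing. Hence [pos_from_left] applies to
    [u' - U'] without any bound on [1 / r]. *)
Lemma radial_deriv_lt s u v U V a b : 0 < s -> 0 <= a ->
  (forall r, a < r < b -> radial_eq s u v r) ->
  (forall r, a < r < b -> radial_eq s U V r) ->
  (forall r, a < r < b -> 0 <= v r < V r) ->
  derive1 u r - derive1 U r @[r --> a^'+] --> (0 : R) ->
  forall r, a < r < b -> derive1 U r < derive1 u r.
Proof.
move=> s0 a0 Eu EU vV cv r rab; rewrite -subr_gt0.
apply: (pos_from_left _ cv (lexx 0) _ rab).
  by move=> t tab; exact: (radial_eq_is_deriveB (Eu t tab) (EU t tab)).2.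
move=> t tab; rewrite subr_le0 => uU; rewrite subr_gt0.
have [_ _ ->] := Eu t tab; have [_ _ ->] := EU t tab.
apply: M_fun_lt => //; apply: ler_ltD; first exact: (coefM_le a0 tab).
have /andP[v0 vVt] := vV t tab.
by rewrite ltrN2 gt0_ltr_powR ?nnegrE// ltW// (le_lt_trans v0).
Qed.

(** The previous argument against the zero function: a point with [0 <= u'] has [u'' < 0]. *)
Lemma radial_deriv_lt0 s u v a b : 0 < s -> 0 <= a ->
  (forall r, a < r < b -> radial_eq s u v r) ->
  (forall r, a < r < b -> 0 < v r) ->
  derive1 u r @[r --> a^'+] --> (0 : R) ->
  forall r, a < r < b -> derive1 u r < 0.
Proof.
move=> s0 a0 Eu v0 cv r rab; rewrite -oppr_gt0.
have cv' := cvg_right_opp0 cv.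
apply: (pos_from_left (g' := fun r => - derive1 (derive1 u) r) _ cv' (lexx 0) _ rab).
  move=> t tab; apply: is_derive1N; apply: derivable1_is_derive.
  by have [] := Eu t tab.
move=> t tab; rewrite oppr_le0 oppr_gt0 => ut.
have [_ _ ->] := Eu t tab.
have M0 : M 0 = 0 by rewrite /M /M_fun !mul0r; case: sgn; case: ifP.
have m0 : m 0 = 0 by rewrite /m /m_fun !mulr0; case: sgn; case: ifP.
rewrite -[ltRHS]M0; apply: M_fun_lt => //.
have := coefM_le a0 tab ut; rewrite m0 mulr0 oppr0.
by have : 0 < v t `^ s by [rewrite powR_gt0// v0]; lra.
Qed.

(** The coupling closes on itself: as long as [v < V], the equation for [u] gives [u' > U'], hence
    [u > U]; then the equation for [v] gives [v' < V'], so [V - v] increases and the assumed order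
    cannot be lost. *)
Lemma order_from_left u v U V b d :
  radial_sol p q 0 b u v -> radial_sol p q 0 b U V ->
  u r - U r @[r --> 0^'+] --> (0 : R) ->
  V r - v r @[r --> 0^'+] --> d -> 0 < d ->
  derive1 u r - derive1 U r @[r --> 0^'+] --> (0 : R) ->
  derive1 V r - derive1 v r @[r --> 0^'+] --> (0 : R) ->
  forall r, 0 < r < b ->
    [/\ U r < u r, v r < V r, derive1 U r < derive1 u r & derive1 v r < derive1 V r].
Proof.
move=> S1 S2 cu cv d0 cu' cv'.
have sub t r : 0 < t < b -> 0 < r < t -> 0 < r < b.
  by move=> /andP[_ tb] /andP[-> /=] /lt_trans; exact.
have key t : 0 < t <= b -> (forall s, 0 < s < t -> v s < V s) ->
    forall r, 0 < r < t -> [/\ U r < u r, derive1 U r < derive1 u r & derive1 v r < derive1 V r].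
  move=> /andP[_ tb] vV.
  have T1 := radial_sol_sub (lexx 0) tb S1.
  have T2 := radial_sol_sub (lexx 0) tb S2.
  have Uu' : forall r, 0 < r < t -> derive1 U r < derive1 u r.
    apply: (radial_deriv_lt p0 (lexx 0) (v := v) (V := V) _ _ _ cu') => r rt.
    - by have [] := T1 r rt.
    - by have [] := T2 r rt.
    - by have [_ v0 _ _] := T1 r rt; rewrite ltW//= vV.
  have Uu : forall r, 0 < r < t -> U r < u r.
    move=> r rt; rewrite -subr_gt0.
    apply: (sincr_from_left (g' := fun r => derive1 u r - derive1 U r) _ cu _ rt) => s st; last first.
      by rewrite subr_gt0; exact: Uu'.
    have [_ _ e1 _] := T1 s st; have [_ _ e2 _] := T2 s st.
    by have [] := radial_eq_is_deriveB e1 e2.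
  have vV' : forall r, 0 < r < t -> derive1 v r < derive1 V r.
    apply: (radial_deriv_lt q0 (lexx 0) (v := U) (V := u) _ _ _ cv') => r rt.
    - by have [] := T2 r rt.
    - by have [] := T1 r rt.
    - by have [U0 _ _ _] := T2 r rt; rewrite ltW//= Uu.
  by move=> r rt; split; [exact: Uu|exact: Uu'|exact: vV'].
have DV t : 0 < t < b -> is_derive t 1 (fun r => V r - v r) (derive1 V t - derive1 v t).
  move=> tb; have [_ _ _ e1] := S2 t tb; have [_ _ _ e2] := S1 t tb.
  by have [] := radial_eq_is_deriveB e1 e2.
have vV : forall r, 0 < r < b -> v r < V r.
  move=> r rb; rewrite -subr_gt0.
  apply: (pos_propagates DV cv d0 _ rb) => t tb pos.
  have {}pos s : 0 < s < t -> v s < V s by move=> /pos; rewrite subr_gt0.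
  have tb' : 0 < t <= b by move/andP: tb => [-> /ltW].
  have K := key t tb' pos.
  pose s := t / 2.
  have [s0 st] : 0 < s /\ s < t by move/andP: tb => [? _]; rewrite /s; split; lra.
  have := pos s; rewrite s0 st => /(_ isT); rewrite -subr_gt0 => /lt_le_trans; apply.
  rewrite leNgt; apply/negP => lt_ts.
  have /andP[t0 tb1] := tb.
  have [c /andP[sc ct] E] := oo_MVT s0 st tb1 DV.
  move: lt_ts; rewrite -subr_lt0 E ltNge mulr_ge0// ?subr_ge0 ?ltW//.
  by have [|_ _ //] := K c; rewrite ct (lt_trans s0).
move=> r rb; have [r0 rb'] := andP rb.
have bb : 0 < b <= b by rewrite lexx (lt_trans r0).
by have [] := key b bb vV r rb; split => //; exact: vV.
Qed.

(* A contraction estimate: applied with [S] a bound for [`|v - V|], in both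
   components, it halves the distance of two solutions with equal data. *)
Lemma diff_le_half s (L S : R) u v U V a b : 0 <= a -> 0 < L -> 0 < S ->
  4 * L * (b - a) ^+ 2 <= lam ->
  (forall r, a < r < b -> radial_eq s u v r) ->
  (forall r, a < r < b -> radial_eq s U V r) ->
  (forall r, a < r < b -> `|v r `^ s - V r `^ s| <= L * S) ->
  u r - U r @[r --> a^'+] --> (0 : R) ->
  derive1 u r - derive1 U r @[r --> a^'+] --> (0 : R) ->
  forall r, a < r < b -> u r - U r <= S / 2.
Proof.
move=> a0 L0 S0 small Eu EU vV cu cu' r rab.
have [ar rb] := andP rab.
(* Wherever [u' >= U'] the singular term is favourable and [M] has slopes at most [1 / lam], so
   [u'' - U'' <= L * S / lam]. The factor 2 makes the comparison of [u' - U'] with [K * (t - a)]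
   strict. *)
pose K := 2 * L * S / lam.
have K0 : 0 < K by rewrite /K divr_gt0// !mulr_gt0.
have DB t (tab : a < t < b) := radial_eq_is_deriveB (Eu t tab) (EU t tab).
have cK := cvg_right_affine K a.
have step t : a < t < b -> derive1 u t - derive1 U t < K * (t - a).
  move=> tab; rewrite -subr_gt0.
  apply: (pos_from_left (g := fun t => K * (t - a) - (derive1 u t - derive1 U t))
     (g' := fun t => K - (derive1 (derive1 u) t - derive1 (derive1 U) t)) _ _ (lexx 0) _ tab).
  - move=> y yab; apply: is_derive1B; last by have [] := DB y yab.
    exact: is_derive1_affine.
  - by rewrite -[X in _ --> X]subr0; exact: cvgB.
  move=> y yab; rewrite subr_le0 => h.
  have [ay yb] := andP yab.
  have uU : derive1 U y <= derive1 u y.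
    by rewrite -subr_ge0 (le_trans _ h)// mulr_ge0 ?subr_ge0 ?ltW.
  rewrite subr_gt0.
  have [_ _ ->] := Eu y yab; have [_ _ ->] := EU y yab.
  set x1 := (X in M X - _); set x2 := (X in _ - M X).
  have x12 : x1 - x2 <= L * S.
    rewrite /x1 /x2; have := coefM_le a0 yab uU.
    by have := vV y yab; rewrite ler_norml => /andP[]; lra.
  apply: (@le_lt_trans _ _ (L * S / lam)); last first.
    by rewrite /K ltr_pM2r ?invr_gt0//; have := mulr_gt0 L0 S0; nra.
  have [x21|/ltW x12'] := leP x2 x1.
    by apply: le_trans (M_fun_lip sgn lam0 lamLam x21) _; rewrite ler_pM2r ?invr_gt0.
  apply: (@le_trans _ _ 0); last by rewrite divr_ge0 ?mulr_ge0 ?ltW.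
  rewrite subr_le0; move: x12'; rewrite le_eqVlt => /predU1P[->//|xx].
  by apply/ltW/M_fun_lt.
pose Kb := K * (b - a).
have ba : a < b by exact: lt_trans rb.
have cKb : Kb * (t - a) - (u t - U t) @[t --> a^'+] --> (0 : R).
  by rewrite -[X in _ --> X]subr0; exact: (cvgB (cvg_right_affine Kb a) cu).
have : 0 <= Kb * (r - a) - (u r - U r).
  apply: (incr_from_left (g' := fun t => Kb - (derive1 u t - derive1 U t)) _ cKb _ rab).
    move=> y yab; apply: is_derive1B; last by have [] := DB y yab.
    exact: is_derive1_affine.
  move=> y yab; rewrite subr_ge0 (le_trans (ltW (step y yab)))// /Kb.
  by have [ay yb] := andP yab; rewrite ler_pM2l// lerD2r ltW.
rewrite subr_ge0 => /le_trans; apply.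
apply: (@le_trans _ _ (K * (b - a) ^+ 2)).
  rewrite expr2 mulrA -/Kb ler_pM2l ?lerD2r ?ltW// /Kb mulr_gt0// subr_gt0//.
rewrite /K mulrAC ler_pdivrMr//.
have -> : 2 * L * S * (b - a) ^+ 2 = (4 * L * (b - a) ^+ 2) * (S / 2) by field.
by rewrite mulrC ler_pM2l// divr_gt0.
Qed.

End RadialSystem.

(** * Uniqueness for the radial initial value problem *)

Section RadialUniqueness.
Variables (R : realType) (sgn : pucci_sign) (lam Lam k p q : R).
Hypotheses (lam0 : 0 < lam) (lamLam : lam <= Lam) (k0 : 0 <= k).
Hypotheses (p0 : 0 < p) (q0 : 0 < q).
Implicit Types (u v U V f : R -> R) (a b r s t d l xi eta : R).

Let eqn := radial_eq sgn lam Lam k.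
Let sol := radial_sol sgn lam Lam k.

Definition starts a u xi :=
  u r @[r --> a^'+] --> xi /\ derive1 u r @[r --> a^'+] --> (0 : R).

Lemma cvg_right_bounds a u xi : 0 < xi -> u r @[r --> a^'+] --> xi ->
  exists2 e, a < e & forall r, a < r < e -> xi / 2 <= u r <= 2 * xi.
Proof.
move=> xi0 cu; apply: near_right_ex.
have x2 : 0 < xi / 2 by rewrite divr_gt0.
move/cvgrPdist_le/(_ _ x2) : cu; apply: filterS => r.
by rewrite distrC ler_distl => /andP[]; lra.
Qed.

Lemma cvg_right0N a f g : f r - g r @[r --> a^'+] --> (0 : R) ->
  g r - f r @[r --> a^'+] --> (0 : R).
Proof.
move=> /cvgN; rewrite oppr0; apply: cvg_trans.
by apply: near_eq_cvg; near=> r; rewrite /= opprB.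
Unshelve. all: by end_near. Qed.

Lemma cvg_right_eqB a f g l : f r @[r --> a^'+] --> l ->
  g r @[r --> a^'+] --> l -> f r - g r @[r --> a^'+] --> (0 : R).
Proof. by move=> fl gl; rewrite -(subrr l); exact: (cvgB fl gl). Qed.

(** On a short interval the four functions stay in some [[c, C]] with [c > 0], where the powers are
    Lipschitz. There [diff_le_half] bounds the supremum of [|u - U|] and [|v - V|] by its own half.
    Only the differences of the derivatives must vanish at [a], so the lemma serves both at the
    singular origin and for a restart at an interior point. *)
Lemma uniqueness_near a b u v U V xi eta : 0 <= a -> a < b ->
  sol p q a b u v -> sol p q a b U V -> 0 < xi -> 0 < eta ->
  u r @[r --> a^'+] --> xi -> U r @[r --> a^'+] --> xi ->
  v r @[r --> a^'+] --> eta -> V r @[r --> a^'+] --> eta ->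
  derive1 u r - derive1 U r @[r --> a^'+] --> (0 : R) ->
  derive1 v r - derive1 V r @[r --> a^'+] --> (0 : R) ->
  exists2 e, a < e & forall r, a < r < e -> u r = U r /\ v r = V r.
Proof.
move=> a0 ab S1 S2 xi0 eta0 cu cU cv cV cu' cv'.
have [e1 ae1 B1] := cvg_right_bounds xi0 cu.
have [e2 ae2 B2] := cvg_right_bounds xi0 cU.
have [e3 ae3 B3] := cvg_right_bounds eta0 cv.
have [e4 ae4 B4] := cvg_right_bounds eta0 cV.
pose c := Num.min (xi / 2) (eta / 2); pose C := Num.max (2 * xi) (2 * eta).
have c0 : 0 < c by rewrite lt_min !divr_gt0.
have [Lp Lp0 HLp] := powR_lipschitz C p0 c0.
have [Lq Lq0 HLq] := powR_lipschitz C q0 c0.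
pose L := Lp + Lq; have L0 : 0 < L by rewrite addr_gt0.
(* The bound by [1] gives [d ^ 2 <= d]; the other one is then the smallness that [diff_le_half]
   requires. *)
pose d := Num.min 1 (lam / (4 * L)).
have d0 : 0 < d by rewrite lt_min ltr01 divr_gt0// mulr_gt0.
pose e := Num.min (Num.min (Num.min e1 e2) (Num.min e3 e4)) (Num.min b (a + d)).
have ae : a < e by rewrite !lt_min ae1 ae2 ae3 ae4 ab ltrDl.
have eb : e <= b by rewrite /e !ge_min lexx !orbT.
have small : 4 * L * (e - a) ^+ 2 <= lam.
  have h1 : 0 <= e - a by rewrite subr_ge0 ltW.
  have h2 : e - a <= d by rewrite lerBlDl /e !ge_min lexx !orbT.
  have h3 : d <= 1 by rewrite /d ge_min lexx.
  have h4 : 4 * L * d <= lam.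
    have : d <= lam / (4 * L) by rewrite /d ge_min lexx orbT.
    by rewrite ler_pdivlMr ?mulr_gt0// mulrC.
  apply: le_trans h4; rewrite ler_pM2l ?mulr_gt0// expr2.
  by nra.
have bnd r : a < r < e -> [/\ c <= u r <= C, c <= U r <= C, c <= v r <= C &
    c <= V r <= C].
  move=> /andP[ar]; rewrite !lt_min => /andP[/andP[/andP[r1 r2] /andP[r3 r4]] _].
  have /B1/andP[? ?] : a < r < e1 by rewrite ar.
  have /B2/andP[? ?] : a < r < e2 by rewrite ar.
  have /B3/andP[? ?] : a < r < e3 by rewrite ar.
  have /B4/andP[? ?] : a < r < e4 by rewrite ar.
  by split; rewrite /c /C ge_min le_max; apply/andP; split;
    apply/orP; by [left|right].
have T1 := radial_sol_sub (lexx a) eb S1.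
have T2 := radial_sol_sub (lexx a) eb S2.
pose A := [set x | exists2 r, a < r < e & x = `|u r - U r| \/ x = `|v r - V r|].
have ubA : ubound A C.
  have H x y : c <= x <= C -> c <= y <= C -> `|x - y| <= C.
    move: c0 => {}c0; clearbody c C; move=> /andP[? ?] /andP[? ?].
    by rewrite ler_norml; apply/andP; split; lra.
  by move=> x [r /bnd[h1 h2 h3 h4]] [->|->]; exact: H.
have Aub : has_ubound A by exists C.
have half : 0 < sup A -> forall x, A x -> x <= sup A / 2.
  move=> S0 x [r rae xr].
  have wle y : a < y < e -> `|u y - U y| <= sup A.
    by move=> ye; apply: ub_le_sup => //; exists y => //; left.
  have zle y : a < y < e -> `|v y - V y| <= sup A.
    by move=> ye; apply: ub_le_sup => //; exists y => //; right.
  have vp y : a < y < e -> `|v y `^ p - V y `^ p| <= L * sup A.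
    move=> ye; have [_ _ h3 h4] := bnd y ye.
    apply: (le_trans (HLp _ _ h3 h4)); apply: ler_pM (zle y ye) => //.
      exact: ltW.
    by rewrite lerDl ltW.
  have uq y : a < y < e -> `|u y `^ q - U y `^ q| <= L * sup A.
    move=> ye; have [h1 h2 _ _] := bnd y ye.
    apply: (le_trans (HLq _ _ h1 h2)); apply: ler_pM (wle y ye) => //.
      exact: ltW.
    by rewrite lerDr ltW.
  have vp' y : a < y < e -> `|V y `^ p - v y `^ p| <= L * sup A.
    by rewrite distrC; exact: vp.
  have uq' y : a < y < e -> `|U y `^ q - u y `^ q| <= L * sup A.
    by rewrite distrC; exact: uq.
  have E1 y : a < y < e -> eqn p u v y by move=> /T1[].
  have E2 y : a < y < e -> eqn q v u y by move=> /T1[].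
  have E3 y : a < y < e -> eqn p U V y by move=> /T2[].
  have E4 y : a < y < e -> eqn q V U y by move=> /T2[].
  have cw : u y - U y @[y --> a^'+] --> (0 : R) by exact: cvg_right_eqB cu cU.
  have cz : v y - V y @[y --> a^'+] --> (0 : R) by exact: cvg_right_eqB cv cV.
  have h1 := diff_le_half lam0 lamLam k0 a0 L0 S0 small E1 E3 vp cw cu' rae.
  have h2 := diff_le_half lam0 lamLam k0 a0 L0 S0 small E3 E1 vp'
    (cvg_right0N cw) (cvg_right0N cu') rae.
  have h3 := diff_le_half lam0 lamLam k0 a0 L0 S0 small E2 E4 uq cz cv' rae.
  have h4 := diff_le_half lam0 lamLam k0 a0 L0 S0 small E4 E2 uq'
    (cvg_right0N cz) (cvg_right0N cv') rae.
  by case: xr => ->; rewrite ler_norml lerNl opprB ?h1 ?h2 ?h3 ?h4.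
exists e => // r rae.
have Aw : A `|u r - U r| by exists r => //; left.
have Az : A `|v r - V r| by exists r => //; right.
have supA : sup A <= 0.
  rewrite leNgt; apply/negP => S0.
  have : sup A <= sup A / 2.
    by apply: ge_sup (half S0); exists `|u r - U r|.
  by rewrite leNgt ltr_pdivrMr// ltr_pMr// ltr1n.
split; apply/eqP; rewrite -subr_eq0 -normr_le0; apply: le_trans supA.
  exact: ub_le_sup.
exact: ub_le_sup.
Qed.

Lemma continuous_zero_from_left f t : 0 < t -> {for t, continuous f} ->
  (forall r, 0 < r < t -> f r = 0) -> f t = 0.
Proof.
move=> t0 ft f0.
have /(cvg_lim (@Rhausdorff R)) <- := cvg_at_left_filter ft.
apply: (cvg_lim (@Rhausdorff R)).
apply: cvg_near_cst.
by near=> r; apply: f0; near: r; exact: near_left_oo.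
Unshelve. all: by end_near. Qed.

Lemma derive1_eq_oo f g a b : (forall r, a < r < b -> f r = g r) ->
  forall r, a < r < b -> derive1 f r = derive1 g r.
Proof.
move=> fg r rab; rewrite !derive1E; apply: near_eq_derive.
have : r \in `]a, b[ by rewrite in_itv.
by move=> /near_in_itvoo; apply: filterS => x; rewrite in_itv/= => /fg.
Qed.

(** Continuation from the infimum [t] of the points of disagreement: if [0 < t], values and
    derivatives agree at [t] by continuity, and if [t = 0] the initial data agree, so
    [uniqueness_near] extends the agreement beyond [t]. *)
Lemma uniqueness_oo T u v U V xi eta :
  sol p q 0 T u v -> sol p q 0 T U V -> 0 < xi -> 0 < eta ->
  starts 0 u xi -> starts 0 U xi -> starts 0 v eta -> starts 0 V eta ->
  forall r, 0 < r < T -> u r = U r /\ v r = V r.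
Proof.
move=> S1 S2 xi0 eta0 [cu cu'] [cU cU'] [cv cv'] [cV cV'] r1 r1T.
apply: contrapT => neq.
pose D := [set r | 0 < r < T /\ ~ (u r = U r /\ v r = V r)].
have lbD : lbound D 0 by move=> r [/andP[/ltW]].
have D0 : nonempty D by exists r1.
have hD : has_inf D by split => //; exists 0.
pose t := inf D.
have t0 : 0 <= t by exact: lb_le_inf.
have tr1 : t <= r1 by apply: ge_inf; [exists 0|].
have tT : t < T by move/andP: r1T => [_]; exact: le_lt_trans.
have Deq r : 0 < r < t -> u r = U r /\ v r = V r.
  move=> /andP[r0 rt]; apply: contrapT => ne.
  have : t <= r by apply: ge_inf; [exists 0|split; rewrite // r0 (lt_trans rt)].
  by rewrite leNgt rt.
suff [te [e ete He]] : (0 < t -> u t = U t /\ v t = V t) /\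
    exists2 e, t < e & forall r, t < r < e -> u r = U r /\ v r = V r.
  have et0 : 0 < e - t by rewrite subr_gt0.
  have [r [/andP[r0 rT] ne] re] := inf_adherent et0 hD; apply: (ne).
  have : t <= r by apply: ge_inf; [exists 0|split; rewrite ?r0].
  rewrite le_eqVlt => /predU1P[tr|tr]; first by rewrite -tr; apply: te; rewrite tr.
  by apply: He; rewrite tr/= -(subrK t e) addrC.
have [t0'|t0'] := leP t 0.
  have tE : t = 0 by apply/eqP; rewrite eq_le t0 t0'.
  have tT0 : 0 < T by rewrite -tE.
  rewrite tE; split; first by move=> h; have := ltxx (0 : R); rewrite h.
  apply: (uniqueness_near (lexx 0) tT0 S1 S2 xi0 eta0) => //.
    exact: cvg_right_eqB cu' cU'.
  exact: cvg_right_eqB cv' cV'.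
have tT' : 0 < t < T by rewrite t0'.
have [u0 v0 [u1 u2 _] [v1 v2 _]] := S1 t tT'.
have [U0 V0 [U1 U2 _] [V1 V2 _]] := S2 t tT'.
have cont f : derivable f t 1 -> {for t, continuous f}.
  by move=> ?; apply/differentiable_continuous/derivable1_diffP.
have agree f g : derivable f t 1 -> derivable g t 1 ->
    (forall r, 0 < r < t -> f r = g r) -> f t = g t.
  move=> ft gt fg; apply/eqP; rewrite -subr_eq0; apply/eqP.
  apply: (@continuous_zero_from_left (fun r => f r - g r) t t0').
    by apply: continuousB; exact: cont.
  by move=> r /fg ->; rewrite subrr.
have uU : u t = U t := agree _ _ u1 U1 (fun r rt => (Deq r rt).1).
have vV : v t = V t := agree _ _ v1 V1 (fun r rt => (Deq r rt).2).
have uU' : derive1 u t = derive1 U t.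
  exact: (agree _ _ u2 U2 (derive1_eq_oo (fun r rt => (Deq r rt).1))).
have vV' : derive1 v t = derive1 V t.
  exact: (agree _ _ v2 V2 (derive1_eq_oo (fun r rt => (Deq r rt).2))).
split => //.
have rl f : derivable f t 1 -> f r @[r --> t^'+] --> f t.
  by move=> ft; apply: cvg_at_right_filter; exact: cont.
have du : derive1 u r - derive1 U r @[r --> t^'+] --> (0 : R).
  by apply: cvg_right_eqB (rl _ U2); rewrite -uU'; exact: (rl _ u2).
have dv : derive1 v r - derive1 V r @[r --> t^'+] --> (0 : R).
  by apply: cvg_right_eqB (rl _ V2); rewrite -vV'; exact: (rl _ v2).
have tU : U r @[r --> t^'+] --> u t by rewrite uU; exact: (rl _ U1).
have tV : V r @[r --> t^'+] --> v t by rewrite vV; exact: (rl _ V1).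
exact: (uniqueness_near t0 tT (radial_sol_sub t0 (lexx T) S1)
  (radial_sol_sub t0 (lexx T) S2) u0 v0 (rl _ u1) tU (rl _ v1) tV du dv).
Qed.

End RadialUniqueness.

(** * Scaling and global comparison of radial solutions *)

Section RadialComparison.
Variables (R : realType) (sgn : pucci_sign) (lam Lam k p q : R).
Hypotheses (lam0 : 0 < lam) (lamLam : lam <= Lam) (k0 : 0 <= k).
Hypotheses (p0 : 0 < p) (q0 : 0 < q).
Implicit Types (u v U V f : R -> R) (a b r s t d l xi eta : R).

Let m := m_fun sgn lam Lam.
Let M := M_fun sgn lam Lam.
Let eqn := radial_eq sgn lam Lam k.
Let sol := radial_sol sgn lam Lam k.

(** Under [d ^ s = c * gam ^ 2] every term of the equation scales by [c * gam ^ 2], and [m] and [M]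
    are positively homogeneous. With [c = gam ^ alpha] and [d = gam ^ beta] this is the scaling of
    the system. *)
Lemma radial_scale_eq s (gam c d a b : R) u v r : 0 < gam -> 0 < c -> 0 < r -> 0 < d ->
  d `^ s = c * gam ^+ 2 ->
  (forall t, a < t < b -> derivable u t 1) -> a < gam * r < b ->
  0 < v (gam * r) ->
  eqn s u v (gam * r) ->
  derive1 (fun t => c * u (gam * t)) r = c * gam * derive1 u (gam * r) /\
  eqn s (fun t => c * u (gam * t)) (fun t => d * v (gam * t)) r.
Proof.
move=> g0 c0 r0 d0 ds du rab vr [u1 u2 u3].
have Dlin t : is_derive t 1 (fun t => gam * t) gam.
  by have := is_derive1Zl gam (is_derive_id t 1); rewrite mulr1.
have D f t : derivable f (gam * t) 1 ->
    is_derive t 1 (fun t => c * f (gam * t)) (c * gam * derive1 f (gam * t)).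
  move=> ft; rewrite -mulrA; apply: is_derive1Zl; rewrite mulrC.
  exact: (is_derive1_comp (derivable1_is_derive ft) (Dlin t)).
have nr : \forall t \near r, derivable u (gam * t) 1.
  have itvE t : (t \in `]a / gam, b / gam[) = (a < gam * t < b).
    by rewrite in_itv/= ltr_pdivrMr// ltr_pdivlMr// mulrC.
  have : r \in `]a / gam, b / gam[ by rewrite itvE.
  move=> /near_in_itvoo; apply: filterS => t; rewrite itvE => h.
  exact: (du _ h).
have E1 : \forall t \near r,
    c * gam * derive1 u (gam * t) = derive1 (fun t => c * u (gam * t)) t.
  by apply: filterS nr => t /D[_ <-]; rewrite derive1E.
have D2 : is_derive r 1 (derive1 (fun t => c * u (gam * t)))
    (c * gam ^+ 2 * derive1 (derive1 u) (gam * r)).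
  apply: near_eq_is_derive E1 _.
  have := is_derive1Zl gam (D _ _ u2).
  rewrite [gam * _](_ : _ = c * gam ^+ 2 * derive1 (derive1 u) (gam * r)); last by ring.
  apply: near_eq_is_derive; near=> t; ring.
have E1r := nbhs_singleton E1; split; first by rewrite -E1r.
split.
- by have [] := D u r u1.
- by have [] := D2.
have [_ e2] := D2; rewrite [LHS]derive1E e2 u3 -E1r.
rewrite -/M -M_funZ ?mulr_gt0 ?exprn_gt0//; congr (M _).
rewrite m_funZ ?mulr_gt0// powRM ?ltW// ds.
rewrite invfM -/m; field.
by rewrite !gt_eqF.
Unshelve. all: by end_near. Qed.

(** With [u] bounded below, [v'] decreases at least linearly, [v' < - K * r]: at a point with
    [v' >= - K * r] the equation gives [v'' < - K]. Such a [v] cannot stay positive. *)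
Lemma no_entire_bounded_below s d u v : 0 < s -> 0 < d ->
  (forall r, 0 < r -> eqn s v u r) -> (forall r, 0 < r -> d <= u r) ->
  (forall r, 0 < r -> 0 < v r) ->
  derive1 v r @[r --> 0^'+] --> (0 : R) -> False.
Proof.
move=> s0 d0 Ev ud v0 cv.
have L0 : 0 < Lam by exact: lt_le_trans lamLam.
(* Small enough for [(k * Lam * K - d ^ s) / Lam < - K], where [k * Lam * K] bounds the singular
   term at points with [v' >= - K * r]. *)
pose K := d `^ s / (2 * Lam * (k + 1)).
have ds0 : 0 < d `^ s by exact: powR_gt0.
have k1 : 0 < k + 1 by rewrite ltr_wpDl.
have K0 : 0 < K by rewrite divr_gt0// !mulr_gt0.
have KE : k * Lam * K + Lam * K = d `^ s / 2.
  by rewrite /K; field; rewrite !gt_eqF.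
have Kx : k * Lam * K - d `^ s <= 0.
  by have := mulr_gt0 L0 K0; lra.
have cK := cvg_right_affine K 0.
have cg : - derive1 v r - K * (r - 0) @[r --> 0^'+] --> (0 : R).
  exact: (cvg_right_eqB (cvg_right_opp0 cv) cK).
have rate T r : 0 < r < T -> derive1 v r < - (K * r).
  move=> rT; rewrite -ltrN2 opprK -subr_gt0 -[X in K * X]subr0.
  apply: (pos_from_left (g' := fun r => - derive1 (derive1 v) r - K) _ cg (lexx 0) _ rT).
    move=> t /andP[t0 _]; apply: is_derive1B; last exact: is_derive1_affine.
    by have [_ v2 _] := Ev t t0; apply: is_derive1N; exact: derivable1_is_derive.
  move=> t /andP[t0 _]; rewrite subr0 subr_le0 => h.
  have [_ _ ->] := Ev t t0.
  rewrite subr_gt0 -ltrN2 opprK.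
  have h1 : - (K * t) <= derive1 v t by rewrite lerNl.
  have h2 : - (Lam * (K * t)) <= m (derive1 v t).
    apply: le_trans (m_fun_le sgn lam0 lamLam h1).
    rewrite -mulrN; apply: m_fun_ge => //.
    by rewrite oppr_le0 mulr_ge0// ltW.
  have h3 : - (t^-1 * k * m (derive1 v t)) <= k * Lam * K.
    have -> : k * Lam * K = - (t^-1 * k * - (Lam * (K * t))).
      by field; rewrite gt_eqF.
    by rewrite lerN2 ler_wpM2l// mulr_ge0// invr_ge0 ltW.
  have h4 : d `^ s <= u t `^ s.
    by rewrite ge0_ler_powR ?nnegrE ?(ltW s0) ?(ltW d0) ?ud// (le_trans (ltW d0))// ud.
  apply: (@le_lt_trans _ _ (M (k * Lam * K - d `^ s))).
    have : - (t^-1 * k * m (derive1 v t)) - u t `^ s <= k * Lam * K - d `^ s.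
      by rewrite lerB.
    rewrite le_eqVlt => /predU1P[->//|?]; exact/ltW/M_fun_lt.
  apply: le_lt_trans (M_fun_neg sgn lam0 lamLam Kx) _.
  by rewrite ltr_pdivrMr//; have := mulr_gt0 L0 K0; lra.
(* Over [[1, T]], where [v' < - K], the drop of [v] exceeds [K * (T - 1) = K + v 1]. *)
pose T := 2 + v 1 / K.
have v1 : 0 < v 1 by exact: v0.
have T1 : 1 < T.
  by rewrite /T; have := divr_gt0 v1 K0; lra.
have DT r : 0 < r < T + 1 -> is_derive r 1 v (derive1 v r).
  by move=> /andP[/Ev[v' _ _] _]; exact: derivable1_is_derive.
have TT : T < T + 1 by rewrite ltrDl.
have [c /andP[c1 cT] E] := oo_MVT ltr01 T1 TT DT.
have := v0 T (lt_trans ltr01 T1).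
rewrite -(subrK (v 1) (v T)) E.
have : derive1 v c < - K.
  apply: (lt_trans (rate T c _)); first by rewrite cT (lt_trans ltr01).
  by rewrite ltrN2 ltr_pMr.
rewrite -(ltr_pM2r (_ : 0 < T - 1)) ?subr_gt0//.
have -> : - K * (T - 1) = - K - v 1 by rewrite /T; field; rewrite gt_eqF.
lra.
Qed.

Let itv1 r : 0 < r -> 0 < r < r + 1.
Proof. by move=> r0; rewrite r0 ltrDl ltr01. Qed.

Lemma entire_not_ordered u v U V xi eta eta' :
  (forall T, sol p q 0 T u v) -> (forall T, sol p q 0 T U V) ->
  starts 0 u xi -> starts 0 U xi -> starts 0 v eta -> starts 0 V eta' ->
  ~ eta < eta'.
Proof.
move=> S1 S2 [cu cu'] [cU cU'] [cv cv'] [cV cV'] lt_eta.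
have ord r : 0 < r -> [/\ U r < u r, v r < V r, derive1 U r < derive1 u r &
    derive1 v r < derive1 V r].
  move=> r0; apply: (order_from_left lam0 lamLam k0 p0 q0 (S1 (r + 1)) (S2 (r + 1))
    (d := eta' - eta)); rewrite ?subr_gt0//.
  - exact: (cvg_right_eqB cu cU).
  - exact: (cvgB cV cv).
  - exact: (cvg_right_eqB cu' cU').
  - exact: (cvg_right_eqB cV' cv').
  - exact: itv1.
have D1 r : 0 < r -> is_derive r 1 u (derive1 u r).
  move=> r0; apply: derivable1_is_derive.
  by have [_ _ [] //] := S1 _ _ (itv1 r0).
have D2 r : 0 < r -> is_derive r 1 U (derive1 U r).
  move=> r0; apply: derivable1_is_derive.
  by have [_ _ [] //] := S2 _ _ (itv1 r0).
have u'0 r : 0 < r -> derive1 u r < 0.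
  move=> r0.
  have e1 t : 0 < t < r + 1 -> eqn p u v t by move=> /S1[].
  have e2 t : 0 < t < r + 1 -> 0 < v t by move=> /S1[].
  exact: (radial_deriv_lt0 lam0 lamLam k0 p0 (lexx 0) e1 e2 cu' (itv1 r0)).
(* The lower bound for [u]: beyond [1] because [u - U] increases and [U] is positive, before [1]
   because [u] decreases and [u 1] exceeds [d]. *)
pose d := u 1 - U 1.
have d0 : 0 < d by rewrite subr_gt0; have [] := ord 1 ltr01.
apply: (@no_entire_bounded_below q d u v q0 d0) cv'.
- by move=> r r0; have [_ _ _] := S1 _ _ (itv1 r0).
- move=> r r0.
  have U0 t : 0 < t -> 0 < U t.
    by move=> t0; have [] := S2 _ _ (itv1 t0).
  have [r1|r1|->] := ltgtP r 1.
  + have D t : 0 < t < 2 -> is_derive t 1 u (derive1 u t) by move=> /andP[/D1].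
    have [c /andP[c1 c2] E] := oo_MVT r0 r1 (ltr1n R 2) D.
    have c0 := lt_trans r0 c1.
    have : u 1 <= u r by rewrite -subr_le0 E pmulr_lle0 ?subr_gt0// ltW// u'0.
    by have := U0 1 ltr01; rewrite /d; lra.
  + have D t : 0 < t < r + 1 -> is_derive t 1 (fun t => u t - U t) (derive1 u t - derive1 U t).
      by move=> /andP[t0 _]; apply: is_derive1B; [exact: D1|exact: D2].
    have rr : r < r + 1 by rewrite ltrDl.
    have [c /andP[c1 c2] E] := oo_MVT ltr01 r1 rr D.
    have c0 := lt_trans ltr01 c1.
    have : d <= u r - U r.
      rewrite -subr_ge0 E mulr_ge0 ?subr_ge0 ?(ltW r1)//.
      by have [_ _ /ltW ? _] := ord c c0.
    by have := U0 r r0; lra.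
  + by rewrite /d lerBlDr lerDl ltW// U0.
- by move=> r r0; have [_] := S1 _ _ (itv1 r0).
Qed.

Theorem entire_unique u v U V xi eta eta' : 0 < xi -> 0 < eta ->
  (forall T, sol p q 0 T u v) -> (forall T, sol p q 0 T U V) ->
  starts 0 u xi -> starts 0 U xi -> starts 0 v eta -> starts 0 V eta' ->
  eta = eta' /\ forall r, 0 < r -> u r = U r /\ v r = V r.
Proof.
move=> xi0 eta0 S1 S2 su sU sv sV.
have e : eta = eta'.
  have [h|h|//] := ltgtP eta eta'.
    by have := entire_not_ordered S1 S2 su sU sv sV h.
  by have := entire_not_ordered S2 S1 sU su sV sv h.
split => // r r0; rewrite -e in sV.
apply: (uniqueness_oo lam0 lamLam k0 p0 q0 (S1 (r + 1)) (S2 (r + 1)) xi0 eta0) => //.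
exact: itv1.
Qed.

Lemma left_limit_ge b d f g : 0 < b -> g r @[r --> b^'-] --> (0 : R) ->
  (forall r, b / 2 <= r < b -> d <= g r) -> d <= 0.
Proof.
move=> b0 cg h.
have PF : ProperFilter (at_left b) by typeclasses eauto.
rewrite -(cvg_lim (@Rhausdorff R) cg); apply: limr_ge.
  by apply/cvg_ex; exists 0.
near=> r; apply: h.
have /andP[h1 h2] : b / 2 < r < b.
  by near: r; apply: near_left_oo; lra.
by rewrite ltW.
Unshelve. all: by end_near. Qed.

(** The order holds up to the smaller radius [b]. If [b = S], then [u] tends to [0] there although
    [u >= u - U] and [u - U] increases from a positive value; if [b = T], the same contradiction
    arises for [V] and [V - v]. *)
Lemma dirichlet_not_ordered S T u v U V xi eta eta' : 0 < S -> 0 < T ->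
  sol p q 0 S u v -> sol p q 0 T U V ->
  starts 0 u xi -> starts 0 U xi -> starts 0 v eta -> starts 0 V eta' ->
  u r @[r --> S^'-] --> (0 : R) -> V r @[r --> T^'-] --> (0 : R) ->
  ~ eta < eta'.
Proof.
move=> S0 T0 S1 S2 [cu cu'] [cU cU'] [cv cv'] [cV cV'] zu zV lt_eta.
pose b := Num.min S T.
have b0 : 0 < b by rewrite lt_min S0.
have bS : b <= S by rewrite ge_min lexx.
have bT : b <= T by rewrite ge_min lexx orbT.
have T1 := radial_sol_sub (lexx 0) bS S1.
have T2 := radial_sol_sub (lexx 0) bT S2.
have ord : forall r, 0 < r < b -> [/\ U r < u r, v r < V r,
    derive1 U r < derive1 u r & derive1 v r < derive1 V r].
  apply: (order_from_left lam0 lamLam k0 p0 q0 T1 T2 (d := eta' - eta));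
    rewrite ?subr_gt0//.
  - exact: (cvg_right_eqB cu cU).
  - exact: (cvgB cV cv).
  - exact: (cvg_right_eqB cu' cU').
  - exact: (cvg_right_eqB cV' cv').
have mono (f g : R -> R) : (forall r, 0 < r < b -> derivable f r 1 /\ derivable g r 1) ->
    (forall r, 0 < r < b -> 0 < g r) ->
    (forall r, 0 < r < b -> derive1 g r < derive1 f r) ->
    forall r, b / 2 <= r < b -> f (b / 2) - g (b / 2) <= f r.
  move=> fg g0 fg' r /andP[]; rewrite le_eqVlt => /predU1P[<-|br] rb.
    by rewrite lerBlDr lerDl ltW// g0//; apply/andP; split; lra.
  have D t : 0 < t < b -> is_derive t 1 (fun t => f t - g t) (derive1 f t - derive1 g t).
    move=> /fg[ft gt].
    exact: (is_derive1B (derivable1_is_derive ft) (derivable1_is_derive gt)).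
  have b2 : 0 < b / 2 by rewrite divr_gt0.
  have [c /andP[c1 c2] E] := oo_MVT b2 br rb D.
  have : f (b / 2) - g (b / 2) <= f r - g r.
    rewrite -subr_ge0 E mulr_ge0 ?subr_ge0 ?(ltW br)// ltW// fg'//.
    by rewrite (lt_trans b2)// (lt_trans c2).
  move=> /le_trans; apply; rewrite lerBlDr lerDl ltW// g0//.
  by rewrite (lt_trans b2).
have b2b : 0 < b / 2 < b by apply/andP; split; lra.
have [w2 z2 _ _] := ord _ b2b.
have [ST|TS] := leP S T.
  have bE : b = S by rewrite /b min_l.
  have : u (b / 2) - U (b / 2) <= 0.
    apply: (@left_limit_ge b _ u u b0); first by rewrite bE.
    apply: mono => r rb.
    - by have [_ _ [] ? _ _ _] := T1 r rb; have [_ _ [] ? _ _ _] := T2 r rb.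
    - by have [] := T2 r rb.
    - by have [] := ord r rb.
  by rewrite leNgt subr_gt0 w2.
have bE : b = T by rewrite /b min_r// ltW.
have : V (b / 2) - v (b / 2) <= 0.
  apply: (@left_limit_ge b _ V V b0); first by rewrite bE.
  apply: mono => r rb.
  - by have [_ _ _ [] ? _ _] := T2 r rb; have [_ _ _ [] ? _ _] := T1 r rb.
  - by have [] := T1 r rb.
  - by have [] := ord r rb.
by rewrite leNgt subr_gt0 z2.
Qed.

Lemma common_zero_ge S T u U : 0 < S ->
  (forall r, 0 < r < T -> 0 < U r /\ derivable U r 1) ->
  (forall r, 0 < r < Num.min S T -> u r = U r) ->
  u r @[r --> S^'-] --> (0 : R) -> T <= S.
Proof.
move=> S0 U0 uU cu; rewrite leNgt; apply/negP => ST.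
have [US dU] : 0 < U S /\ derivable U S 1 by apply: U0; rewrite S0.
have /(cvg_lim (@Rhausdorff R)) cU : U r @[r --> S^'-] --> U S.
  by apply: cvg_at_left_filter; exact/differentiable_continuous/derivable1_diffP.
move: US; rewrite -cU ltNge => /negP; apply.
have -> : lim (U r @[r --> S^'-]) = 0; last by [].
apply: (cvg_lim (@Rhausdorff R)); apply: cvg_trans cu.
apply: near_eq_cvg; near=> r; apply: uU; rewrite min_l ?(ltW ST)//.
by near: r; exact: near_left_oo.
Unshelve. all: by end_near. Qed.

Theorem dirichlet_unique S T u v U V xi eta eta' : 0 < S -> 0 < T ->
  0 < xi -> 0 < eta ->
  sol p q 0 S u v -> sol p q 0 T U V ->
  starts 0 u xi -> starts 0 U xi -> starts 0 v eta -> starts 0 V eta' ->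
  u r @[r --> S^'-] --> (0 : R) -> v r @[r --> S^'-] --> (0 : R) ->
  U r @[r --> T^'-] --> (0 : R) -> V r @[r --> T^'-] --> (0 : R) ->
  [/\ eta = eta', S = T & forall r, 0 < r < T -> u r = U r /\ v r = V r].
Proof.
move=> S0 T0 xi0 eta0 S1 S2 su sU sv sV zu zv zU zV.
have e : eta = eta'.
  have [h|h|//] := ltgtP eta eta'.
    by have := dirichlet_not_ordered S0 T0 S1 S2 su sU sv sV zu zV h.
  by have := dirichlet_not_ordered T0 S0 S2 S1 sU su sV sv zU zv h.
rewrite -e in sV *.
have bS : Num.min S T <= S by rewrite ge_min lexx.
have bT : Num.min S T <= T by rewrite ge_min lexx orbT.
have eq := uniqueness_oo lam0 lamLam k0 p0 q0 (radial_sol_sub (lexx 0) bS S1)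
  (radial_sol_sub (lexx 0) bT S2) xi0 eta0 su sU sv sV.
have ST : S = T.
  apply/eqP; rewrite eq_le; apply/andP; split.
    apply: (common_zero_ge (U := u) (u := U) T0) zU.
      by move=> r /S1[u0 _ [] //].
    by rewrite minC => r /eq[].
  apply: (common_zero_ge (U := U) (u := u) S0) zu.
    by move=> r /S2[u0 _ [] //].
  by move=> r /eq[].
by split => // r; rewrite -{1}(minxx T) -{1}ST; exact: eq.
Qed.

End RadialComparison.

(** * Pucci operators *)

Section RealSpectral.
Variables (R : realType).
Local Notation C := (complex R).

Lemma Re_mul_conj (x y : C) : complex.Re (x^* * y) =
  complex.Re x * complex.Re y + complex.Im x * complex.Im y.
Proof. by case: x y => [a b] [c d] /=; rewrite mulNr opprK. Qed.

Lemma Re_real_mul (a : R) (x : C) : complex.Re ((real_complex R a) * x) = a * complex.Re x.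
Proof. by case: x => [c d] /=; rewrite mul0r subr0. Qed.

Lemma Re_sum (I : finType) (F : I -> C) : complex.Re (\sum_i F i) = \sum_i complex.Re (F i).
Proof. by apply: (big_morph (@complex.Re R)) => // -[a b] [c d]. Qed.

Lemma char_poly_conj (F : fieldType) n (P A : 'M[F]_n) : P \in unitmx ->
  char_poly (invmx P *m A *m P) = char_poly A.
Proof.
move=> Pu; rewrite /char_poly.
have -> : char_poly_mx (invmx P *m A *m P) =
    map_mx polyC (invmx P) *m char_poly_mx A *m map_mx polyC P.
  rewrite /char_poly_mx !map_mxM mulmxBr mulmxBl; congr (_ - _).
  by rewrite -mulmxA mul_scalar_mx -scalemxAr -map_mxM mulVmx// map_mx1 scalemx1.
by rewrite !det_mulmx mulrAC -det_mulmx -map_mxM mulVmx// map_mx1 det1 mul1r.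
Qed.

(* The columns of the conjugate of [X + i Y] are an orthonormal eigenbasis of
   [A] over the complex numbers. *)
Lemma symmetric_frame n (A : 'M[R]_n) : A^T = A ->
  exists (d : 'I_n -> R) (X Y : 'M[R]_n),
  [/\ char_poly A = \prod_(i < n) ('X - (d i)%:P),
      forall j k, A j k = \sum_i d i * (X i j * X i k + Y i j * Y i k),
      forall j k, \sum_i (X i j * X i k + Y i j * Y i k) = (j == k)%:R,
      forall i, \sum_j (X i j ^+ 2 + Y i j ^+ 2) = 1 &
      forall i, \sum_j \sum_k A j k * (X i j * X i k + Y i j * Y i k) = d i].
Proof.
move=> Asym.
pose AC : 'M[C]_n := map_mx (real_complex R) A.
have Areal : AC \is a mxOver Num.real.
  by apply/mxOverP => i j; rewrite mxE; apply/complex_realP; exists (A i j).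
have Aherm : AC \is hermitianmx _ false Num.conj.
  apply: realsym_hermsym => //; apply/is_hermitianmxP.
  by rewrite expr0 scale1r map_mx_id// map_trmx Asym.
have /orthomx_spectralP := hermitian_normalmx Aherm.
set P := spectralmx AC; set D := spectral_diag AC => AE.
have Pu : P \is unitarymx by exact: spectral_unitarymx.
have PPc := unitarymxP Pu.
have PcP : (map_mx Num.conj P^T) *m P = 1%:M by exact: mulmx1C.
have Pinv : invmx P = map_mx Num.conj P^T by exact: invmx_unitary.
have Dreal : D \is a mxOver Num.real by exact: hermitian_spectral_diag_real.
pose d i := complex.Re (D 0 i).
have dE i : D 0 i = real_complex R (d i).
  by rewrite /d RRe_real//; exact: (mxOverP Dreal).
pose X : 'M[R]_n := \matrix_(i, j) complex.Re (P i j).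
pose Y : 'M[R]_n := \matrix_(i, j) complex.Im (P i j).
exists d, X, Y; split.
- have : map_poly (real_complex R) (char_poly A) =
      map_poly (real_complex R) (\prod_(i < n) ('X - (d i)%:P)).
    rewrite map_char_poly -/AC rmorph_prod/=.
    rewrite AE char_poly_conj ?spectral_unit// char_poly_trig ?diag_mx_is_trig//.
    by apply: eq_bigr => i _; rewrite map_polyXsubC/= -dE mxE eqxx.
  by apply: map_poly_inj.
- move=> j k.
  have : complex.Re (AC j k) = A j k by rewrite mxE.
  move=> <-; rewrite [in LHS]AE Pinv -mulmxA mxE Re_sum; apply: eq_bigr => i _.
  rewrite mul_diag_mx !mxE dE mulrCA Re_real_mul.
  by rewrite Re_mul_conj.
- move=> j k; have := congr1 (fun M : 'M[C]_n => complex.Re (M j k)) PcP.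
  rewrite !mxE Re_sum => E.
  rewrite -[RHS](_ : complex.Re ((j == k)%:R : C) = _); last by case: eqP.
  rewrite -E; apply: eq_bigr => i _; rewrite !mxE.
  by rewrite Re_mul_conj.
- move=> i; have := congr1 (fun M : 'M[C]_n => complex.Re (M i i)) PPc.
  rewrite !mxE Re_sum eqxx /= => <-; apply: eq_bigr => j _; rewrite !mxE.
  by rewrite mulrC Re_mul_conj !expr2.
- move=> i.
  have : P *m AC *m (map_mx Num.conj P^T) = diag_mx D.
    by rewrite {1}AE Pinv !mulmxA PPc mul1mx -mulmxA PPc mulmx1.
  move=> /(congr1 (fun M : 'M[C]_n => complex.Re (M i i))).
  rewrite mxE Re_sum [in RHS]mxE eqxx mulr1n -/(d i) => <-.
  rewrite exchange_big/=; apply: eq_bigr => k _.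
  rewrite [(P *m AC) i k]mxE mulr_suml Re_sum; apply: eq_bigr => j _.
  rewrite !mxE (mulrAC (P i j)) (mulrC _ (real_complex R (A j k))).
  rewrite (mulrC (P i j) (P i k)^*).
  by rewrite Re_real_mul Re_mul_conj; ring.
Qed.

End RealSpectral.

(** * Pucci operators as extremal linear elliptic operators *)

Section Pucci.
Variables (R : realType).

Definition dot n (h k : 'rV[R]_n) : R := \sum_(i < n) h ord0 i * k ord0 i.

Definition qform n (A : 'M[R]_n) (h : 'rV[R]_n) : R :=
  \sum_(j < n) \sum_(k < n) A j k * (h ord0 j * h ord0 k).

(** The family [k] stands for the coefficient matrix [sum_i (k i)^T (k i)], whose spectrum lies in
    [[lam, Lam]]. In this form the linear operator applied to a Hessian [A] is
    [sum_i qform A (k i)], a sum of second derivatives along lines. *)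
Definition elliptic (lam Lam : R) n (I : finType) (k : I -> 'rV[R]_n) :=
  forall h, lam * dot h h <= \sum_i dot h (k i) ^+ 2 <= Lam * dot h h.

Lemma dotC n (h k : 'rV[R]_n) : dot h k = dot k h.
Proof. by apply: eq_bigr => i _; rewrite mulrC. Qed.

Lemma dotDl n (h1 h2 k : 'rV[R]_n) : dot (h1 + h2) k = dot h1 k + dot h2 k.
Proof. by rewrite -big_split; apply: eq_bigr => i _; rewrite mxE mulrDl. Qed.

Lemma dotDr n (h k1 k2 : 'rV[R]_n) : dot h (k1 + k2) = dot h k1 + dot h k2.
Proof. by rewrite dotC dotDl !(dotC h). Qed.

Lemma dotZl n (a : R) (h k : 'rV[R]_n) : dot (a *: h) k = a * dot h k.
Proof. by rewrite mulr_sumr; apply: eq_bigr => i _; rewrite mxE mulrA. Qed.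

Lemma dotZr n (a : R) (h k : 'rV[R]_n) : dot h (a *: k) = a * dot h k.
Proof. by rewrite dotC dotZl dotC. Qed.

Lemma dotNl n (h k : 'rV[R]_n) : dot (- h) k = - dot h k.
Proof. by rewrite -scaleN1r dotZl mulN1r. Qed.

Lemma dotNr n (h k : 'rV[R]_n) : dot h (- k) = - dot h k.
Proof. by rewrite dotC dotNl dotC. Qed.

Lemma dotBl n (h1 h2 k : 'rV[R]_n) : dot (h1 - h2) k = dot h1 k - dot h2 k.
Proof. by rewrite dotDl dotNl. Qed.

Lemma dotBr n (h k1 k2 : 'rV[R]_n) : dot h (k1 - k2) = dot h k1 - dot h k2.
Proof. by rewrite dotDr dotNr. Qed.

Lemma dot_ge0 n (h : 'rV[R]_n) : 0 <= dot h h.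
Proof. by apply: sumr_ge0 => i _; rewrite -expr2 sqr_ge0. Qed.

Lemma dot_eq0 n (h : 'rV[R]_n) : (dot h h == 0) = (h == 0).
Proof.
rewrite psumr_eq0; last by move=> i _; rewrite -expr2 sqr_ge0.
apply/allP/eqP => [h0|-> i _]; last by rewrite /= mxE mul0r eqxx.
apply/rowP => i; rewrite [RHS]mxE; apply/eqP.
by have := h0 i; rewrite mem_index_enum => /(_ isT); rewrite -expr2 sqrf_eq0.
Qed.

Lemma dot_delta n (i : 'I_n) (h : 'rV[R]_n) : dot (delta_mx ord0 i) h = h ord0 i.
Proof.
rewrite /dot (bigD1 i)//= mxE !eqxx mul1r big1 ?addr0// => j ji.
by rewrite mxE (negbTE ji) andbF mul0r.
Qed.

Lemma dot_sqr n (h k : 'rV[R]_n) : dot h k ^+ 2 =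
  \sum_(i < n) \sum_(j < n) h ord0 i * h ord0 j * (k ord0 i * k ord0 j).
Proof.
rewrite expr2 mulr_suml; apply: eq_bigr => i _.
by rewrite mulr_sumr; apply: eq_bigr => j _; rewrite mulrACA.
Qed.

Lemma qform_frame n (A : 'M[R]_n) (d : 'I_n -> R) (X Y : 'M[R]_n) h :
  (forall j k, A j k = \sum_i d i * (X i j * X i k + Y i j * Y i k)) ->
  qform A h = \sum_i d i * (dot h (row i X) ^+ 2 + dot h (row i Y) ^+ 2).
Proof.
move=> AE; rewrite /qform.
under eq_bigr do under eq_bigr do rewrite AE mulr_suml.
under eq_bigr do rewrite exchange_big/=.
rewrite exchange_big/=; apply: eq_bigr => i _.
rewrite !dot_sqr -big_split/= mulr_sumr; apply: eq_bigr => j _.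
rewrite -big_split/= mulr_sumr; apply: eq_bigr => k _.
by rewrite !mxE; ring.
Qed.

Lemma elliptic_trace (lam Lam : R) n (I : finType) (k : I -> 'rV[R]_n) :
  elliptic lam Lam k -> lam * n%:R <= \sum_i dot (k i) (k i) <= Lam * n%:R.
Proof.
move=> ell.
have -> : \sum_i dot (k i) (k i) =
    \sum_(j < n) \sum_i dot (delta_mx ord0 j) (k i) ^+ 2.
  rewrite [RHS]exchange_big/=; apply: eq_bigr => i _; apply: eq_bigr => j _.
  by rewrite dot_delta expr2.
have nE (c : R) : c * n%:R = \sum_(j < n) c.
  by rewrite sumr_const card_ord mulr_natr.
rewrite !nE; apply/andP; split; apply: ler_sum => j _;
  have /andP[] := ell (delta_mx ord0 j);
  by rewrite dot_delta mxE !eqxx !mulr1.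
Qed.

Variables (lam Lam : R).
Hypotheses (lam0 : 0 < lam) (lamLam : lam <= Lam).

Lemma pucci_eigen sgn n (A : 'M[R]_n) :
  pucci sgn lam Lam A = \sum_(e <- eigenvalues A) m_fun sgn lam Lam e.
Proof.
rewrite /pucci; case: sgn; rewrite !mulr_sumr big_mkcond/=.
  rewrite [X in _ + X]big_mkcond -big_split/=; apply: eq_bigr => e _.
  rewrite /m_fun; case: (ltgtP e 0) => [||->]; rewrite ?addr0 ?add0r ?mulr0//.
rewrite [X in _ + X]big_mkcond -big_split/=; apply: eq_bigr => e _.
rewrite /m_fun; case: (ltgtP e 0) => [||->]; rewrite ?addr0 ?add0r ?mulr0//.
Qed.

(** The list [eigenvalues A] is a choice, determined up to a permutation by the factorisation of the
    characteristic polynomial; a sum over it does not see the choice. *)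
Lemma pucci_char_poly sgn n (A : 'M[R]_n) (d : 'I_n -> R) :
  char_poly A = \prod_(i < n) ('X - (d i)%:P) ->
  pucci sgn lam Lam A = \sum_(i < n) m_fun sgn lam Lam (d i).
Proof.
move=> AE; rewrite pucci_eigen.
pose s := [seq d i | i <- index_enum 'I_n].
have sE : char_poly A = \prod_(e <- s) ('X - e%:P) by rewrite big_map.
have := @xgetPex _ [::] [set s : seq R | char_poly A = \prod_(e <- s) ('X - e%:P)]
  (ex_intro _ s sE).
rewrite -/(eigenvalues A) /= sE => /prod_XsubC_eq es.
by rewrite -(perm_big _ es) big_map.
Qed.

Lemma pucci_eq_char_poly sgn n (A B : 'M[R]_n) : char_poly A = char_poly B ->
  pucci sgn lam Lam A = pucci sgn lam Lam B.
Proof. by rewrite !pucci_eigen /eigenvalues => ->. Qed.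

(** In the frame of [symmetric_frame] the sum is [sum_i d i * c i]. Each weight [c i] lies in
    [[lam, Lam]] because the rows [i] of [X] and [Y] have total squared length [1]; the sign of
    [d i] decides which end of the interval is extremal. *)
Lemma elliptic_pucci n (I : finType) (k : I -> 'rV[R]_n) (A : 'M[R]_n) :
  A^T = A -> elliptic lam Lam k ->
  pucci PucciMinus lam Lam A <= \sum_i qform A (k i) <= pucci PucciPlus lam Lam A.
Proof.
move=> /symmetric_frame[d [X [Y [Ad AE _ XY1 _]]]] ell.
pose c i := \sum_l (dot (row i X) (k l) ^+ 2 + dot (row i Y) (k l) ^+ 2).
have cb i : lam <= c i <= Lam.
  rewrite /c big_split/=.
  have /andP[x1 x2] := ell (row i X); have /andP[y1 y2] := ell (row i Y).
  have E : dot (row i X) (row i X) + dot (row i Y) (row i Y) = 1.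
    by rewrite -(XY1 i) /dot -big_split; apply: eq_bigr => j _; rewrite !mxE !expr2.
  rewrite -[lam]mulr1 -[Lam]mulr1 -E !mulrDr.
  by apply/andP; split; exact: lerD.
have -> : \sum_i qform A (k i) = \sum_i d i * c i.
  under eq_bigr do rewrite (qform_frame _ AE).
  rewrite exchange_big/=; apply: eq_bigr => i _; rewrite mulr_sumr.
  by apply: eq_bigr => l _; rewrite !(dotC (k l)).
rewrite !(pucci_char_poly _ Ad); apply/andP; split; apply: ler_sum => i _;
  have /andP[c1 c2] := cb i; rewrite /m_fun; case: ifPn => [d0|].
- by rewrite mulrC ler_wnM2l.
- by rewrite -ltNge => d0; rewrite mulrC ler_pM2l.
- by rewrite [leRHS]mulrC ler_wnM2l.
- by rewrite -ltNge => d0; rewrite [leRHS]mulrC ler_pM2l.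
Qed.

(** The extremal weight [a i] is [lam] or [Lam] according to the sign of [d i], so that
    [m (d i) = a i * d i]. The vectors are the real and imaginary parts of the complex eigenvectors
    scaled by [sqrt (a i)], whence the index type ['I_n + 'I_n]. *)
Lemma pucci_attained sgn n (A : 'M[R]_n) : A^T = A ->
  exists2 k : 'I_n + 'I_n -> 'rV[R]_n, elliptic lam Lam k &
    \sum_i qform A (k i) = pucci sgn lam Lam A.
Proof.
move=> /symmetric_frame[d [X [Y [Ad AE XYD _ AXY]]]].
have [a aE ab] : exists2 a : 'I_n -> R,
    (forall i, m_fun sgn lam Lam (d i) = a i * d i) & forall i, lam <= a i <= Lam.
  exists (fun i => match sgn with PucciPlus => if d i <= 0 then lam else Lam
          | PucciMinus => if d i <= 0 then Lam else lam end) => i.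
    by rewrite /m_fun; case: sgn; case: ifP.
  by case: sgn; case: ifP; rewrite lexx lamLam.
have a0 i : 0 <= a i by have /andP[/(le_trans (ltW lam0))] := ab i.
pose k (i : 'I_n + 'I_n) := match i with
  | inl i => Num.sqrt (a i) *: row i X | inr i => Num.sqrt (a i) *: row i Y end.
have split_sum (F : 'I_n + 'I_n -> R) :
    \sum_i F i = \sum_i (F (inl i) + F (inr i)).
  by rewrite big_sumType/= big_split.
exists k.
  move=> h; rewrite split_sum.
  have hh : dot h h = \sum_i (dot h (row i X) ^+ 2 + dot h (row i Y) ^+ 2).
    transitivity (\sum_j \sum_l (\sum_i (X i j * X i l + Y i j * Y i l)) *
        (h ord0 j * h ord0 l)).
      apply: eq_bigr => j _; rewrite (bigD1 j)//= XYD eqxx mul1r big1 ?addr0//.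
      by move=> l lj; rewrite XYD eq_sym (negbTE lj) mul0r.
    rewrite -/(qform (\matrix_(j, l) \sum_i (X i j * X i l + Y i j * Y i l)) h).
    have -> : \sum_j \sum_l (\sum_i (X i j * X i l + Y i j * Y i l)) *
        (h ord0 j * h ord0 l) =
        qform (\matrix_(j, l) \sum_i (X i j * X i l + Y i j * Y i l)) h.
      by apply: eq_bigr => j _; apply: eq_bigr => l _; rewrite mxE.
    rewrite (@qform_frame _ _ (fun=> 1) X Y); last first.
      by move=> j l; rewrite mxE; apply: eq_bigr => i _; rewrite mul1r.
    by apply: eq_bigr => i _; rewrite mul1r.
  rewrite hh !mulr_sumr /k; apply/andP; split; apply: ler_sum => i _;
    rewrite !dotZr !exprMn sqr_sqrtr// -mulrDr; have /andP[a1 a2] := ab i;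
    by rewrite ler_wpM2r// addr_ge0// sqr_ge0.
rewrite split_sum (pucci_char_poly _ Ad); apply: eq_bigr => i _.
rewrite aE /qform /k -(AXY i) -big_split/= mulr_sumr; apply: eq_bigr => j _.
rewrite -big_split/= mulr_sumr; apply: eq_bigr => l _.
rewrite !mxE -[in RHS](sqr_sqrtr (a0 i)); ring.
Qed.

(** The plus operator is a maximum and the minus operator a minimum of linear operators:
    coefficients optimal for [A] in the first case and for [B] in the second bound the difference
    from below. *)
Lemma pucci_linearized sgn n (A B : 'M[R]_n) : A^T = A -> B^T = B ->
  exists2 k : 'I_n + 'I_n -> 'rV[R]_n, elliptic lam Lam k &
    \sum_i (qform B (k i) - qform A (k i)) <=
    pucci sgn lam Lam B - pucci sgn lam Lam A.
Proof.
move=> As Bs; case: sgn.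
  have [k ell E] := pucci_attained PucciPlus As; exists k => //.
  by rewrite sumrB E lerD2r; have /andP[] := elliptic_pucci Bs ell.
have [k ell E] := pucci_attained PucciMinus Bs; exists k => //.
by rewrite sumrB E lerD2l lerN2; have /andP[] := elliptic_pucci As ell.
Qed.

End Pucci.

(** * Second derivatives along lines *)

Section SecondDerivative.
Variable R : realType.
Implicit Types (f g : R -> R) (l : R).

(** A relation rather than a value of [derive1], so that it composes along lines for reflected
    functions and barriers, whose partial derivatives are never studied. *)
Definition second_derive0 g l := exists2 g1 : R -> R,
  (\forall t \near (0 : R), is_derive (t : R) 1 g (g1 t)) & is_derive (0 : R) 1 g1 l.

Lemma second_derive0_eq g l l' : second_derive0 g l -> l = l' ->
  second_derive0 g l'.
Proof. by move=> ? <-. Qed.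

Lemma second_derive0_near f g l : (\forall t \near (0 : R), f t = g t) ->
  second_derive0 f l -> second_derive0 g l.
Proof.
move=> fg [g1 Hf Hg1]; exists g1 => //.
have /near_join fg' := fg.
apply: filterS2 fg' Hf => t fgt; exact: near_eq_is_derive.
Qed.

Lemma second_derive0D f g l l' : second_derive0 f l -> second_derive0 g l' ->
  second_derive0 (fun t => f t + g t) (l + l').
Proof.
move=> [f1 Hf Hf1] [g1 Hg Hg1]; exists (fun t => f1 t + g1 t).
  by apply: filterS2 Hf Hg => t; exact: is_derive1D.
exact: is_derive1D.
Qed.

Lemma second_derive0Z f l (c : R) : second_derive0 f l ->
  second_derive0 (fun t => c * f t) (c * l).
Proof.
move=> [f1 Hf Hf1]; exists (fun t => c * f1 t).
  by apply: filterS Hf => t; exact: is_derive1Zl.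
exact: is_derive1Zl.
Qed.

Lemma second_derive0B f g l l' : second_derive0 f l -> second_derive0 g l' ->
  second_derive0 (fun t => f t - g t) (l - l').
Proof.
move=> [f1 Hf Hf1] [g1 Hg Hg1]; exists (fun t => f1 t - g1 t).
  by apply: filterS2 Hf Hg => t; exact: is_derive1B.
exact: is_derive1B.
Qed.

Lemma second_derive0_unique f l l' : second_derive0 f l -> second_derive0 f l' ->
  l = l'.
Proof.
move=> [f1 Hf [_ <-]] [g1 Hg [_ <-]]; apply: near_eq_derive.
by apply: filterS2 Hf Hg => t [_ <-] [_ <-].
Qed.

Lemma second_derive0_min g l : (\forall t \near (0 : R), g 0 <= g t) ->
  second_derive0 g l -> 0 <= l.
Proof.
move=> gmin [g1 Hg Hg1].
have : \forall t \near (0 : R), is_derive (t : R) 1 g (g1 t) /\ g 0 <= g t.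
  by apply: filterS2 Hg gmin.
move=> /nbhs_ballP[e /= e0 He].
have He' t : - e < t < e -> is_derive t 1 g (g1 t) /\ g 0 <= g t.
  move=> /andP[h1 h2]; apply: He; rewrite /ball/= sub0r normrN ltr_norml.
  by rewrite h1.
have g10 : g1 0 = 0.
  have D t : t \in `]-e, e[ -> derivable g t 1.
    by rewrite in_itv/= => /He'[[]].
  have m t : t \in `]-e, e[ -> g 0 <= g t by rewrite in_itv/= => /He'[].
  have e_e : - e <= e by lra.
  have z : 0 \in `]-e, e[ by rewrite in_itv/=; apply/andP; split; lra.
  have [_ E1] := derive1_at_min e_e D z m.
  by move: z; rewrite in_itv/= => /He'[[_ <-] _].
rewrite leNgt; apply/negP => l0.
have [] := is_derive_gt0_near (is_derive1N Hg1) (_ : 0 < - l).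
  by rewrite oppr_gt0.
rewrite g10 oppr0 => rt _.
have [d d0 Hd] := near_right_ex rt.
pose t := Num.min d e / 2.
have m0 : 0 < Num.min d e by rewrite lt_min d0.
have t0 : 0 < t by rewrite divr_gt0.
have [td te] : t < d /\ t < e.
  have : t < Num.min d e by rewrite /t; lra.
  by rewrite lt_min => /andP[].
have ee : - e < 0 by rewrite oppr_lt0.
have DD r : - e < r < e -> is_derive r 1 g (g1 r) by move=> /He'[].
have [c /andP[c0 ct] E] := oo_MVT ee t0 te DD.
have : g1 c < 0 by rewrite -oppr_gt0; apply: Hd; rewrite c0 (lt_trans ct).
have : 0 <= g t - g 0.
  by rewrite subr_ge0; apply: (He' t _).2; rewrite te (lt_trans ee).
by rewrite E pmulr_lge0 ?subr_gt0// => /le_lt_trans h /h; rewrite ltxx.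
Qed.

End SecondDerivative.

(** * Directional derivatives and the symmetry of the Hessian *)

Section DirectionalDerivatives.
Variables (R : realType) (N : nat).
Local Notation V := 'rV[R]_N.
Implicit Types (u : V -> R) (x h k : V).

Lemma line_quotient u x h t :
  (fun s : R => s^-1 *: (((fun s => u (x + s *: h)) \o shift t) (s *: (1 : R)) - u (x + t *: h))) =
  (fun s : R => s^-1 *: ((u \o shift (x + t *: h)) (s *: h) - u (x + t *: h))).
Proof.
apply/funext => s /=; congr (_ *: (u _ - _)).
by rewrite (_ : s *: (1 : R) = s) ?scalerDl 1?addrCA//; exact: mulr1.
Qed.

Lemma line_is_deriveP u x h t (d : R) :
  is_derive (x + t *: h) h u d <-> is_derive t 1 (fun s => u (x + s *: h)) d.
Proof.
split=> -[D E]; apply: DeriveDef; move: D E;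
  by rewrite /derivable /derive line_quotient.
Qed.

Lemma segment_MVT u x k (b : R) :
  (forall th : R, 0 <= th <= 1 -> derivable u (x + (th * b) *: k) k) ->
  exists2 th : R, 0 <= th <= 1 &
    u (x + b *: k) - u x = b * 'D_k u (x + (th * b) *: k).
Proof.
move=> du; pose f th := u (x + (th * b) *: k).
have Df (th : R) : 0 <= th <= 1 -> is_derive th 1 f (b * 'D_k u (x + (th * b) *: k)).
  move=> /du /derivableP /line_is_deriveP D.
  have Dl : is_derive th 1 (fun s => s * b) b.
    have -> : (fun s => s * b) = (fun s => b * (s - 0)).
      by apply/funext => s; rewrite subr0 mulrC.
    exact: is_derive1_affine.
  rewrite mulrC; 
  exact: (@is_derive1_comp _ (fun s => u (x + s *: k)) ( *%R^~ b) th _ _ D Dl).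
have cf : {within `[0, 1], continuous f}.
  apply: continuous_in_subspaceT => th /set_mem/=; rewrite in_itv/= => /Df.
  exact: is_derive_continuous.
have Df' (th : R) : th \in `]0, 1[ ->
    is_derive th 1 f (b * 'D_k u (x + (th * b) *: k)).
  by rewrite in_itv/= => /andP[h0 h1]; apply: Df; rewrite !ltW.
have [th] := MVT_segment ler01 Df' cf.
rewrite in_itv/= => th01; rewrite /f mul1r mul0r scale0r addr0 subr0 mulr1.
by move=> ->; exists th.
Qed.

(** The increment along [h + c k] is the increment along [h] followed by a leg along [k], to which
    the mean value theorem applies. Only the derivative along [k] has to be continuous, so
    coordinates can be added one at a time. *)
Lemma is_derive_add_direction u x h k (d c : R) : is_derive x h u d ->
  (\forall y \near x, derivable u y k) -> {for x, continuous ('D_k u)} ->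
  is_derive x (h + c *: k) u (d + c * 'D_k u x).
Proof.
move=> Dh dk ck.
rewrite -[x]addr0 -(scale0r (h + c *: k)); apply/line_is_deriveP.
rewrite scale0r addr0.
have {}Dh : is_derive (0 : R) 1 (fun s => u (x + s *: h)) d.
  by apply/line_is_deriveP; rewrite scale0r addr0.
have -> : (fun s => u (x + s *: (h + c *: k))) =
    (fun s => u (x + s *: h) + (u (x + s *: (h + c *: k)) - u (x + s *: h))).
  by apply/funext => s; rewrite [RHS]addrC subrK.
apply: (is_derive1D Dh).
suff cv : s^-1 *: (u (x + s *: (h + c *: k)) - u (x + s *: h)) @[s --> 0^'] -->
    c * 'D_k u x.
  have E : (fun s : R => s^-1 *: (((fun s => u (x + s *: (h + c *: k)) - u (x + s *: h)) \o
      shift 0) (s *: (1 : R)) - (u (x + 0 *: (h + c *: k)) - u (x + 0 *: h)))) =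
      (fun s => s^-1 *: (u (x + s *: (h + c *: k)) - u (x + s *: h))).
    apply/funext => s /=; rewrite !scale0r subrr subr0 addr0.
    by rewrite (_ : s *: (1 : R) = s)//; exact: mulr1.
  apply: DeriveDef.
    by rewrite /derivable E; apply/cvg_ex; exists (c * 'D_k u x).
  by rewrite /derive E; exact: (cvg_lim (@Rhausdorff R) cv).
apply/cvgrPdist_lt => e e0.
pose e' := e / (`|c| + 1).
have c1 : 0 < `|c| + 1 by rewrite ltr_wpDl.
have e'0 : 0 < e' by rewrite divr_gt0.
have /nbhs_ballP[r /= r0 Hr] : \forall y \near x,
    derivable u y k /\ `|'D_k u x - 'D_k u y| < e'.
  by move/cvgrPdist_lt/(_ _ e'0) : ck => ck; apply: filterS2 dk ck.
pose K := `|h| + `|c *: k| + 1.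
have K0 : 0 < K by rewrite ltr_wpDl ?addr_ge0.
have rK : 0 < r / K by rewrite divr_gt0.
near=> s.
have s0 : s != 0 by near: s; exact: nbhs_dnbhs_neq.
have sK : `|s| < r / K by near: s; apply: dnbhs0_lt.
have inb (th : R) : 0 <= th <= 1 -> ball x r (x + s *: h + (th * (s * c)) *: k).
  move=> /andP[th0 th1]; rewrite -ball_normE /ball_/=.
  rewrite -(addrA x) opprD addrA subrr add0r normrN.
  have -> : (th * (s * c)) *: k = (th * s) *: (c *: k) by rewrite scalerA mulrA.
  apply: (@le_lt_trans _ _ (`|s| * K)); last by rewrite -ltr_pdivlMr.
  apply: (le_trans (ler_normD _ _)); rewrite (normrZ s) (normrZ (th * s)) normrM (ger0_norm th0).
  rewrite /K mulrDr mulr1 mulrDr -addrA lerD2l -mulrA -[leLHS]addr0.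
  by rewrite lerD ?normr_ge0// ler_piMl ?mulr_ge0.
have [th th01 E] : exists2 th : R, 0 <= th <= 1 &
    u (x + s *: h + (s * c) *: k) - u (x + s *: h) =
    s * c * 'D_k u (x + s *: h + (th * (s * c)) *: k).
  by apply: segment_MVT => th /inb /Hr[].
rewrite (scalerDr s) scalerA (addrA x) E.
have sc (z : R) : s^-1 *: (s * c * z) = c * z.
  by rewrite -mulrA; exact: (mulKf s0).
rewrite sc -mulrBr normrM.
have [_ lt_e'] := Hr _ (inb _ th01).
apply: (@le_lt_trans _ _ (`|c| * e')); first by rewrite ler_wpM2l// ltW.
by rewrite /e' mulrA ltr_pdivrMr// mulrC ltr_pM2l// ltrDl.
Unshelve. all: by end_near. Qed.

End DirectionalDerivatives.

Section HessianCalculus.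
Variables (R : realType) (N : nat).
Local Notation V := 'rV[R]_N.
Implicit Types (u : V -> R) (x y h k : V) (D : set V).

Lemma line0_is_deriveP u x h (d : R) :
  is_derive x h u d <-> is_derive (0 : R) 1 (fun s => u (x + s *: h)) d.
Proof. by rewrite -line_is_deriveP scale0r addr0. Qed.

Lemma is_derive_shift_arg u x h (w : V) (d : R) :
  is_derive (x + w) h u d -> is_derive x h (fun y => u (y + w)) d.
Proof.
move=> /line0_is_deriveP H; apply/line0_is_deriveP.
have -> // : (fun s => u (x + s *: h + w)) = (fun s => u (x + w + s *: h)).
by apply/funext => s; rewrite addrAC.
Qed.

Lemma is_derive_partials u x h :
  (forall i : 'I_N, \forall y \near x, derivable u y (delta_mx ord0 i)) ->
  (forall i : 'I_N, {for x, continuous (partial i u)}) ->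
  is_derive x h u (\sum_i h ord0 i * partial i u x).
Proof.
move=> du cu; rewrite {1}(row_sum_delta h).
elim: (index_enum _) => [|i s IH]; first by rewrite !big_nil; exact: is_derive0.
rewrite !big_cons (addrC (_ *: _)) (addrC (h ord0 i * _)).
exact: is_derive_add_direction IH (du i) (cu i).
Qed.

Lemma open_near D x : open D -> D x -> \forall y \near x, D y.
Proof. by move=> oD Dx; exact: open_nbhs_nbhs. Qed.

Lemma near_line (P : V -> Prop) x h : (\forall y \near x, P y) ->
  \forall t \near (0 : R), P (x + t *: h).
Proof.
move=> Px; have : x + t *: h @[t --> (0 : R)] --> x.
  rewrite -[X in _ --> X]addr0 -(scale0r h); apply: cvgD; first exact: cvg_cst.
  by apply: cvgZr_tmp; exact: cvg_id.
by apply.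
Qed.

Section C2.
Variables (D : set V) (u : V -> R).
Hypotheses (oD : open D) (C2u : C2_on D u).

Lemma C2_is_derive x h : D x -> is_derive x h u (\sum_i h ord0 i * partial i u x).
Proof.
move=> Dx; apply: is_derive_partials => i.
  by apply: filterS (open_near oD Dx) => y /C2u[_ /(_ i)[]].
by have [_ /(_ i)[_ []]] := C2u Dx.
Qed.

Lemma C2_partial_is_derive i x h : D x ->
  is_derive x h (partial i u) (\sum_j h ord0 j * hessian u x i j).
Proof.
move=> Dx; under eq_bigr do rewrite mxE.
apply: is_derive_partials => j.
  by apply: filterS (open_near oD Dx) => y /C2u[_ /(_ i)[_ [_ /(_ j)[]]]].
by have [_ /(_ i)[_ [_ /(_ j)[]]]] := C2u Dx.
Qed.

Lemma C2_second_derive x h : D x ->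
  second_derive0 (fun t => u (x + t *: h)) (qform (hessian u x) h).
Proof.
move=> Dx; exists (fun t => \sum_i h ord0 i * partial i u (x + t *: h)).
  apply: filterS (near_line h (open_near oD Dx)) => t Dt.
  by apply/line_is_deriveP; exact: C2_is_derive.
pose d i := \sum_j h ord0 j * hessian u x i j.
have -> : qform (hessian u x) h = \sum_i h ord0 i * d i.
  apply: eq_bigr => i _; rewrite mulr_sumr; apply: eq_bigr => j _.
  by rewrite mulrC mulrA.
have Hi i : is_derive (0 : R) 1 (fun t => h ord0 i * partial i u (x + t *: h))
    (h ord0 i * d i).
  apply: is_derive1Zl.
  exact: (line0_is_deriveP (partial i u) x h _).1 (C2_partial_is_derive i h Dx).
clearbody d.
elim: (index_enum _) => [|i s IH].
  rewrite big_nil (_ : (fun _ => _) = cst 0); first exact: is_derive_cst.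
  by apply/funext => t; rewrite big_nil.
rewrite big_cons [X in is_derive _ _ X _](_ : _ = (fun t =>
    h ord0 i * partial i u (x + t *: h) +
    \sum_(l <- s) h ord0 l * partial l u (x + t *: h))).
  exact: (is_derive1D (Hi i) IH).
by apply/funext => t; rewrite big_cons.
Qed.

(** The mean value theorem along [e i] for the increment of [u] in direction [e j], then along [e j]
    for [partial i u]. *)
Lemma second_difference x (i j : 'I_N) (t : R) :
  let e (l : 'I_N) := delta_mx ord0 l : V in
  (forall a b : R, 0 <= a <= 1 -> 0 <= b <= 1 ->
    D (x + (a * t) *: e i + (b * t) *: e j)) ->
  exists a b : R, [/\ 0 <= a <= 1, 0 <= b <= 1 &
    u (x + t *: e i + t *: e j) - u (x + t *: e i) - (u (x + t *: e j) - u x) =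
    t * (t * hessian u (x + (a * t) *: e i + (b * t) *: e j) i j)].
Proof.
move=> e inD.
have D1 (a b : R) : 0 <= a <= 1 -> 0 <= b <= 1 ->
    is_derive (x + (a * t) *: e i + (b * t) *: e j) (e i) u
      (partial i u (x + (a * t) *: e i + (b * t) *: e j)).
  move=> ha hb; have [_ /(_ i)[d _]] := C2u (inD a b ha hb).
  exact/derivableP.
pose phi y := u (y + t *: e j) - u y.
have Dphi (a : R) : 0 <= a <= 1 -> is_derive (x + (a * t) *: e i) (e i) phi
    (partial i u (x + (a * t) *: e i + t *: e j) - partial i u (x + (a * t) *: e i)).
  move=> ha.
  have h1 := D1 a 1 ha; rewrite mul1r ler01 lexx in h1.
  have h0 := D1 a 0 ha; rewrite mul0r scale0r addr0 ler01 lexx in h0.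
  exact: (is_deriveB (is_derive_shift_arg (h1 isT)) (h0 isT)).
have [a ha E] := @segment_MVT _ _ phi x (e i) t (fun a ha => @ex_derive _ _ _ _ _ _ _ (Dphi a ha)).
have Ephi : 'D_(e i) phi (x + (a * t) *: e i) =
    partial i u (x + (a * t) *: e i + t *: e j) - partial i u (x + (a * t) *: e i).
  by have [_ ->] := Dphi a ha.
have d2 (b : R) : 0 <= b <= 1 ->
    derivable (partial i u) (x + (a * t) *: e i + (b * t) *: e j) (e j).
  by move=> hb; have [_ /(_ i)[_ [_ /(_ j)[]]]] := C2u (inD a b ha hb).
have [b hb E2] := segment_MVT d2.
by exists a, b; split => //; rewrite mxE -E2 -Ephi -E.
Qed.

End C2.

(** Schwarz's theorem: the second difference is symmetric in [i] and [j], so the two mixed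
    derivatives take the same value at two points as close to [x] as desired, and both are
    continuous at [x]. *)
Lemma hessian_sym D u x : open D -> C2_on D u -> D x ->
  (hessian u x)^T = hessian u x.
Proof.
move=> oD C2u Dx; apply/matrixP => i j; rewrite mxE.
apply/eqP; rewrite -subr_eq0 -normr_eq0; apply/eqP/le_anti.
rewrite normr_ge0 andbT; apply/ler_addgt0Pr => e e0; rewrite add0r.
have cont (k l : 'I_N) : {for x, continuous (fun y => hessian u y k l)}.
  have -> : (fun y => hessian u y k l) = partial l (partial k u).
    by apply/funext => y; rewrite mxE.
  by have [_ /(_ k)[_ [_ /(_ l)[]]]] := C2u x Dx.
have e2 : 0 < e / 2 by rewrite divr_gt0.
have : \forall y \near x, [/\ D y, `|hessian u x i j - hessian u y i j| < e / 2
    & `|hessian u x j i - hessian u y j i| < e / 2].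
  near=> y; split; near: y; first exact: open_near.
    exact: (cvgrPdist_lt _ _).1 (cont i j) _ e2.
  exact: (cvgrPdist_lt _ _).1 (cont j i) _ e2.
move=> /nbhs_ballP[r /= r0 Hr].
pose ee (l : 'I_N) := delta_mx ord0 l : V.
pose K := `|ee i| + `|ee j| + 1.
have K0 : 0 < K by rewrite ltr_wpDl ?addr_ge0.
pose t := r / K / 2.
have t0 : 0 < t by rewrite !divr_gt0.
have tK : t * K < r by rewrite /t mulrAC divfK ?gt_eqF//; lra.
have inb (k l : 'I_N) (a b : R) : `|ee k| + `|ee l| + 1 = K -> 0 <= a <= 1 -> 0 <= b <= 1 ->
    ball x r (x + (a * t) *: ee k + (b * t) *: ee l).
  move=> KE /andP[a0 a1] /andP[b0 b1]; rewrite -ball_normE /ball_/=.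
  rewrite -(addrA x) opprD addrA subrr add0r normrN.
  apply: le_lt_trans tK; apply: (le_trans (ler_normD _ _)).
  have at0 : 0 <= a * t := mulr_ge0 a0 (ltW t0).
  have bt0 : 0 <= b * t := mulr_ge0 b0 (ltW t0).
  rewrite (normrZ (a * t)) (normrZ (b * t)) (ger0_norm at0) (ger0_norm bt0) -KE.
  rewrite !mulrDr mulr1 -[leLHS]addr0 lerD ?(ltW t0)//.
  by rewrite lerD// ler_wpM2r// ler_piMl ?(ltW t0).
have [|a [b [ha hb E1]]] := @second_difference _ _ C2u x i j t.
  by move=> a b ha hb; have [] := Hr _ (inb i j a b erefl ha hb).
have KE : `|ee j| + `|ee i| + 1 = K by rewrite (addrC `|ee j|).
have [|c [d [hc hd E2]]] := @second_difference _ _ C2u x j i t.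
  by move=> c d hc hd; have [] := Hr _ (inb j i c d KE hc hd).
have {E1 E2} E : hessian u (x + (a * t) *: ee i + (b * t) *: ee j) i j =
   hessian u (x + (c * t) *: ee j + (d * t) *: ee i) j i.
  have tN0 : t != 0 by rewrite gt_eqF.
  apply: (mulfI tN0); apply: (mulfI tN0).
  rewrite -E1 -E2 -/(ee i) -/(ee j) (addrAC x (t *: ee j)).
  by rewrite !opprB; ring.
have [_ h1 _] := Hr _ (inb i j a b erefl ha hb).
have [_ _ h2] := Hr _ (inb j i c d KE hc hd).
have key (y1 y2 z1 z2 : R) : z1 = z2 -> `|y1 - z1| < e / 2 ->
    `|y2 - z2| < e / 2 -> `|y2 - y1| <= e.
  move=> -> l1 l2; rewrite -(subrKA z2) (le_trans (ler_normD _ _))//.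
  by rewrite [leRHS]splitr lerD ?ltW// distrC.
exact: key E h1 h2.
Unshelve. all: by end_near. Qed.

End HessianCalculus.

(** * Maximum principles *)

Section EuclideanBall.
Variables (R : realType) (N : nat).
Local Notation V := 'rV[R]_N.
Implicit Types (x y h e : V) (r mu : R).

Lemma enormE x : enorm x = Num.sqrt (dot x x).
Proof. by congr Num.sqrt; apply: eq_bigr => i _; rewrite expr2. Qed.

Lemma enorm_sqr x : enorm x ^+ 2 = dot x x.
Proof. by rewrite enormE sqr_sqrtr// dot_ge0. Qed.

Lemma enorm_ge0 x : 0 <= enorm x.
Proof. by rewrite enormE sqrtr_ge0. Qed.

Lemma enorm_lt x r : 0 <= r -> (enorm x < r) = (dot x x < r ^+ 2).
Proof. by move=> r0; rewrite -enorm_sqr ltr_pXn2r ?nnegrE// enorm_ge0. Qed.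

Lemma enorm_le x r : 0 <= r -> (enorm x <= r) = (dot x x <= r ^+ 2).
Proof. by move=> r0; rewrite -enorm_sqr ler_pXn2r ?nnegrE// enorm_ge0. Qed.

Lemma dot_CauchySchwarz x y : dot x y ^+ 2 <= dot x x * dot y y.
Proof.
have [->|y0] := eqVneq y 0.
  by rewrite -(scale0r (0 : V)) dotZr mul0r expr0n/= mulr_ge0 ?dot_ge0.
have yy : 0 < dot y y by rewrite lt_neqAle eq_sym dot_eq0 y0 dot_ge0.
have := dot_ge0 (dot y y *: x - dot x y *: y).
rewrite dotBl !dotBr !dotZl !dotZr (dotC y x) => h.
have : 0 <= dot y y * (dot x x * dot y y - dot x y ^+ 2) by nra.
by rewrite pmulr_rge0// subr_ge0.
Qed.

Lemma dot_le_enorm x e : dot e e = 1 -> dot x e <= enorm x.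
Proof.
move=> ee; apply: (le_trans (ler_norm _)).
rewrite -(@ler_pXn2r _ 2)// ?nnegrE ?enorm_ge0// -normrX ger0_norm ?sqr_ge0//.
by rewrite enorm_sqr -[leRHS]mulr1 -ee dot_CauchySchwarz.
Qed.

Lemma continuous_dot (T : topologicalType) (f g : T -> V) (t : T) :
  {for t, continuous f} -> {for t, continuous g} ->
  {for t, continuous (fun s => dot (f s) (g s))}.
Proof.
move=> cf cg.
suff H (l : seq 'I_N) : (fun z : T => \sum_(i <- l) f z ord0 i * g z ord0 i) @ t
    --> \sum_(i <- l) f t ord0 i * g t ord0 i by exact: H.
elim: l => [|i l IH].
  rewrite big_nil (_ : (fun z => _) = cst 0); first exact: cvg_cst.
  by apply/funext => z; rewrite big_nil.
rewrite big_cons (_ : (fun z => _) = (fun z => f z ord0 i * g z ord0 i +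
    \sum_(j <- l) f z ord0 j * g z ord0 j)); last first.
  by apply/funext => z; rewrite big_cons.
apply: cvgD IH; apply: cvgM.
  exact: (continuous_comp cf (@coord_continuous _ _ _ ord0 i (f t))).
exact: (continuous_comp cg (@coord_continuous _ _ _ ord0 i (g t))).
Qed.

Lemma continuous_dotl e : continuous (fun x => dot x e).
Proof.
move=> x; apply: (@continuous_dot _ id (fun=> e)); first exact: cvg_id.
exact: cst_continuous.
Qed.

Lemma continuous_sqdist y : continuous (fun x => dot (x - y) (x - y)).
Proof.
move=> x; have c : {for x, continuous (fun z : V => z - y)}.
  by apply: (@continuousB _ _ _ id (fun=> y)); [exact: cvg_id|exact: cst_continuous].
exact: (continuous_dot c c).
Qed.

Lemma open_lt_continuous (f g : V -> R) : continuous f -> continuous g ->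
  open [set x | f x < g x].
Proof.
move=> cf cg; have -> : [set x | f x < g x] = (fun x => g x - f x) @^-1` [set y | 0 < y].
  by apply/seteqP; split => x /=; rewrite subr_gt0.
apply: open_comp; last exact: open_gt.
by move=> x _; apply: (@continuousB _ _ _ g f); [exact: cg|exact: cf].
Qed.

Lemma closed_le_continuous (f g : V -> R) : continuous f -> continuous g ->
  closed [set x | f x <= g x].
Proof.
move=> cf cg; have -> : [set x | f x <= g x] = ~` [set x | g x < f x].
  by apply/seteqP; split => x /=; [move=> h; rewrite ltNge h|move/negP; rewrite -leNgt].
by apply: open_closedC; exact: open_lt_continuous.
Qed.

Lemma dot0r x : dot x 0 = 0.
Proof. by rewrite -(scale0r (0 : V)) dotZr mul0r. Qed.

Lemma open_eball r : open (@eball R N r).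
Proof.
have [r0|r0] := leP 0 r; last first.
  have -> : @eball R N r = set0; last exact: open0.
  apply/seteqP; split => // x; rewrite /eball/= => h.
  by have := lt_trans (le_lt_trans (enorm_ge0 x) h) r0; rewrite ltxx.
have -> : @eball R N r = [set x | dot (x - 0) (x - 0) < r ^+ 2].
  by apply/seteqP; split => x; rewrite /eball/= subr0 -enorm_lt.
by apply: open_lt_continuous; [exact: continuous_sqdist|exact: cst_continuous].
Qed.

(** Passes from Euclidean bounds to the sup norm, in which balls and boundedness are expressed. *)
Lemma norm_le_dot x (c : R) : 0 <= c -> dot x x <= c ^+ 2 -> `|x| <= c.
Proof.
move=> c0 xc; rewrite /Num.norm/= mx_normE -[leRHS]/((NngNum c0)%:num) num_le.
apply/bigmax_leP; split => [|[i j] _]; first exact: c0.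
rewrite -num_le/= (ord1 i)/= -(@ler_pXn2r _ 2)// ?nnegrE//.
rewrite real_normK ?num_real//; apply: le_trans xc; rewrite /dot (bigD1 j)//=.
by rewrite -expr2 lerDl; apply: sumr_ge0 => k _; rewrite -expr2 sqr_ge0.
Qed.

Lemma compact_sqdist_le y (c : R) (A : set V) : closed A ->
  A `<=` [set x | dot (x - y) (x - y) <= c] -> compact A.
Proof.
move=> cA sub; apply: bounded_closed_compact => //.
exists (`|y| + Num.sqrt c); split; first exact: num_real.
move=> M ltM x /= /sub/= xc; apply: le_trans (ltW ltM).
rewrite -(subrK y x) (le_trans (ler_normD _ _))// addrC lerD2l.
apply: norm_le_dot; first exact: sqrtr_ge0.
by rewrite sqr_sqrtr// (le_trans (dot_ge0 _) xc).
Qed.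

Lemma within_continuousP (T : topologicalType) (A : set T) (f : T -> R) :
  {within A, continuous f} <->
  forall t, A t -> forall P : set R, nbhs (f t) P -> \forall z \near t, A z -> P (f z).
Proof. exact: subspace_continuousP. Qed.

Lemma within_continuous_for (A : set V) (f : V -> R) x : open A -> A x ->
  {within A, continuous f} -> {for x, continuous f}.
Proof.
move=> oA Ax /within_continuousP cf P /(cf _ Ax) H.
by apply: filterS2 H (open_near oA Ax) => y; apply.
Qed.

Lemma within_continuous_comp (T1 T2 : topologicalType) (A : set T1) (B : set T2)
    (f : T2 -> R) (g : T1 -> T2) :
  continuous g -> (forall t, A t -> B (g t)) -> {within B, continuous f} ->
  {within A, continuous (fun t => f (g t))}.
Proof.
move=> cg AB /within_continuousP cf; apply/within_continuousP => x Ax P Pfx.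
have H : \forall z \near x, B (g z) -> P (f (g z)).
  exact: (cg x _ (cf _ (AB _ Ax) _ Pfx)).
by apply: filterS H => y H Ay; exact: H (AB _ Ay).
Qed.

Lemma within_powR (b : R) : 0 < b ->
  {within [set z : R | 0 <= z], continuous (@powR R ^~ b)}.
Proof.
move=> b0; apply/within_continuousP => z /= z0 P Pz.
move: z0; rewrite le_eqVlt => /predU1P[z0|z0]; last first.
  have c : {for z, continuous (@powR R ^~ b)}.
    by apply: is_derive_continuous; exact: is_derive1_powR.
  have H : \forall y \near z, P (y `^ b) := c _ Pz.
  by apply: filterS H => y Py _.
rewrite -z0 in Pz *; rewrite powR0 ?gt_eqF// in Pz.
have : \forall a \near 0^'+, P (a `^ b) := powR_cvg0 b0 Pz.
move=> /near_right_ex[d d0 Hd]; near=> y => y0.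
move: y0; rewrite le_eqVlt => /predU1P[<-|y0].
  by rewrite powR0 ?gt_eqF//; exact: nbhs_singleton.
by apply: Hd; rewrite y0/=; near: y; exact: lt_nbhsl.
Unshelve. all: by end_near. Qed.

Lemma within_continuousS (A B : set V) (f : V -> R) : A `<=` B ->
  {within B, continuous f} -> {within A, continuous f}.
Proof.
move=> AB /within_continuousP cf; apply/within_continuousP => x Ax P Pfx.
by apply: filterS (cf _ (AB _ Ax) _ Pfx) => y H Ay; exact: H (AB _ Ay).
Qed.

End EuclideanBall.

(** * Test functions, supersolutions and Hopf's barrier *)

Section TestFunctions.
Variable R : realType.

Lemma is_derive1M (f g : R -> R) (x df dg : R) : is_derive x 1 f df ->
  is_derive x 1 g dg -> is_derive x 1 (fun t => f t * g t) (f x * dg + g x * df).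
Proof. exact: (@is_deriveM _ _ f g). Qed.

(** Along a line both [|x|^2] and [x.e] are polynomials of degree at most two in [t]; this one chain
    rule therefore covers radial and planar barriers. *)
Lemma second_derive0_quadratic (F F1 : R -> R) (F2 s b c : R) :
  (\forall z \near s, is_derive (z : R) 1 F (F1 z)) -> is_derive s 1 F1 F2 ->
  second_derive0 (fun t => F (s + t * (b + t * c))) (F2 * b ^+ 2 + F1 s * (2 * c)).
Proof.
move=> nF HF1.
pose q t := s + t * (b + t * c); pose q1 t := b + t * (2 * c).
have Dq (t : R) : is_derive t 1 q (q1 t).
  have D1 : is_derive t 1 (fun t => b + t * c) c.
    have -> : (fun t => b + t * c) = (fun t => b + c * (t - 0)).
      by apply/funext => z; rewrite subr0 mulrC.
    have := is_derive1D (is_derive_cst b t 1) (is_derive1_affine c 0 t).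
    by rewrite add0r.
  have -> : q1 t = 0 + (t * c + (b + t * c) * 1) by rewrite /q1; ring.
  exact: (is_derive1D (is_derive_cst s t 1) (is_derive1M (is_derive_id t 1) D1)).
have q0 : q 0 = s by rewrite /q mul0r addr0.
have q10 : q1 0 = b by rewrite /q1 mul0r addr0.
have Dq1 : is_derive (0 : R) 1 q1 (2 * c).
  have -> : q1 = (fun t => b + (2 * c) * (t - 0)).
    by apply/funext => z; rewrite /q1 subr0 (mulrC z).
  have := is_derive1D (is_derive_cst b (0 : R) 1) (is_derive1_affine (2 * c) 0 0).
  by rewrite add0r.
exists (fun t => F1 (q t) * q1 t).
  have cq : q t @[t --> (0 : R)] --> s.
    by rewrite -[X in _ --> X]q0; exact: is_derive_continuous (Dq 0).
  have nFq : \forall t \near (0 : R), is_derive (q t) 1 F (F1 (q t)) := cq _ nF.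
  apply: filterS nFq => t Ht.
  exact: (@is_derive1_comp _ F q t _ _ Ht (Dq t)).
have HF1' : is_derive (q 0) 1 F1 F2 by rewrite q0.
have -> : F2 * b ^+ 2 + F1 s * (2 * c) =
    F1 (q 0) * (2 * c) + q1 0 * (F2 * q1 0) by rewrite q0 q10; ring.
exact: (is_derive1M (@is_derive1_comp _ F1 q 0 _ _ HF1' (Dq 0)) Dq1).
Qed.

Variable N : nat.
Local Notation V := 'rV[R]_N.
Implicit Types (x y h e : V).

Lemma second_derive0_radial0 (F F1 : R -> R) (F2 : R) x h :
  (\forall z \near dot x x, is_derive (z : R) 1 F (F1 z)) ->
  is_derive (dot x x) 1 F1 F2 ->
  second_derive0 (fun t => F (dot (x + t *: h) (x + t *: h)))
    (4 * F2 * dot x h ^+ 2 + 2 * F1 (dot x x) * dot h h).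
Proof.
move=> nF HF1.
have := second_derive0_quadratic (2 * dot x h) (dot h h) nF HF1.
move=> /second_derive0_eq H.
have -> : (fun t : R => F (dot (x + t *: h) (x + t *: h))) = (fun t =>
    F (dot x x + t * (2 * dot x h + t * dot h h))).
  apply/funext => t; congr F.
  by rewrite dotDl !dotDr !dotZl !dotZr (dotC h); ring.
by apply: H; ring.
Qed.

Lemma second_derive0_radial (F F1 : R -> R) (F2 : R) x y h :
  (\forall z \near dot (x - y) (x - y), is_derive (z : R) 1 F (F1 z)) ->
  is_derive (dot (x - y) (x - y)) 1 F1 F2 ->
  second_derive0 (fun t => F (dot (x + t *: h - y) (x + t *: h - y)))
    (4 * F2 * dot (x - y) h ^+ 2 + 2 * F1 (dot (x - y) (x - y)) * dot h h).
Proof.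
move=> nF HF1; have H := second_derive0_radial0 h nF HF1.
have -> // : (fun t : R => F (dot (x + t *: h - y) (x + t *: h - y))) =
    (fun t => F (dot (x - y + t *: h) (x - y + t *: h))).
by apply/funext => t; rewrite addrAC.
Qed.

Lemma second_derive0_planar (G G1 : R -> R) (G2 : R) x h e :
  (\forall z \near dot x e, is_derive (z : R) 1 G (G1 z)) ->
  is_derive (dot x e) 1 G1 G2 ->
  second_derive0 (fun t => G (dot (x + t *: h) e)) (G2 * dot h e ^+ 2).
Proof.
move=> nG HG1; have := second_derive0_quadratic (dot h e) 0 nG HG1.
move=> /second_derive0_eq H.
have -> : (fun t : R => G (dot (x + t *: h) e)) =
    (fun t => G (dot x e + t * (dot h e + t * 0))).
  by apply/funext => t; congr G; rewrite dotDl dotZl mulr0 addr0.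
by apply: H; rewrite mulr0 mulr0 addr0.
Qed.

Variables (lam Lam : R).
Hypotheses (lam0 : 0 < lam) (lamLam : lam <= Lam).

(* Viscosity sense: every test function touching [W] from below at [x], with
   second derivative [l h] in each direction [h], satisfies
   [Pucci^- (Hessian) <= rhs]. *)
Definition supersolution_at (W : V -> R) x (rhs : R) :=
  forall (psi l : V -> R), (\forall y \near x, W x - psi x <= W y - psi y) ->
  (forall h, second_derive0 (fun t => psi (x + t *: h)) (l h)) ->
  exists2 k : 'I_N + 'I_N -> V, elliptic lam Lam k & \sum_i l (k i) <= rhs.

(** At a touching point, [W2 - W1 - psi] has a minimum along every line, so its second derivative
    along each vector of [pucci_linearized] is nonnegative. *)
Lemma supersolution_sub sgn (A B : 'M[R]_N) (W1 W2 : V -> R) x :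
  A^T = A -> B^T = B ->
  (forall h, second_derive0 (fun t => W1 (x + t *: h)) (qform A h)) ->
  (forall h, second_derive0 (fun t => W2 (x + t *: h)) (qform B h)) ->
  supersolution_at (fun y => W2 y - W1 y) x
    (pucci sgn lam Lam B - pucci sgn lam Lam A).
Proof.
move=> As Bs dA dB psi l minx dl.
have [k ell le_k] := pucci_linearized lam0 lamLam sgn As Bs.
exists k => //; apply: le_trans le_k; apply: ler_sum => i _.
rewrite -subr_ge0.
apply: second_derive0_min (second_derive0B (second_derive0B (dB (k i)) (dA (k i))) (dl (k i))).
by rewrite /= scale0r addr0; exact: (near_line (k i) minx).
Qed.

Lemma pucci0 sgn n : pucci sgn lam Lam (0 : 'M[R]_n) = 0.
Proof.
rewrite (@pucci_char_poly _ _ _ _ _ _ (fun=> 0)).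
  by rewrite big1// => i _; rewrite /m_fun; case: sgn; case: ifP; rewrite mulr0.
rewrite char_poly_trig; last by apply/is_trig_mxP => i j _; rewrite mxE.
by apply: eq_bigr => i _; rewrite mxE.
Qed.

Lemma qform0 n (h : 'rV[R]_n) : qform 0 h = 0.
Proof. by rewrite /qform big1// => i _; rewrite big1// => j _; rewrite mxE mul0r. Qed.

Lemma second_derive0_cst (c : R) : second_derive0 (fun=> c) 0.
Proof.
exists (fun=> 0); last exact: is_derive_cst.
by near=> t; exact: is_derive_cst.
Unshelve. all: by end_near. Qed.

Lemma supersolution_C2 sgn (D : set V) u x : open D -> C2_on D u -> D x ->
  supersolution_at u x (pucci sgn lam Lam (hessian u x)).
Proof.
move=> oD C2u Dx.
have := @supersolution_sub sgn 0 (hessian u x) (fun=> 0) u x (trmx0 _ _ _)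
  (hessian_sym oD C2u Dx) _ (fun h => C2_second_derive oD C2u h Dx).
rewrite pucci0 subr0 (_ : (fun y => _) = u); last by apply/funext => y; rewrite subr0.
by apply => h; rewrite qform0; exact: second_derive0_cst.
Qed.

(** Hopf's barrier: zero on the sphere of radius [rho] about [y], positive inside it, and for large
    [a] a strict subsolution of all the linear operators away from [y]. *)
Definition annulus_barrier (a rho : R) y x :=
  expR (- a * dot (x - y) (x - y)) - expR (- a * rho ^+ 2).

(** A negative minimum of [W - eps * barrier] on the closed annulus would be interior: the barrier
    vanishes on the outer sphere, and on the inner one it is at most [1] while [W >= eps]. The
    barrier would then touch the supersolution from below at a point where every admissible linear
    operator is positive on it. *)
Lemma annulus_lower_bound (W : V -> R) y (sig rho : R) : 0 < sig -> sig < rho ->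
  {within [set x | dot (x - y) (x - y) <= rho ^+ 2], continuous W} ->
  (forall x, dot (x - y) (x - y) <= rho ^+ 2 -> 0 <= W x) ->
  (forall x, dot (x - y) (x - y) <= sig ^+ 2 -> 0 < W x) ->
  (forall x, sig ^+ 2 < dot (x - y) (x - y) < rho ^+ 2 -> supersolution_at W x 0) ->
  exists a, 0 < a /\ exists2 eps, 0 < eps &
    forall x, sig ^+ 2 <= dot (x - y) (x - y) <= rho ^+ 2 ->
      eps * annulus_barrier a rho y x <= W x.
Proof.
move=> sig0 sr cW W0 Wsig super.
have sig20 : 0 < sig ^+ 2 by rewrite exprn_gt0.
have sr2 : sig ^+ 2 < rho ^+ 2 by rewrite ltr_pXn2r ?nnegrE ?ltW// (lt_trans sig0).
have Lam0 : 0 < Lam by exact: lt_le_trans lamLam.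
(* Makes [a * lam * sig ^ 2] exceed [Lam * N], hence [2 * a * S1 > S2] below, where ellipticity
   gives [S1 >= lam * sig ^ 2] and the trace bound gives [S2 <= Lam * N]. *)
pose a := (Lam * N%:R + 1) / (lam * sig ^+ 2).
have a0 : 0 < a by rewrite divr_gt0 ?mulr_gt0// ltr_wpDl// mulr_ge0// ltW.
have cd : continuous (fun x : V => dot (x - y) (x - y)) := @continuous_sqdist R N y.
have cB : continuous (annulus_barrier a rho y).
  move=> x; apply: (@continuousB _ _ _ (fun x => expR (- a * dot (x - y) (x - y)))
      (fun=> expR (- a * rho ^+ 2))); last exact: cst_continuous.
  apply: (@continuous_comp _ _ _ (fun x => - a * dot (x - y) (x - y)) expR).
    by apply: continuousM; [exact: cst_continuous|exact: cd].
  exact: continuous_expR.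
have [x1 x1s minx1] : exists2 x1, x1 \in [set x | dot (x - y) (x - y) <= sig ^+ 2] &
    forall x, x \in [set x | dot (x - y) (x - y) <= sig ^+ 2] -> W x1 <= W x.
  apply: EVT_min_rV.
  - by exists y; rewrite /= subrr dot0r ltW.
  - apply: (@compact_sqdist_le _ _ y (sig ^+ 2)) => //.
    by apply: closed_le_continuous => //; exact: cst_continuous.
  - by apply: within_continuousS cW => x /= /le_trans; apply; exact: ltW.
rewrite inE/= in x1s.
pose eps := W x1; have eps0 : 0 < eps by exact: Wsig.
exists a; split=> //; exists eps => // x xK.
pose K := [set x | sig ^+ 2 <= dot (x - y) (x - y)] `&`
          [set x | dot (x - y) (x - y) <= rho ^+ 2].
pose G z := W z - eps * annulus_barrier a rho y z.
have [x0 x0K minx0] : exists2 x0, x0 \in K & forall z, z \in K -> G x0 <= G z.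
  apply: EVT_min_rV.
  - by exists x; move/andP: xK.
  - apply: (@compact_sqdist_le _ _ y (rho ^+ 2)) => [|z []//].
    apply: closedI; apply: closed_le_continuous => //; exact: cst_continuous.
  - have c1 : {within K, continuous W} by apply: within_continuousS cW => z [].
    have c2 : {within K, continuous (fun z => eps * annulus_barrier a rho y z)}.
      apply: continuous_subspaceT => z; apply: continuousM; last exact: cB.
      exact: cst_continuous.
    by move=> z; exact: continuousB (c1 z) (c2 z).
rewrite inE in x0K; have [x0s x0r] := x0K; rewrite /= in x0s x0r.
have GE z : (0 <= G z) = (eps * annulus_barrier a rho y z <= W z).
  by rewrite subr_ge0.
rewrite -GE; apply: (@le_trans _ _ (G x0)); last first.
  by apply: minx0; rewrite inE; move/andP: xK.
rewrite leNgt; apply/negP => G0.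
have bar_le1 z : annulus_barrier a rho y z <= 1.
  rewrite /annulus_barrier lerBlDr (@le_trans _ _ 1) ?lerDl ?expR_ge0//.
  by rewrite -expR0 ler_expR mulNr oppr_le0 mulr_ge0 ?dot_ge0// ltW.
have x0s' : sig ^+ 2 < dot (x0 - y) (x0 - y).
  rewrite lt_neqAle x0s andbT; apply: contraTneq G0 => E; rewrite -leNgt GE.
  rewrite (@le_trans _ _ eps)// ?ger_pMr// ?minx1// inE/=.
  by rewrite E.
have x0r' : dot (x0 - y) (x0 - y) < rho ^+ 2.
  rewrite lt_neqAle x0r andbT; apply: contraTneq G0 => E; rewrite -leNgt GE.
  by rewrite /annulus_barrier E subrr mulr0 W0.
have oK : \forall z \near x0, z \in K.
  have o1 : open [set z | sig ^+ 2 < dot (z - y) (z - y)].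
    by apply: open_lt_continuous => //; exact: cst_continuous.
  have o2 : open [set z | dot (z - y) (z - y) < rho ^+ 2].
    by apply: open_lt_continuous => //; exact: cst_continuous.
  apply: filterS2 (open_near o1 x0s') (open_near o2 x0r') => z z1 z2.
  by rewrite inE; split; apply: ltW.
pose s := dot (x0 - y) (x0 - y).
have De (z : R) : is_derive z 1 (fun z => expR (- a * z)) (- a * expR (- a * z)).
  have Dl : is_derive z 1 (fun z => - a * z) (- a).
    by have := is_derive1Zl (- a) (is_derive_id z 1); rewrite mulr1.
  rewrite mulrC; exact: (@is_derive1_comp _ expR (fun z => - a * z) z _ _ (is_derive_expR _) Dl).
pose F z := eps * (expR (- a * z) - expR (- a * rho ^+ 2)).
pose F1 z := eps * (- a * expR (- a * z)).
have DF (z : R) : is_derive z 1 F (F1 z).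
  apply: is_derive1Zl.
  by have := is_derive1B (De z) (is_derive_cst (expR (- a * rho ^+ 2)) z 1); rewrite subr0.
have DF1 (z : R) : is_derive z 1 F1 (eps * (- a * (- a * expR (- a * z)))).
  by apply: is_derive1Zl; apply: is_derive1Zl; exact: De.
have nDF : \forall z \near dot (x0 - y) (x0 - y), is_derive (z : R) 1 F (F1 z).
  by near=> z; exact: DF.
have sd h := second_derive0_radial h nDF (DF1 s).
have min0 : \forall z \near x0, W x0 - eps * annulus_barrier a rho y x0 <=
    W z - eps * annulus_barrier a rho y z.
  by apply: filterS oK => z zK; exact: minx0.
have x0ann : sig ^+ 2 < dot (x0 - y) (x0 - y) < rho ^+ 2 by rewrite x0s' x0r'.
have [k ell] := super x0 x0ann _ _ min0 sd.
rewrite -/s big_split/= -!mulr_sumr.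
have /andP[ell1 _] := ell (x0 - y).
have /andP[_ tr2] := elliptic_trace ell.
rewrite leNgt => /negP; apply.
set S1 := \sum_i _ in ell1 *; set S2 := \sum_i _ in tr2 *.
rewrite /F1; set E := expR _.
have E0 : 0 < E by exact: expR_gt0.
have -> : 4 * (eps * (- a * (- a * E))) * S1 + 2 * (eps * (- a * E)) * S2 =
  2 * eps * a * E * (2 * a * S1 - S2) by ring.
have two0 : 0 < 2 :> R by [].
apply: (mulr_gt0 (mulr_gt0 (mulr_gt0 (mulr_gt0 two0 eps0) a0) E0)).
rewrite subr_gt0; apply: (le_lt_trans tr2).
have h1 : lam * sig ^+ 2 <= S1 by apply: le_trans ell1; rewrite ler_pM2l// ltW.
have h2 : a * (lam * sig ^+ 2) = Lam * N%:R + 1.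
  by rewrite /a divfK// gt_eqF// mulr_gt0.
have h3 : a * (lam * sig ^+ 2) <= a * S1 by rewrite ler_pM2l.
have h4 : 0 <= Lam * N%:R by rewrite mulr_ge0// ltW.
by rewrite h2 in h3; lra.
Unshelve. all: by end_near. Qed.

End TestFunctions.

(** * Hopf's lemma and the strong maximum principle *)

Section MaximumPrinciples.
Variables (R : realType) (N : nat) (lam Lam : R).
Hypotheses (lam0 : 0 < lam) (lamLam : lam <= Lam).
Local Notation V := 'rV[R]_N.
Implicit Types (x y h e : V) (W : V -> R).
Let super := @supersolution_at R N lam Lam.

(** In the outer annulus [exp s >= 1 + s] turns the exponential barrier into a multiple of
    [r ^ 2 - |x|^2], a quantity comparable to the distance to the sphere; in the inner ball the
    minimum of [W] suffices. *)
Lemma hopf_bound W (r : R) : 0 < r ->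
  {within [set x | dot x x <= r ^+ 2], continuous W} ->
  (forall x, dot x x <= r ^+ 2 -> 0 <= W x) ->
  (forall x, dot x x < r ^+ 2 -> 0 < W x) ->
  (forall x, dot x x < r ^+ 2 -> super W x 0) ->
  exists2 c, 0 < c & forall x, dot x x <= r ^+ 2 -> c * (r ^+ 2 - dot x x) <= W x.
Proof.
move=> r0 cW W0 Wpos sW.
have r2 : 0 < r / 2 by rewrite divr_gt0.
have r2r : r / 2 < r by lra.
have rr : 0 < r ^+ 2 by rewrite exprn_gt0.
have lt2 : (r / 2) ^+ 2 < r ^+ 2 by rewrite ltr_pXn2r ?nnegrE ?ltW.
have E : [set x : V | dot (x - 0) (x - 0) <= r ^+ 2] = [set x | dot x x <= r ^+ 2].
  by apply/seteqP; split => x /=; rewrite subr0.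
have [a [a0 [eps eps0 He]]] : exists a, 0 < a /\ exists2 eps, 0 < eps &
    forall x, (r / 2) ^+ 2 <= dot (x - 0) (x - 0) <= r ^+ 2 ->
      eps * annulus_barrier a r 0 x <= W x.
  apply: (annulus_lower_bound lam0 lamLam r2 r2r); rewrite ?E//.
  - by move=> x; rewrite subr0; exact: W0.
  - by move=> x; rewrite subr0 => h; apply: Wpos; exact: le_lt_trans lt2.
  - by move=> x; rewrite subr0 => /andP[_]; exact: sW.
have [x1 x1s minx1] : exists2 x1, x1 \in [set x : V | dot x x <= (r / 2) ^+ 2] &
    forall x, x \in [set x : V | dot x x <= (r / 2) ^+ 2] -> W x1 <= W x.
  apply: EVT_min_rV.
  - by exists 0; rewrite /= dot0r ltW// exprn_gt0.
  - apply: (@compact_sqdist_le _ _ 0 ((r / 2) ^+ 2)); last by move=> x /=; rewrite subr0.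
    apply: closed_le_continuous; last exact: cst_continuous.
    by have := @continuous_sqdist R N 0; under eq_fun do rewrite subr0.
  - by apply: within_continuousS cW => x /= /le_trans; apply; exact: ltW.
rewrite inE/= in x1s.
have W1 : 0 < W x1 by apply: Wpos; exact: le_lt_trans lt2.
pose c1 := eps * (a * expR (- a * r ^+ 2)).
have c10 : 0 < c1 by rewrite !mulr_gt0// expR_gt0.
exists (Num.min c1 (W x1 / r ^+ 2)); first by rewrite lt_min c10 divr_gt0.
move=> x xr; have d0 : 0 <= r ^+ 2 - dot x x by rewrite subr_ge0.
have [xs|xs] := leP (dot x x) ((r / 2) ^+ 2).
  apply: (@le_trans _ _ (W x1)); last by apply: minx1; rewrite inE.
  apply: (@le_trans _ _ (W x1 / r ^+ 2 * (r ^+ 2 - dot x x))).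
    by rewrite ler_wpM2r// ge_min lexx orbT.
  by rewrite mulrAC ler_pdivrMr// ler_pM2l// lerBlDr lerDl dot_ge0.
apply: le_trans (He x _); last by rewrite subr0 xr ltW.
apply: (@le_trans _ _ (c1 * (r ^+ 2 - dot x x))).
  by rewrite ler_wpM2r// ge_min lexx.
rewrite /c1 /annulus_barrier subr0 -mulrA ler_pM2l//.
have -> : - a * dot x x = - a * r ^+ 2 + a * (r ^+ 2 - dot x x) by ring.
rewrite expRD -[X in _ <= _ - X]mulr1 -mulrBr mulrAC [leLHS]mulrC.
rewrite ler_pM2l ?expR_gt0//.
by have := expR_ge1Dx (a * (r ^+ 2 - dot x x)); lra.
Qed.

(** [W] is positive on a small ball about [y] by continuity, and the barrier carries this up to the
    outer sphere. *)
Lemma positivity_ball W y (rho : R) : 0 < rho ->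
  {within [set x | dot (x - y) (x - y) <= rho ^+ 2], continuous W} ->
  (forall x, dot (x - y) (x - y) <= rho ^+ 2 -> 0 <= W x) ->
  (forall x, dot (x - y) (x - y) < rho ^+ 2 -> super W x 0) ->
  0 < W y -> forall x, dot (x - y) (x - y) < rho ^+ 2 -> 0 < W x.
Proof.
move=> rho0 cW W0 sW Wy x xr.
have rr : 0 < rho ^+ 2 by rewrite exprn_gt0.
have yy : dot (y - y) (y - y) <= rho ^+ 2 by rewrite subrr dot0r ltW.
have near_pos : \forall z \near y, dot (z - y) (z - y) <= rho ^+ 2 -> 0 < W z.
  have P : nbhs (W y) [set w : R | 0 < w] by exact: lt_nbhsr.
  exact: (within_continuousP _ _).1 cW y yy _ P.
have /nbhs_ballP[d /= d0 Hd] := near_pos.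
pose sig := Num.min d rho / 2.
have m0 : 0 < Num.min d rho by rewrite lt_min d0.
have sig0 : 0 < sig by rewrite divr_gt0.
have sigm : sig < Num.min d rho by rewrite /sig; lra.
have [sd sr] : sig < d /\ sig < rho by move: sigm; rewrite lt_min => /andP[].
have ss : sig ^+ 2 < rho ^+ 2 by rewrite ltr_pXn2r ?nnegrE ?ltW.
have Ws z : dot (z - y) (z - y) <= sig ^+ 2 -> 0 < W z.
  move=> zs; apply: Hd; last by rewrite (le_trans zs)// ltW.
  rewrite -ball_normE/= distrC (le_lt_trans _ sd)//.
  by apply: norm_le_dot => //; exact: ltW.
have [xs|xs] := leP (dot (x - y) (x - y)) (sig ^+ 2); first exact: Ws.
have [|a [a0 [eps eps0 He]]] := annulus_lower_bound lam0 lamLam sig0 sr cW W0 Ws.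
  by move=> z /andP[_]; exact: sW.
apply: lt_le_trans (He x _); last by rewrite !ltW.
by rewrite mulr_gt0// /annulus_barrier subr_gt0 ltr_expR !mulNr ltrN2 ltr_pM2l.
Qed.

(** A chain of balls along the segment from [x] to [y]. Convexity lets one radius serve all of them:
    the balls about the two ends sweep out a tube inside [D]. *)
Lemma strong_positivity W (D : set V) : open D ->
  (forall x y (t : R), D x -> D y -> 0 <= t <= 1 -> D (x + t *: (y - x))) ->
  (forall x, D x -> {for x, continuous W}) -> (forall x, D x -> 0 <= W x) ->
  (forall x, D x -> super W x 0) ->
  forall x y, D x -> D y -> 0 < W x -> 0 < W y.
Proof.
move=> oD cvx cW W0 sW x y Dx Dy Wx.
have ballD z : D z -> exists2 rho, 0 < rho & forall w, dot w w <= rho ^+ 2 -> D (z + w).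
  move=> Dz; have /nbhs_ballP[d /= d0 Hd] := open_near oD Dz.
  exists (d / 2) => [|w ww]; first by rewrite divr_gt0.
  apply: Hd; rewrite -ball_normE/= opprD addrA subrr add0r normrN.
  apply: (@le_lt_trans _ _ (d / 2)); last by lra.
  by apply: norm_le_dot => //; rewrite divr_ge0// ltW.
have [r1 r10 H1] := ballD x Dx; have [r2 r20 H2] := ballD y Dy.
pose rho := Num.min r1 r2; have rho0 : 0 < rho by rewrite lt_min r10.
have le1 : rho ^+ 2 <= r1 ^+ 2 by rewrite ler_pXn2r ?nnegrE ?(ltW rho0) ?(ltW r10)// ge_min lexx.
have le2 : rho ^+ 2 <= r2 ^+ 2.
  by rewrite ler_pXn2r ?nnegrE ?(ltW rho0) ?(ltW r20)// ge_min lexx orbT.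
have tube (t : R) w : 0 <= t <= 1 -> dot w w <= rho ^+ 2 -> D (x + t *: (y - x) + w).
  move=> t01 ww.
  have -> : x + t *: (y - x) + w = (x + w) + t *: ((y + w) - (x + w)).
    by rewrite addrAC; congr (_ + _ *: _); rewrite opprD addrACA subrr addr0.
  by apply: cvx => //; [apply: H1|apply: H2]; exact: le_trans ww _.
(* With [n] steps, consecutive centres [g i] are less than [rho] apart. *)
pose n := Num.bound (enorm (y - x) / rho).
have n_gt : enorm (y - x) / rho < n%:R.
  by apply: archi_boundP; rewrite divr_ge0 ?enorm_ge0// ltW.
have n0 : 0 < n%:R :> R by apply: le_lt_trans n_gt; rewrite divr_ge0 ?enorm_ge0// ltW.
pose g (i : nat) : V := x + (i%:R / n%:R) *: (y - x).
have step i : (i <= n)%N -> 0 < W (g i).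
  elim: i => [|i IH] lein; first by rewrite /g mul0r scale0r addr0.
  have t01 : 0 <= (i%:R / n%:R : R) <= 1.
    by rewrite divr_ge0 ?ler0n//= ler_pdivrMr// mul1r ler_nat ltnW.
  have inD z : dot (z - g i) (z - g i) <= rho ^+ 2 -> D z.
    by move=> /(tube _ _ t01); rewrite -/(g i) addrC subrK.
  apply: (@positivity_ball W (g i) rho rho0).
  - by apply: continuous_in_subspaceT => z /set_mem/= /inD; exact: cW.
  - by move=> z /inD; exact: W0.
  - by move=> z /ltW/inD; exact: sW.
  - by apply: IH; exact: ltnW.
  have -> : g i.+1 - g i = n%:R^-1 *: (y - x).
    rewrite /g opprD addrACA subrr add0r -scalerBl -mulrBl -natrB ?leqnSn//.
    by rewrite subSnn mul1r.
  rewrite dotZl dotZr -enorm_sqr mulrA -expr2 -exprMn.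
  rewrite ltr_pXn2r ?nnegrE ?(ltW rho0) ?mulr_ge0 ?enorm_ge0 ?invr_ge0 ?(ltW n0)//.
  by rewrite mulrC ltr_pdivrMr// -ltr_pdivrMl// mulrC.
have := step n (leqnn n).
by rewrite /g divff ?gt_eqF// scale1r addrC subrK.
Qed.

End MaximumPrinciples.

(** * The maximum principle near the sphere and near the reflecting plane *)

Section NarrowRegions.
Variables (R : realType) (N : nat) (lam Lam : R).
Hypotheses (lam0 : 0 < lam) (lamLam : lam <= Lam).
Local Notation V := 'rV[R]_N.
Implicit Types (x y h e : V) (mu : R).
Let super := @supersolution_at R N lam Lam.

Lemma supersolution_le W x (a b : R) : a <= b -> super W x a -> super W x b.
Proof.
move=> ab sW psi l h1 h2; have [k ell le_a] := sW psi l h1 h2.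
by exists k => //; exact: le_trans ab.
Qed.

(** At [z = |x|^2], the quantity [d = r ^ 2 - z] takes the place of the distance to the sphere. The
    term [- K d ^ (1 + th)] has a second derivative of order [- d ^ (th - 1)] in the normal
    direction. *)
Definition sphere_barrier (r K L th : R) (z : R) :=
  1 + (L * (r ^+ 2 - z) - K * (r ^+ 2 - z) `^ (1 + th)).

Lemma is_derive_powR_sub (c b z : R) : z < c ->
  is_derive z 1 (fun z => (c - z) `^ b) (- (b * (c - z) `^ (b - 1))).
Proof.
move=> zc.
have Dl : is_derive z 1 (fun z => c - z) (- 1).
  by have := is_derive1B (is_derive_cst c z 1) (is_derive_id z 1); rewrite sub0r.
have cz : 0 < c - z by rewrite subr_gt0.
have := @is_derive1_comp _ (@powR R ^~ b) (fun z => c - z) z _ _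
  (is_derive1_powR b cz) Dl.
by rewrite mulrN1.
Qed.

Lemma sphere_barrier_second_derive (r K L th : R) x h : dot x x < r ^+ 2 ->
  second_derive0 (fun t => sphere_barrier r K L th (dot (x + t *: h) (x + t *: h)))
    (- (4 * (K * (1 + th) * th * (r ^+ 2 - dot x x) `^ (th - 1)) * dot x h ^+ 2
        + 2 * (L - K * (1 + th) * (r ^+ 2 - dot x x) `^ th) * dot h h)).
Proof.
move=> xr.
pose F1 z := - L + K * (1 + th) * (r ^+ 2 - z) `^ th.
have DF z : z < r ^+ 2 -> is_derive z 1 (sphere_barrier r K L th) (F1 z).
  move=> zr.
  have -> : F1 z = 0 + (L * (0 - 1) - K * (- ((1 + th) * (r ^+ 2 - z) `^ (1 + th - 1)))).
    by rewrite /F1 (_ : 1 + th - 1 = th); [ring|rewrite addrAC subrr add0r].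
  have H1 := is_derive1Zl L (is_derive1B (is_derive_cst (r ^+ 2) z 1) (is_derive_id z 1)).
  have H2 := is_derive1Zl K (is_derive_powR_sub (1 + th) zr).
  exact: (is_derive1D (is_derive_cst (1 : R) z 1) (is_derive1B H1 H2)).
have DF1 z : z < r ^+ 2 ->
    is_derive z 1 F1 (- (K * (1 + th) * th * (r ^+ 2 - z) `^ (th - 1))).
  move=> zr.
  have -> : - (K * (1 + th) * th * (r ^+ 2 - z) `^ (th - 1)) =
      0 + K * (1 + th) * - (th * (r ^+ 2 - z) `^ (th - 1)) by ring.
  have H := is_derive1Zl (K * (1 + th)) (is_derive_powR_sub th zr).
  exact: (is_derive1D (is_derive_cst (- L) z 1) H).
have nDF : \forall z \near dot x x, is_derive (z : R) 1 (sphere_barrier r K L th) (F1 z).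
  by apply: filterS (lt_nbhsl xr) => z; exact: DF.
have := second_derive0_radial0 h nDF (DF1 _ xr).
by move=> /second_derive0_eq; apply; rewrite /F1; ring.
Qed.

Lemma planar_barrier_second_derive (a mu : R) x h e :
  second_derive0 (fun t => 1 - expR (- a * (dot (x + t *: h) e - mu)))
    (- (a ^+ 2 * expR (- a * (dot x e - mu)) * dot h e ^+ 2)).
Proof.
have De (z : R) : is_derive z 1 (fun z => expR (- a * (z - mu)))
    (- a * expR (- a * (z - mu))).
  rewrite mulrC; exact: (@is_derive1_comp _ expR (fun z => - a * (z - mu)) z _ _
    (is_derive_expR _) (is_derive1_affine _ _ _)).
pose G1 z := a * expR (- a * (z - mu)).
have DG (z : R) : is_derive z 1 (fun z => 1 - expR (- a * (z - mu))) (G1 z).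
  have -> : G1 z = 0 - - a * expR (- a * (z - mu)) by rewrite /G1; ring.
  exact: (is_derive1B (is_derive_cst (1 : R) z 1) (De z)).
have nDG : \forall z \near dot x e,
    is_derive (z : R) 1 (fun z => 1 - expR (- a * (z - mu))) (G1 z).
  by near=> z; exact: DG.
have := second_derive0_planar h nDG (is_derive1Zl a (De (dot x e))).
by move=> /second_derive0_eq; apply; ring.
Unshelve. all: by end_near. Qed.

(* The comparison function is [sphere_barrier], whose second derivatives beat
   the right-hand side near the sphere, plus [1 - exp (- a * (x.e - mu))], which
   beats it near the hyperplane [x.e = mu]. *)
Lemma narrow_max_principle (r C th : R) : 0 < r -> 0 < C -> 0 < th -> th <= 1 ->
  exists a s0 : R, [/\ 0 < a, 0 < s0 & forall e mu (U W : V -> R),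
  let K := [set x | dot x x <= r ^+ 2] `&` [set x | mu <= dot x e] in
  dot e e = 1 ->
  {within K, continuous U} -> {within K, continuous W} ->
  (forall x, K x -> dot x x = r ^+ 2 \/ dot x e = mu -> 0 <= U x /\ 0 <= W x) ->
  (forall x m, dot x x < r ^+ 2 -> mu < dot x e -> 0 <= m -> - m <= W x ->
    super U x (C * (r ^+ 2 - dot x x) `^ (th - 1) * m)) ->
  (forall x m, dot x x < r ^+ 2 -> mu < dot x e -> 0 <= m -> - m <= U x ->
    super W x (C * (r ^+ 2 - dot x x) `^ (th - 1) * m)) ->
  (forall x, K x -> s0 <= r ^+ 2 - dot x x -> mu + a^-1 <= dot x e ->
    0 <= U x /\ 0 <= W x) ->
  forall x, K x -> 0 <= U x /\ 0 <= W x].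
Proof.
move=> r0 C0 th0 th1.
have rr : 0 < r ^+ 2 by rewrite exprn_gt0.
(* With [d = r ^ 2 - |x|^2], in the layer [d < s0] one has [|x|^2 >= r ^ 2 / 2], and this [Kc] makes
   the radial term at least [4 C d ^ (th - 1)], against a right-hand side of at most
   [3 C d ^ (th - 1)], up to the common factor [t] in [touch]. *)
pose Kc := 2 * C / (th * lam * r ^+ 2).
have Kc0 : 0 < Kc by rewrite divr_gt0 ?mulr_gt0.
have KcE : Kc * (th * lam * r ^+ 2) = 2 * C by rewrite divfK// gt_eqF// !mulr_gt0.
(* The slope that keeps the barrier nondecreasing in [d] on [[0, r ^ 2]]: its value is then at least
   [1], and the coefficient [c2] of [|h|^2] below is nonnegative. *)
pose L := Kc * (1 + th) * (r ^+ 2) `^ th.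
have th10 : 0 < 1 + th by rewrite addr_gt0.
have L0 : 0 < L by rewrite mulr_gt0 ?powR_gt0// mulr_gt0.
(* Width of the layer; [L * s0 <= 1] bounds the comparison function [phi] by [3] in it. *)
pose s0 := Num.min (r ^+ 2 / 2) (L^-1).
have s00 : 0 < s0 by rewrite lt_min divr_gt0// invr_gt0.
have Ls0 : L * s0 <= 1.
  by rewrite -ler_pdivlMl// mulr1 ge_min lexx orbT.
have s0r : s0 <= r ^+ 2 / 2 by rewrite ge_min lexx.
pose E1 : R := expR (- 1).
have E10 : 0 < E1 by exact: expR_gt0.
(* Bounds the right-hand side off the layer, where [d ^ (th - 1) <= s0 ^ (th - 1)] and
   [phi <= 2 + L * r ^ 2]. *)
pose D := C * s0 `^ (th - 1) * (2 + L * r ^+ 2).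
have D0 : 0 < D.
  have h1 : 0 < 2 + L * r ^+ 2 by rewrite addr_gt0// mulr_gt0.
  by rewrite mulr_gt0// mulr_gt0// powR_gt0.
(* In the strip [x.e - mu < 1 / a] the exponential is at least [exp (- 1)], so the planar barrier
   contributes at least [a ^ 2 * lam * exp (- 1)], which must exceed [D]. The summand [1] gives
   [a <= a ^ 2] and strictness. *)
pose a := 1 + D / (lam * E1).
have lE : 0 < lam * E1 by exact: mulr_gt0.
have a1 : 1 <= a by rewrite lerDl; apply: ltW; exact: divr_gt0.
have a0 : 0 < a by exact: lt_le_trans a1.
have aE : D < a ^+ 2 * (lam * E1).
  have : D < a * (lam * E1).
    by rewrite /a mulrDl mul1r divfK ?gt_eqF// ltrDr.
  move=> /lt_le_trans; apply; rewrite ler_pM2r// expr2.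
  by rewrite ler_peMl// ltW.
clearbody a s0.
exists a, s0; split => // e mu U W K ee cU cW bd sU sW reg.
pose s x := r ^+ 2 - dot x x.
pose phi x := sphere_barrier r Kc L th (dot x x) + (1 - expR (- a * (dot x e - mu))).
have sK x : K x -> 0 <= s x by move=> [/= h _]; rewrite subr_ge0.
have s_le x : s x <= r ^+ 2 by rewrite lerBlDr lerDl dot_ge0.
have sth x : K x -> Kc * (1 + th) * s x `^ th <= L.
  move=> Kx; rewrite ler_pM2l; last exact: mulr_gt0.
  by apply: ge0_ler_powR; [exact: ltW|exact: sK|exact: ltW|exact: s_le].
have bar1 x : K x -> 1 <= sphere_barrier r Kc L th (dot x x) <= 1 + L * s x.
  move=> Kx; have sx := sK x Kx; rewrite /sphere_barrier -/(s x) lerDl.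
  have -> : s x `^ (1 + th) = s x * s x `^ th.
    by rewrite addrC -[in RHS](addrK 1 th) mulr_powRB1// addr_gt0.
  have p0 := powR_ge0 (s x) th.
  apply/andP; split.
    rewrite subr_ge0 mulrCA mulrC ler_wpM2r//; apply: le_trans (sth x Kx).
    by rewrite ler_wpM2r// ler_peMr ?(ltW Kc0)// lerDl ltW.
  by rewrite lerD2l lerBlDr lerDl mulr_ge0 ?(ltW Kc0)// mulr_ge0.
have bar2 x : K x -> 0 <= 1 - expR (- a * (dot x e - mu)) <= 1.
  move=> [_ /= h]; rewrite lerBlDr lerDl expR_ge0 andbT subr_ge0 -expR0 ler_expR.
  by rewrite mulNr oppr_le0 mulr_ge0 ?(ltW a0)// subr_ge0.
have phi0 x : K x -> 0 < phi x.
  by move=> Kx; have /andP[? _] := bar1 x Kx; have /andP[? _] := bar2 x Kx; rewrite /phi; lra.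
have cphi : {within K, continuous phi}.
  have cs : continuous s.
    have := @continuous_sqdist R N 0; rewrite (_ : (fun x => _) = (fun x => dot x x)).
      move=> c x; apply: (@continuousB _ _ _ (fun=> r ^+ 2) (fun x => dot x x)); last exact: c.
      exact: cst_continuous.
    by apply/funext => x; rewrite subr0.
  have cp : {within K, continuous (fun x => s x `^ (1 + th))}.
    exact: (within_continuous_comp cs sK (within_powR th10)).
  have c1 : {within K, continuous (fun x => 1 + L * s x + (1 - expR (- a * (dot x e - mu))))}.
    apply: continuous_subspaceT => x.
    apply: (@continuousD _ _ _ (fun x => 1 + L * s x) (fun x => 1 - expR (- a * (dot x e - mu)))).
      apply: (@continuousD _ _ _ (fun=> 1 : R) (fun x => L * s x)); first exact: cst_continuous.
      by apply: continuousM; [exact: cst_continuous|exact: cs].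
    apply: (@continuousB _ _ _ (fun=> 1 : R) (fun x => expR (- a * (dot x e - mu)))); first exact: cst_continuous.
    apply: (@continuous_comp _ _ _ (fun x => - a * (dot x e - mu)) expR); last exact: continuous_expR.
    apply: continuousM; first exact: cst_continuous.
    apply: (@continuousB _ _ _ (fun x => dot x e) (fun=> mu)); last exact: cst_continuous.
    exact: continuous_dotl.
  have -> : phi = (fun x => 1 + L * s x + (1 - expR (- a * (dot x e - mu))) - Kc * s x `^ (1 + th)).
    by apply/funext => x; rewrite /phi /sphere_barrier -/(s x); ring.
  have c2 : {within K, continuous (fun x => Kc * s x `^ (1 + th))}.
    apply/subspace_continuousP => x Kx; apply: cvgM; first exact: cvg_cst.
    exact: (subspace_continuousP _ _).1 cp x Kx.
  by move=> x; exact: continuousB (c1 x) (c2 x).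
(* Stated for either order of the components. Here [- t] is the smaller of the minima of [U / phi]
   and [W / phi], attained by [U1] at [x0]: there [- t * phi] touches [U1] from below, while
   [- t * phi x0 <= W1 x0] allows the right-hand side with [m = t * phi x0]. *)
have touch (U1 W1 : V -> R) (t : R) x0 : K x0 -> 0 < t ->
    (forall x, K x -> dot x x = r ^+ 2 \/ dot x e = mu -> 0 <= U1 x) ->
    (forall x m, dot x x < r ^+ 2 -> mu < dot x e -> 0 <= m -> - m <= W1 x ->
      super U1 x (C * s x `^ (th - 1) * m)) ->
    (forall x, K x -> s0 <= s x -> mu + a^-1 <= dot x e -> 0 <= U1 x) ->
    (forall x, K x -> - t * phi x <= U1 x) -> - t * phi x0 <= W1 x0 ->
    U1 x0 = - t * phi x0 -> False.
  move=> Kx0 t0 bd1 sU1 reg1 min1 W1x0 U1x0.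
  have U1neg : U1 x0 < 0 by rewrite U1x0 mulNr oppr_lt0 mulr_gt0// phi0.
  have [x0r x0e] := Kx0; rewrite /= in x0r x0e.
  have x0r' : dot x0 x0 < r ^+ 2.
    rewrite lt_neqAle x0r andbT; apply: contraTneq U1neg => E.
    by rewrite -leNgt bd1//; left.
  have x0e' : mu < dot x0 e.
    rewrite lt_neqAle x0e andbT; apply: contraTneq U1neg => E.
    by rewrite -leNgt bd1//; right.
  have s_gt0 : 0 < s x0 by rewrite subr_gt0.
  have region : s x0 < s0 \/ dot x0 e < mu + a^-1.
    have [h1|] := ltP (s x0) s0; first by left.
    have [h2|h2 h1] := ltP (dot x0 e) (mu + a^-1); first by right.
    by have := reg1 x0 Kx0 h1 h2; rewrite leNgt U1neg.
  have nK : \forall x \near x0, K x.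
    have o1 : open [set x : V | dot x x < r ^+ 2].
      have := @continuous_sqdist R N 0; under eq_fun do rewrite subr0.
      by move=> c; apply: open_lt_continuous => //; exact: cst_continuous.
    have o2 : open [set x : V | mu < dot x e].
      apply: open_lt_continuous; first exact: cst_continuous.
      exact: continuous_dotl.
    apply: filterS2 (open_near o1 x0r') (open_near o2 x0e') => x h1 h2.
    by split; exact: ltW.
  have min0 : \forall x \near x0, U1 x0 - - t * phi x0 <= U1 x - - t * phi x.
    by apply: filterS nK => x Kx; rewrite U1x0 subrr subr_ge0 min1.
  have sd h := second_derive0Z (- t) (second_derive0D
    (sphere_barrier_second_derive Kc L th h x0r')
    (planar_barrier_second_derive a mu x0 h e)).
  have m0 : 0 <= t * phi x0 by rewrite mulr_ge0 ?ltW// phi0.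
  have mW : - (t * phi x0) <= W1 x0 by rewrite -mulNr.
  have [k ell] := sU1 x0 _ x0r' x0e' m0 mW _ _ min0 sd.
  set P := s x0 `^ (th - 1); have P0 : 0 < P by exact: powR_gt0.
  set X := expR _; set c2 := L - _.
  pose S1 := \sum_i dot x0 (k i) ^+ 2; pose S2 := \sum_i dot (k i) (k i).
  pose S3 := \sum_i dot e (k i) ^+ 2.
  have -> : \sum_i - t * (- (4 * (Kc * (1 + th) * th * P) * dot x0 (k i) ^+ 2 +
      2 * c2 * dot (k i) (k i)) + - (a ^+ 2 * X * dot (k i) e ^+ 2)) =
      t * (4 * (Kc * (1 + th) * th * P) * S1 + 2 * c2 * S2 + a ^+ 2 * X * S3).
    rewrite /S1 /S2 /S3 !mulr_sumr -!big_split/= mulr_sumr; apply: eq_bigr => i _.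
    by rewrite (dotC (k i) e); ring.
  rewrite (mulrCA (C * P)) ler_pM2l//.
  have /andP[S1ge _] : lam * dot x0 x0 <= S1 <= _ := ell x0.
  have /andP[S3ge _] : lam * dot e e <= S3 <= _ := ell e.
  rewrite ee mulr1 in S3ge.
  have S20 : 0 <= S2 by apply: sumr_ge0 => i _; exact: dot_ge0.
  have c20 : 0 <= c2 by rewrite subr_ge0; exact: sth.
  have X0 : 0 < X by exact: expR_gt0.
  have n2 : 0 <= 2 * c2 * S2 by rewrite mulr_ge0// mulr_ge0.
  have S10 : 0 <= S1 by apply: sumr_ge0 => i _; exact: sqr_ge0.
  have cc : 0 < Kc * (1 + th) * th * P := mulr_gt0 (mulr_gt0 (mulr_gt0 Kc0 th10) th0) P0.
  have n1 : 0 <= 4 * (Kc * (1 + th) * th * P) * S1.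
    by rewrite mulr_ge0// mulr_ge0// ltW.
  have n3 : 0 <= a ^+ 2 * X * S3 by rewrite mulr_ge0 ?(mulr_ge0 (sqr_ge0 a) (ltW X0))// (le_trans (ltW lam0)).
  have /andP[_ b1] := bar1 x0 Kx0; have /andP[_ b2] := bar2 x0 Kx0.
  apply/negP; rewrite -ltNge.
  have [s_lt|s_ge] := ltP (s x0) s0.
    have phi3 : phi x0 <= 3.
      have : L * s x0 <= L * s0 by rewrite ler_pM2l// ltW.
      by move: b1 b2 Ls0; rewrite /phi; clear -lam0 lamLam N super; lra.
    apply: (@le_lt_trans _ _ (C * P * 3)); first by rewrite ler_pM2l// mulr_gt0.
    have xx : r ^+ 2 / 2 <= dot x0 x0.
      by move: (ltW (lt_le_trans s_lt s0r)); rewrite /s; clear -lam0 lamLam N super; lra.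
    have l1 : lam * (r ^+ 2 / 2) <= S1 by apply: le_trans S1ge; rewrite ler_pM2l.
    have l2 : 4 * C * P <= 4 * (Kc * (1 + th) * th * P) * S1.
      apply: (@le_trans _ _ (4 * (Kc * (1 + th) * th * P) * (lam * (r ^+ 2 / 2)))).
        have -> : 4 * (Kc * (1 + th) * th * P) * (lam * (r ^+ 2 / 2)) =
            (1 + th) * (2 * P * (Kc * (th * lam * r ^+ 2))) by field.
        rewrite KcE; have : 0 <= th * (C * P) by rewrite mulr_ge0 ?(ltW th0)// mulr_ge0 ?ltW.
        by clear -lam0 lamLam N super; lra.
      by rewrite ler_wpM2l// mulr_ge0// ltW.
    by move: l2 n2 n3 (mulr_gt0 C0 P0); clear -lam0 lamLam N super; lra.
  have x0lt : dot x0 e < mu + a^-1.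
    by case: region => //; rewrite ltNge s_ge.
  have XE : E1 <= X.
    rewrite /X /E1 ler_expR mulNr lerN2 -(divff (lt0r_neq0 a0)) ler_pM2l//.
    by rewrite lerBlDl ltW.
  have PP : P <= s0 `^ (th - 1).
    have thE : th - 1 = - (1 - th) by rewrite opprB.
    rewrite /P thE !powRN lef_pV2 ?posrE ?powR_gt0//.
    by rewrite ge0_ler_powR ?nnegrE ?subr_ge0// ltW.
  have phiL : phi x0 <= 2 + L * r ^+ 2.
    have : L * s x0 <= L * r ^+ 2 by rewrite ler_pM2l.
    by move: b1 b2; rewrite /phi; clear -lam0 lamLam N super; lra.
  apply: (@le_lt_trans _ _ D).
    rewrite /D; apply: ler_pM.
    - by rewrite mulr_ge0 ?ltW.
    - by rewrite ltW// phi0.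
    - by rewrite ler_pM2l.
    - exact: phiL.
  apply: (lt_le_trans aE); apply: (@le_trans _ _ (a ^+ 2 * X * S3)).
    rewrite -mulrA ler_pM2l ?exprn_gt0// mulrC.
    by apply: ler_pM => //; exact: ltW.
  by move: n1 n2; clear -lam0 lamLam N super; lra.
have cdiv (F : V -> R) : {within K, continuous F} -> {within K, continuous (fun x => F x / phi x)}.
  move=> cF; apply/subspace_continuousP => x Kx.
  apply: cvgM; first exact: (subspace_continuousP _ _).1 cF x Kx.
  apply: cvgV; first by rewrite gt_eqF// phi0.
  exact: (subspace_continuousP _ _).1 cphi x Kx.
have cK : compact K.
  apply: (@compact_sqdist_le _ _ 0 (r ^+ 2)); last by move=> x [/= h _]; rewrite subr0.
  apply: closedI; apply: closed_le_continuous; try exact: cst_continuous.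
    have := @continuous_sqdist R N 0; rewrite (_ : (fun x => _) = (fun x => dot x x))//.
    by apply/funext => x; rewrite subr0.
  exact: continuous_dotl.
move=> x Kx; have K0 : K !=set0 by exists x.
have [x1 x1K min1] := EVT_min_rV K0 cK (cdiv U cU).
have [x2 x2K min2] := EVT_min_rV K0 cK (cdiv W cW).
rewrite inE in x1K; rewrite inE in x2K.
have {}min1 y : K y -> U x1 / phi x1 * phi y <= U y.
  by move=> Ky; rewrite -ler_pdivlMr ?phi0//; apply: min1; rewrite inE.
have {}min2 y : K y -> W x2 / phi x2 * phi y <= W y.
  by move=> Ky; rewrite -ler_pdivlMr ?phi0//; apply: min2; rewrite inE.
have main : 0 <= U x1 / phi x1 /\ 0 <= W x2 / phi x2.
  have [le12|/ltW le21] := leP (U x1 / phi x1) (W x2 / phi x2).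
    suff h : 0 <= U x1 / phi x1 by split => //; exact: le_trans le12.
    rewrite leNgt; apply/negP => neg.
    apply: (touch U W (- (U x1 / phi x1)) x1) => //.
    - by rewrite oppr_gt0.
    - by move=> y Ky /(bd y Ky)[].
    - by move=> y Ky h1 h2; have [] := reg y Ky h1 h2.
    - by move=> y Ky; rewrite opprK min1.
    - by rewrite opprK; apply: le_trans (min2 _ x1K); rewrite ler_pM2r ?phi0.
    - by rewrite opprK divfK// gt_eqF// phi0.
  suff h : 0 <= W x2 / phi x2 by split => //; exact: le_trans le21.
  rewrite leNgt; apply/negP => neg.
  apply: (touch W U (- (W x2 / phi x2)) x2) => //.
  - by rewrite oppr_gt0.
  - by move=> y Ky /(bd y Ky)[].
  - by move=> y Ky h1 h2; have [] := reg y Ky h1 h2.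
  - by move=> y Ky; rewrite opprK min2.
  - by rewrite opprK; apply: le_trans (min1 _ x2K); rewrite ler_pM2r ?phi0.
  - by rewrite opprK divfK// gt_eqF// phi0.
have [m1 m2] := main; split.
  by apply: le_trans (min1 x Kx); rewrite mulr_ge0// ltW// phi0.
by apply: le_trans (min2 x Kx); rewrite mulr_ge0// ltW// phi0.
Unshelve. all: by end_near. Qed.

End NarrowRegions.

(** * Moving planes *)

Section Reflections.
Variables (R : realType) (N : nat).
Local Notation V := 'rV[R]_N.
Implicit Types (x y h e : V) (mu : R).

Definition refl e mu x : V := x + (2 * (mu - dot x e)) *: e.

Lemma dot_refl e mu x : dot e e = 1 ->
  dot (refl e mu x) (refl e mu x) = dot x x - 4 * mu * (dot x e - mu).
Proof.
by move=> ee; rewrite /refl dotDl !dotDr !dotZl !dotZr ee (dotC e x); ring.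
Qed.

Lemma dot_refl_normal e mu x : dot e e = 1 -> dot (refl e mu x) e = 2 * mu - dot x e.
Proof. by move=> ee; rewrite /refl dotDl dotZl ee; ring. Qed.

Lemma refl_hyperplane e mu x : dot x e = mu -> refl e mu x = x.
Proof. by move=> xe; rewrite /refl xe subrr mulr0 scale0r addr0. Qed.

Lemma refl0_opp e x : refl (- e) 0 x = refl e 0 x.
Proof. by rewrite /refl dotNr !sub0r scalerN -scaleNr mulrN !opprK mulrN. Qed.

Lemma refl0K e x : dot e e = 1 -> refl e 0 (refl e 0 x) = x.
Proof.
move=> ee; rewrite {1}/refl dot_refl_normal// /refl -addrA -scalerDl.
have -> : 2 * (0 - dot x e) + 2 * (0 - (2 * 0 - dot x e)) = 0 by ring.
by rewrite scale0r addr0.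
Qed.

Lemma refl_line e mu x h (t : R) :
  refl e mu (x + t *: h) = refl e mu x + t *: (h - (2 * dot h e) *: e).
Proof.
rewrite /refl dotDl dotZl scalerBr scalerA -!addrA; congr (x + _).
rewrite [RHS]addrCA -scalerBl; congr (_ + _ *: _); ring.
Qed.

Lemma refl_continuous e mu : continuous (refl e mu).
Proof.
move=> x; apply: (@continuousD _ _ _ id (fun x => (2 * (mu - dot x e)) *: e)).
  exact: cvg_id.
apply: continuousZr_tmp.
apply: continuousM; first exact: cst_continuous.
apply: (@continuousB _ _ _ (fun=> mu) (fun x => dot x e)); first exact: cst_continuous.
exact: continuous_dotl.
Qed.

Lemma refl_continuous2 e x mu :
  {for (x, mu), continuous (fun z : V * R => refl e z.2 z.1)}.
Proof.
have c1 : {for (x, mu), continuous (fun z : V * R => z.1)} by exact: cvg_fst.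
have c2 : {for (x, mu), continuous (fun z : V * R => z.2)} by exact: cvg_snd.
have c3 : {for (x, mu), continuous (fun z : V * R => dot z.1 e)}.
  apply: (@continuous_dot _ _ _ (fun z : V * R => z.1) (fun=> e)) => //.
  exact: cst_continuous.
have c4 : (fun z : V * R => z.1 + (2 * (z.2 - dot z.1 e)) *: e) @ (x, mu) -->
    x + (2 * (mu - dot x e)) *: e.
  apply: cvgD; first exact: c1.
  apply: cvgZr_tmp; apply: cvgM; first exact: cvg_cst.
  by apply: cvgB; [exact: c2|exact: c3].
exact: c4.
Qed.

Lemma qform_mx (A : 'M[R]_N) h : qform A h = (h *m A *m h^T) ord0 ord0.
Proof.
rewrite mxE /qform exchange_big/=; apply: eq_bigr => j _.
rewrite !mxE mulr_suml; apply: eq_bigr => i _; ring.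
Qed.

(** [P = 1 - 2 e^T e] is the matrix of the reflection, symmetric and its own inverse; conjugation by
    it preserves the characteristic polynomial, hence the Pucci operator. *)
Lemma refl_matrix (lam Lam : R) sgn (A : 'M[R]_N) e : A^T = A -> dot e e = 1 ->
  exists B : 'M[R]_N, [/\ B^T = B,
    forall h, qform B h = qform A (h - (2 * dot h e) *: e) &
    pucci sgn lam Lam B = pucci sgn lam Lam A].
Proof.
move=> As ee.
pose P : 'M[R]_N := 1%:M - 2 *: (e^T *m e).
have Ps : P^T = P by rewrite linearB/= trmx1 linearZ/= trmx_mul trmxK.
have hE h : h *m e^T = (dot h e)%:M.
  by apply/matrixP => i j; rewrite !ord1 !mxE eqxx mulr1n; apply: eq_bigr => k _; rewrite mxE.
have hP h : h *m P = h - (2 * dot h e) *: e.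
  by rewrite mulmxBr mulmx1 -scalemxAr mulmxA hE mul_scalar_mx scalerA.
have PP : P *m P = 1%:M.
  have Q : (e^T *m e) *m (e^T *m e) = e^T *m e.
    by rewrite mulmxA -(mulmxA e^T) hE ee mulmx1.
  rewrite /P mulmxBl mul1mx mulmxBr mulmx1 -scalemxAl -scalemxAr Q scalerA.
  rewrite -addrA -opprB opprB -[RHS]addr0; congr (_ + _).
  rewrite -scaleNr -!scalerBl (_ : - 2 - (2 - 2 * 2) = 0 :> R) ?scale0r//.
  ring.
have Pu : P \in unitmx by have [] := mulmx1_unit PP.
have Pinv : invmx P = P by rewrite -[LHS]mulmx1 -PP mulKmx.
exists (P *m A *m P); split.
- by rewrite !trmx_mul Ps As mulmxA.
- by move=> h; rewrite !qform_mx -hP trmx_mul Ps !mulmxA.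
- by apply: pucci_eq_char_poly; rewrite -{1}Pinv char_poly_conj.
Qed.

(** The second derivative of the reflected function along [h] is that of [u] at the reflected point
    along the reflected direction, which is [qform B h] for the [B] of [refl_matrix]. *)
Lemma refl_supersolution (lam Lam : R) sgn (D : set V) (u : V -> R) e mu x :
  0 < lam -> lam <= Lam -> open D -> C2_on D u -> dot e e = 1 ->
  D x -> D (refl e mu x) ->
  supersolution_at lam Lam (fun y => u (refl e mu y) - u y) x
   (pucci sgn lam Lam (hessian u (refl e mu x)) - pucci sgn lam Lam (hessian u x)).
Proof.
move=> lam0 lamLam oD C2u ee Dx Drx.
have [B [Bs Bq BE]] := refl_matrix lam Lam sgn (hessian_sym oD C2u Drx) ee.
have := @supersolution_sub _ _ _ _ lam0 lamLam sgn _ _ u (fun y => u (refl e mu y)) x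
  (hessian_sym oD C2u Dx) Bs (fun h => C2_second_derive oD C2u h Dx).
rewrite BE; apply => h; rewrite Bq.
have -> : (fun t : R => u (refl e mu (x + t *: h))) =
    (fun t => u (refl e mu x + t *: (h - (2 * dot h e) *: e))).
  by apply/funext => t; rewrite refl_line.
exact: (C2_second_derive oD C2u _ Drx).
Qed.

End Reflections.

(** * Dirichlet solutions compared with their reflections *)

Section MovingPlanes.
Variables (R : realType) (N : nat) (sgn : pucci_sign) (lam Lam r : R).
Hypotheses (lam0 : 0 < lam) (lamLam : lam <= Lam) (r0 : 0 < r).
Local Notation V := 'rV[R]_N.
Implicit Types (x y h e : V) (mu p q : R) (u v : V -> R).
Let super := @supersolution_at R N lam Lam.
Let B := @eball R N r.
Let Bc := [set x : V | dot x x <= r ^+ 2].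
Let rr : 0 < r ^+ 2. Proof. by rewrite exprn_gt0. Qed.

Lemma eballE x : B x <-> dot x x < r ^+ 2.
Proof. by rewrite /B /eball/= enorm_lt// ltW. Qed.

Lemma ecballE : @ecball R N r = Bc.
Proof. by apply/seteqP; split => x; rewrite /ecball/Bc/= enorm_le// ltW. Qed.

Lemma dirichlet_sym p q u v : dirichlet_solution sgn lam Lam p q r u v ->
  dirichlet_solution sgn lam Lam q p r v u.
Proof.
move=> [[C2u [C2v eqs]] [cu [cv zero]]]; split; last first.
  by split; [|split] => // x /zero[].
split; [|split] => // x /eqs[? [? [? ?]]].
by split; [|split; [|split]].
Qed.

Lemma dirichlet_within p q u v : dirichlet_solution sgn lam Lam p q r u v ->
  {within Bc, continuous u}.
Proof. by move=> [_ [cu _]]; rewrite -ecballE. Qed.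

Lemma dirichlet_pos p q u v x : dirichlet_solution sgn lam Lam p q r u v ->
  dot x x < r ^+ 2 -> 0 < u x.
Proof. by move=> [[_ [_ eqs]] _] /eballE /eqs[]. Qed.

Lemma dirichlet_zero p q u v x : dirichlet_solution sgn lam Lam p q r u v ->
  dot x x = r ^+ 2 -> u x = 0.
Proof.
move=> [_ [_ [_ zero]]] xr; suff /zero[] : @esphere R N r x by [].
by rewrite /esphere/= enormE xr sqrtr_sqr gtr0_norm.
Qed.

Lemma dirichlet_ge0 p q u v x : dirichlet_solution sgn lam Lam p q r u v ->
  dot x x <= r ^+ 2 -> 0 <= u x.
Proof.
move=> sol; rewrite le_eqVlt => /predU1P[xr|xr].
  by rewrite (dirichlet_zero sol).
by rewrite ltW// (dirichlet_pos sol).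
Qed.

Lemma dirichlet_pucci p q u v x : dirichlet_solution sgn lam Lam p q r u v ->
  dot x x < r ^+ 2 -> pucci sgn lam Lam (hessian u x) = - v x `^ p.
Proof.
move=> [[_ [_ eqs]] _] /eballE /eqs[_ [_ [/eqP + _]]].
by rewrite addr_eq0 => /eqP.
Qed.

Lemma dirichlet_lower_bound p q u v : dirichlet_solution sgn lam Lam p q r u v ->
  exists2 c, 0 < c & forall x, dot x x <= r ^+ 2 -> c * (r ^+ 2 - dot x x) <= u x.
Proof.
move=> sol; apply: (hopf_bound lam0 lamLam r0).
- exact: dirichlet_within sol.
- by move=> x; exact: dirichlet_ge0 sol.
- by move=> x; exact: dirichlet_pos sol.
move=> x xr; have [[C2u _] _] := sol.
have := supersolution_C2 lam0 lamLam sgn (@open_eball R N r) C2u ((eballE x).2 xr).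
rewrite (dirichlet_pucci sol xr); apply: supersolution_le.
by rewrite oppr_le0 powR_ge0.
Qed.

(** The difference of powers is at most [(1 + p) v ^ (p - 1) (v - w)]. Splitting [v ^ (p - 1)] as
    [v ^ (p - th) * v ^ (th - 1)], the first factor is bounded because [v] is, the second by the
    Hopf bound [v >= c (r ^ 2 - |x|^2)] since [th <= 1]. *)
Lemma dirichlet_potential p q u v (th : R) :
  dirichlet_solution sgn lam Lam p q r u v -> 0 < p -> th <= p -> th <= 1 ->
  exists2 C, 0 < C & forall x w m, dot x x < r ^+ 2 -> 0 <= w -> 0 <= m ->
    v x - w <= m -> v x `^ p - w `^ p <= C * (r ^+ 2 - dot x x) `^ (th - 1) * m.
Proof.
move=> sol p0 thp th1; have sol' := dirichlet_sym sol.
have [c c0 Hc] := dirichlet_lower_bound sol'.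
have [Vm Vm0 HV] : exists2 Vm, 0 < Vm & forall x, dot x x <= r ^+ 2 -> v x <= Vm.
  have [x1 x1B max1] : exists2 c, c \in Bc & forall t, t \in Bc -> v t <= v c.
    apply: EVT_max_rV; last exact: dirichlet_within sol'.
      by exists 0; rewrite /Bc/= dot0r ltW.
    apply: (@compact_sqdist_le _ _ 0 (r ^+ 2)); last by move=> x; rewrite /Bc/= subr0.
    apply: closed_le_continuous; last exact: cst_continuous.
    have := @continuous_sqdist R N 0; rewrite (_ : (fun x => _) = (fun x => dot x x))//.
    by apply/funext => x; rewrite subr0.
  rewrite inE in x1B; exists (v x1 + 1).
    by have := dirichlet_ge0 sol' x1B; lra.
  move=> x xB; have : v x <= v x1 by apply: max1; rewrite inE.
  by lra.
pose D := (1 + p) * (Vm `^ (p - th) * c `^ (th - 1)).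
have D0 : 0 < D by rewrite mulr_gt0 ?addr_gt0// mulr_gt0 ?powR_gt0.
exists D => // x w m xr w0 m0 vwm.
have s0 : 0 < r ^+ 2 - dot x x by rewrite subr_gt0.
have rhs0 : 0 <= D * (r ^+ 2 - dot x x) `^ (th - 1) * m.
  by rewrite mulr_ge0// mulr_ge0 ?powR_ge0// ltW.
have v0 : 0 < v x by exact: dirichlet_pos sol' xr.
have [vw|/ltW wv] := leP (v x) w.
  apply: le_trans rhs0; rewrite subr_le0 ge0_ler_powR ?nnegrE//; exact: ltW.
apply: (le_trans (powR_sub_le p0 v0 w0 wv)).
have h1 : 0 <= (1 + p) * v x `^ (p - 1) by rewrite mulr_ge0 ?powR_ge0// addr_ge0// ltW.
have h2 : 0 <= v x - w by rewrite subr_ge0.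
apply: (ler_pM h1 h2 _ vwm).
rewrite /D -!mulrA ler_pM2l ?addr_gt0//.
have -> : v x `^ (p - 1) = v x `^ (p - th) * v x `^ (th - 1).
  rewrite -powRD; last by rewrite (gt_eqF v0) implybT.
  by congr (_ `^ _); ring.
apply: ler_pM; rewrite ?powR_ge0//.
  apply: ge0_ler_powR; rewrite ?nnegrE ?subr_ge0 ?(ltW v0) ?(ltW Vm0)//.
  by apply: HV; exact: ltW.
rewrite -powRM ?(ltW c0) ?(ltW s0)//.
have -> : th - 1 = - (1 - th) by rewrite opprB.
have cs0 : 0 < c * (r ^+ 2 - dot x x) by exact: mulr_gt0.
rewrite (powRN (v x)) (powRN (c * _)) lef_pV2 ?posrE ?powR_gt0//.
apply: ge0_ler_powR; rewrite ?nnegrE ?subr_ge0 ?(ltW cs0) ?(ltW v0)//.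
by apply: Hc; exact: ltW.
Qed.

Lemma refl_in_ball e mu x : dot e e = 1 -> 0 <= mu -> mu <= dot x e ->
  dot (refl e mu x) (refl e mu x) <= dot x x.
Proof.
by move=> ee mu0 xe; rewrite dot_refl// lerBlDr lerDl mulr_ge0 ?subr_ge0// mulr_ge0.
Qed.

Lemma dirichlet_refl_super p q u v e mu x :
  dirichlet_solution sgn lam Lam p q r u v -> dot e e = 1 -> 0 <= mu ->
  mu <= dot x e -> dot x x < r ^+ 2 ->
  super (fun y => u (refl e mu y) - u y) x (v x `^ p - v (refl e mu x) `^ p).
Proof.
move=> sol ee mu0 xe xr; have [[C2u _] _] := sol.
have rxr : dot (refl e mu x) (refl e mu x) < r ^+ 2.
  exact: le_lt_trans (refl_in_ball ee mu0 xe) xr.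
have H := refl_supersolution sgn lam0 lamLam (@open_eball R N r) C2u ee
  ((eballE x).2 xr) ((eballE (refl e mu x)).2 rxr).
apply: supersolution_le H.
have key (y1 y2 z1 z2 : R) : y1 = - z1 -> y2 = - z2 -> y1 - y2 <= z2 - z1.
  by move=> -> ->; rewrite opprK addrC.
exact: key (dirichlet_pucci sol rxr) (dirichlet_pucci sol xr).
Qed.

Section Pair.
Variables (p q : R) (u v : V -> R).
Hypotheses (p0 : 0 < p) (q0 : 0 < q).
Hypothesis sol : dirichlet_solution sgn lam Lam p q r u v.
Let sol' := dirichlet_sym sol.

Let d u e mu x := u (refl e mu x) - u x.

Definition plane_ordered e mu := forall x, dot x x <= r ^+ 2 -> mu <= dot x e ->
  0 <= d u e mu x /\ 0 <= d v e mu x.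

Let cap e mu := Bc `&` [set x | mu <= dot x e].

Let continuous_cap w e mu : dot e e = 1 -> 0 <= mu -> {within Bc, continuous w} ->
  {within cap e mu, continuous (d w e mu)}.
Proof.
move=> ee mu0 cw.
have c1 : {within cap e mu, continuous (fun x => w (refl e mu x))}.
  apply: within_continuous_comp cw; first exact: refl_continuous.
  by move=> x [xr xe]; apply: le_trans xr; exact: refl_in_ball.
have c2 : {within cap e mu, continuous w} by apply: within_continuousS cw => x [].
by move=> x; exact: continuousB (c1 x) (c2 x).
Qed.

(** The constants [a] and [s0] depend neither on the direction nor on the plane. What remains to be
    checked is a compact part of the cap, away from the sphere and from the plane, and its size is
    uniform as the plane moves. *)
Lemma narrow_ordered : exists a s0 : R, [/\ 0 < a, 0 < s0 &
  forall e mu, dot e e = 1 -> 0 <= mu ->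
  (forall x, dot x x <= r ^+ 2 -> s0 <= r ^+ 2 - dot x x -> mu + a^-1 <= dot x e ->
    0 <= d u e mu x /\ 0 <= d v e mu x) -> plane_ordered e mu].
Proof.
(* [th <= p] and [th <= q] serve [dirichlet_potential] for the two equations; [th <= 1] is required
   there and by the barrier. *)
pose th := Num.min 1 (Num.min p q).
have th0 : 0 < th by rewrite !lt_min ltr01 p0.
have th1 : th <= 1 by rewrite ge_min lexx.
have thp : th <= p by rewrite /th !ge_min lexx !orbT.
have thq : th <= q by rewrite /th !ge_min lexx !orbT.
have [C1 C10 H1] := dirichlet_potential sol p0 thp th1.
have [C2 C20 H2] := dirichlet_potential sol' q0 thq th1.
have [a [s0 [a0 s00 H]]] := @narrow_max_principle R N lam Lam lam0 r _ th r0 (addr_gt0 C10 C20) th0 th1.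
exists a, s0; split => // e mu ee mu0 reg x xr xe.
have K : cap e mu x by [].
apply: (H e mu (d u e mu) (d v e mu) ee _ _ _ _ _ _ x K).
- exact: continuous_cap (dirichlet_within sol).
- exact: continuous_cap (dirichlet_within sol').
- move=> y [yr ye] [yr'|ye']; last by rewrite /d refl_hyperplane// !subrr.
  rewrite /d (dirichlet_zero sol yr') (dirichlet_zero sol' yr') !subr0.
  have yB := le_trans (refl_in_ball ee mu0 ye) yr.
  by split; [exact: dirichlet_ge0 sol yB|exact: dirichlet_ge0 sol' yB].
- move=> y m yr ye m0 mW.
  apply: supersolution_le (dirichlet_refl_super sol ee mu0 (ltW ye) yr).
  have yB := le_trans (refl_in_ball ee mu0 (ltW ye)) (ltW yr).
  apply: le_trans (H1 y _ m yr (dirichlet_ge0 sol' yB) m0 _) _.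
    by move: mW; rewrite /d lerNl opprB.
  by rewrite ler_wpM2r// ler_wpM2r ?powR_ge0// lerDl ltW.
- move=> y m yr ye m0 mW.
  apply: supersolution_le (dirichlet_refl_super sol' ee mu0 (ltW ye) yr).
  have yB := le_trans (refl_in_ball ee mu0 (ltW ye)) (ltW yr).
  apply: le_trans (H2 y _ m yr (dirichlet_ge0 sol yB) m0 _) _.
    by move: mW; rewrite /d lerNl opprB.
  by rewrite ler_wpM2r// ler_wpM2r ?powR_ge0// lerDr ltW.
by move=> y [yr _]; exact: reg.
Qed.

(** For [mu] close to [r] the part left over by [narrow_ordered] is empty: its points would satisfy
    both [mu <= x.e <= |x|] and [|x|^2 <= r ^ 2 - s0]. *)
Lemma ordered_near_boundary e : dot e e = 1 ->
  exists2 mu0, mu0 < r & forall mu, 0 <= mu -> mu0 < mu -> plane_ordered e mu.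
Proof.
move=> ee; have [a [s0 [a0 s00 H]]] := narrow_ordered.
pose m := Num.max 0 (r ^+ 2 - s0).
have m0 : 0 <= m by rewrite le_max lexx.
exists (Num.sqrt m).
  rewrite -(@ltr_pXn2r _ 2)// ?nnegrE ?sqrtr_ge0 ?(ltW r0)// sqr_sqrtr//.
  by rewrite gt_max rr ltrBlDr ltrDl.
move=> mu mu0 ltmu; apply: H => // x xr xs xe; exfalso.
have ltm : m < mu ^+ 2.
  by rewrite -(sqr_sqrtr m0) ltr_pXn2r ?nnegrE ?sqrtr_ge0.
have xm : dot x x <= m by rewrite le_max; apply/orP; right; lra.
have : mu <= enorm x.
  apply: le_trans (dot_le_enorm x ee); apply: le_trans xe.
  by rewrite lerDl invr_ge0 ltW.
rewrite -(@ler_pXn2r _ 2)// ?nnegrE ?enorm_ge0// enorm_sqr => h.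
by have := lt_le_trans ltm (le_trans h xm); rewrite ltxx.
Qed.

End Pair.
End MovingPlanes.

(** * The continuity method for the planes, and radial symmetry *)

Section RadialSymmetry.
Variables (R : realType) (N : nat) (sgn : pucci_sign) (lam Lam r : R).
Hypotheses (lam0 : 0 < lam) (lamLam : lam <= Lam) (r0 : 0 < r).
Local Notation V := 'rV[R]_N.
Implicit Types (x y h e : V) (mu : R) (u v : V -> R).
Variables (p q : R) (u v : V -> R).
Hypotheses (p0 : 0 < p) (q0 : 0 < q).
Hypothesis sol : dirichlet_solution sgn lam Lam p q r u v.
Let sol' := dirichlet_sym sol.

Let ordered := plane_ordered r u v.
Let d (w : V -> R) e mu x := w (refl e mu x) - w x.
Let cap e mu := [set x : V | dot x x < r ^+ 2] `&` [set x | mu < dot x e].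

Let continuous_sqnorm : continuous (fun x : V => dot x x).
Proof.
have := @continuous_sqdist R N 0; rewrite (_ : (fun x => _) = (fun x => dot x x))//.
by apply/funext => x; rewrite subr0.
Qed.

Let open_cap e mu : open (cap e mu).
Proof.
apply: openI; apply: open_lt_continuous; try exact: cst_continuous.
  exact: continuous_sqnorm.
exact: continuous_dotl.
Qed.

Let convex_cap e mu x y (t : R) : cap e mu x -> cap e mu y -> 0 <= t <= 1 ->
  cap e mu (x + t *: (y - x)).
Proof.
move=> [/= xr xe] [/= yr ye] /andP[t0 t1].
have comb (a1 a2 c : R) : a1 < c -> a2 < c -> (1 - t) * a1 + t * a2 < c.
  move=> a1c a2c; have [->|tN0] := eqVneq t 0.
    by rewrite subr0 mul1r mul0r addr0.
  have tp : 0 < t by rewrite lt_neqAle eq_sym tN0.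
  have -> : c = (1 - t) * c + t * c by ring.
  by apply: ler_ltD; rewrite ?ltr_pM2l// ler_wpM2l ?subr_ge0// ltW.
split => /=; last first.
  rewrite -ltrN2 dotDl dotZl dotBl.
  have -> : - (dot x e + t * (dot y e - dot x e)) =
    (1 - t) * - dot x e + t * - dot y e by ring.
  by apply: comb; rewrite ltrN2.
have : 0 <= dot x x - 2 * dot x y + dot y y.
  have := dot_ge0 (y - x); rewrite !dotBl !dotBr (dotC y x); lra.
have -> : dot (x + t *: (y - x)) (x + t *: (y - x)) =
    (1 - t) * dot x x + t * dot y y - t * (1 - t) * (dot x x - 2 * dot x y + dot y y).
  by rewrite dotDl !dotDr !dotZl !dotZr !dotBl !dotBr !(dotC y x); ring.
move=> h; apply: (@le_lt_trans _ _ ((1 - t) * dot x x + t * dot y y)).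
  by rewrite lerBlDr lerDl mulr_ge0// mulr_ge0// subr_ge0.
exact: comb.
Qed.

Let interior_continuous (w : V -> R) x :
  {within [set x : V | dot x x <= r ^+ 2], continuous w} -> dot x x < r ^+ 2 ->
  {for x, continuous w}.
Proof.
move=> cw xr; have o : open [set x : V | dot x x < r ^+ 2].
  by apply: open_lt_continuous; [exact: continuous_sqnorm|exact: cst_continuous].
apply: (within_continuous_for o xr); apply: within_continuousS cw => y /=; exact: ltW.
Qed.

Let continuous2 (w : V -> R) e mu x :
  {within [set x : V | dot x x <= r ^+ 2], continuous w} ->
  dot e e = 1 -> 0 <= mu -> mu <= dot x e -> dot x x < r ^+ 2 ->
  {for (x, mu), continuous (fun z : V * R => d w e z.2 z.1)}.
Proof.
move=> cw ee mu0 xe xr.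
have rxr := le_lt_trans (refl_in_ball ee mu0 xe) xr.
have c1 : {for (x, mu), continuous (fun z : V * R => w (refl e z.2 z.1))}.
  apply: (@continuous_comp _ _ _ (fun z : V * R => refl e z.2 z.1) w).
    exact: refl_continuous2.
  exact: interior_continuous.
have c2 : {for (x, mu), continuous (fun z : V * R => w z.1)}.
  apply: (@continuous_comp _ _ _ (fun z : V * R => z.1) w); first exact: cvg_fst.
  exact: interior_continuous.
exact: (cvgB c1 c2).
Qed.

Let continuous1 (w : V -> R) e mu x :
  {within [set x : V | dot x x <= r ^+ 2], continuous w} ->
  dot e e = 1 -> 0 <= mu -> mu <= dot x e -> dot x x < r ^+ 2 ->
  {for x, continuous (d w e mu)}.
Proof.
move=> cw ee mu0 xe xr.
have rxr := le_lt_trans (refl_in_ball ee mu0 xe) xr.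
have c1 : {for x, continuous (fun z => w (refl e mu z))}.
  apply: (@continuous_comp _ _ _ (refl e mu) w); first exact: refl_continuous.
  exact: interior_continuous.
have c2 : {for x, continuous w} by exact: interior_continuous.
exact: (cvgB c1 c2).
Qed.

(** The order of the other component makes the right-hand side nonpositive, so by the strong maximum
    principle in the convex cap one point with positive difference suffices. At the boundary point
    [r e] the solution vanishes while the reflected point is inside the ball; continuity gives such
    a point in the cap. *)
Let strict_aux p1 q1 (w z : V -> R) e mu : 0 < p1 ->
  dirichlet_solution sgn lam Lam p1 q1 r w z -> dot e e = 1 ->
  0 < mu -> mu < r ->
  (forall x, dot x x <= r ^+ 2 -> mu <= dot x e -> 0 <= d w e mu x /\ 0 <= d z e mu x) ->
  forall x, cap e mu x -> 0 < d w e mu x.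
Proof.
move=> p10 solw ee mu0 mur ord x capx.
have cw := dirichlet_within r0 solw.
suff [y capy dy] : exists2 y, cap e mu y & 0 < d w e mu y.
  apply: (strong_positivity lam0 lamLam (@open_cap e mu) _ _ _ _ capy capx dy).
  - by move=> *; exact: convex_cap.
  - by move=> y' [yr ye]; apply: continuous1 => //; exact: ltW.
  - by move=> y' [yr ye]; have [] := ord y' (ltW yr) (ltW ye).
  - move=> y' [yr ye]; have /= := dirichlet_refl_super lam0 lamLam r0 solw ee (ltW mu0) (ltW ye) yr.
    apply: supersolution_le; rewrite subr_le0.
    have [_] := ord y' (ltW yr) (ltW ye); rewrite subr_ge0 => zz.
    have yB := le_trans (refl_in_ball ee (ltW mu0) (ltW ye)) (ltW yr).
    have solz := dirichlet_sym solw.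
    have z1 := dirichlet_ge0 r0 solz (ltW yr).
    have z2 := dirichlet_ge0 r0 solz yB.
    by apply: ge0_ler_powR => //; exact: ltW.
pose z0 : V := r *: e.
have z0r : dot z0 z0 = r ^+ 2 by rewrite dotZl dotZr ee mulr1 expr2.
have z0e : dot z0 e = r by rewrite dotZl ee mulr1.
have dz0 : 0 < d w e mu z0.
  rewrite /d (dirichlet_zero r0 solw z0r) subr0.
  apply: (dirichlet_pos r0 solw); rewrite dot_refl// z0r z0e ltrBlDr ltrDl.
  by rewrite mulr_gt0 ?subr_gt0// mulr_gt0.
have cK : {within [set x : V | dot x x <= r ^+ 2] `&` [set x | mu <= dot x e],
    continuous (d w e mu)}.
  have c1 : {within [set x : V | dot x x <= r ^+ 2] `&` [set x | mu <= dot x e],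
      continuous (fun x => w (refl e mu x))}.
    apply: within_continuous_comp cw; first exact: refl_continuous.
    move=> y [yr ye]; apply: le_trans yr; apply: refl_in_ball => //; exact: ltW.
  have c2 : {within [set x : V | dot x x <= r ^+ 2] `&` [set x | mu <= dot x e],
      continuous w} by apply: within_continuousS cw => y [].
  by move=> y; exact: continuousB (c1 y) (c2 y).
have z0K : ([set x : V | dot x x <= r ^+ 2] `&` [set x | mu <= dot x e]) z0.
  by split; rewrite /= ?z0r// z0e ltW.
have := (within_continuousP _ _).1 cK z0 z0K _ (lt_nbhsr dz0).
move=> /nbhs_ballP[eps /= eps0 Heps].
have ne : 0 < `|e| + 1 by rewrite ltr_wpDl.
pose eta := Num.min (eps / (`|e| + 1)) (Num.min (r - mu) r) / 2.
have m0 : 0 < Num.min (eps / (`|e| + 1)) (Num.min (r - mu) r).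
  by rewrite !lt_min divr_gt0// subr_gt0 mur.
have eta0 : 0 < eta by rewrite divr_gt0.
have : eta < Num.min (eps / (`|e| + 1)) (Num.min (r - mu) r) by rewrite /eta; lra.
rewrite !lt_min => /and3P[eta1 eta2 eta3].
have ye : dot ((r - eta) *: e) e = r - eta by rewrite dotZl ee mulr1.
have yr : dot ((r - eta) *: e) ((r - eta) *: e) < r ^+ 2.
  rewrite dotZr ye -expr2 ltr_pXn2r ?nnegrE ?subr_ge0 ?(ltW eta3) ?(ltW r0)//.
  by rewrite ltrBlDr ltrDl.
have mue : mu < r - eta by rewrite ltrBrDr -ltrBrDl.
exists ((r - eta) *: e); first by split; rewrite //= ye.
apply: Heps; last by split; rewrite /= ?ye ltW.
rewrite -ball_normE/= -scalerBl opprB addrC subrK normrZ gtr0_norm//.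
apply: (@le_lt_trans _ _ (eta * (`|e| + 1))); last by rewrite -ltr_pdivlMr.
by rewrite ler_pM2l// lerDl.
Qed.

Lemma ordered_strict e mu : dot e e = 1 -> 0 < mu -> mu < r -> ordered e mu ->
  forall x, cap e mu x -> 0 < d u e mu x /\ 0 < d v e mu x.
Proof.
move=> ee mu0 mur ord x cx; split; first exact: (strict_aux p0 sol).
by apply: (strict_aux q0 sol') => // y yr ye; have [] := ord y yr ye.
Qed.

(** Since [narrow_ordered] serves all planes, only a compact set [K] has to be checked for [mu']. On
    [K] the order at [mu] is strict, and compactness preserves it for nearby planes. *)
Lemma ordered_open e mu : dot e e = 1 -> 0 < mu -> mu < r -> ordered e mu ->
  exists2 eps, 0 < eps & forall mu', mu - eps < mu' -> mu' <= mu -> ordered e mu'.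
Proof.
move=> ee mu0 mur ord.
have [a [s0 [a0 s00 H]]] := narrow_ordered lam0 lamLam r0 p0 q0 sol.
have ia0 : 0 < a^-1 by rewrite invr_gt0.
(* Half of the strip width is kept as a margin: the leftover part for [mu'] lies in [K] as long as
   [mu - mu' < a^-1 / 2]. *)
pose K := [set x : V | dot x x <= r ^+ 2 - s0] `&` [set x | mu + a^-1 / 2 <= dot x e].
have Kcap x : K x -> cap e mu x.
  by move=> [/= h1 h2]; split => /=; lra.
have cK : compact K.
  apply: (@compact_sqdist_le _ _ 0 (r ^+ 2 - s0)); last by move=> x [/= h _]; rewrite subr0.
  apply: closedI; apply: closed_le_continuous; try exact: cst_continuous.
    exact: continuous_sqnorm.
  exact: continuous_dotl.
have cu := dirichlet_within r0 sol; have cv := dirichlet_within r0 sol'.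
have near_mu : \forall m \near mu, K `<=` [set x | 0 < d u e m x /\ 0 < d v e m x].
  have nc := (compact_near_coveringP K).1 cK.
  apply: (nc _ (nbhs mu) (fun m x => 0 < d u e m x /\ 0 < d v e m x)) => x /Kcap cx; have [/= xr xe] := cx.
  have [du dv] := ordered_strict ee mu0 mur ord cx.
  have Cu := continuous2 cu ee (ltW mu0) (ltW xe) xr.
  have Cv := continuous2 cv ee (ltW mu0) (ltW xe) xr.
  have nu : \forall z \near (x, mu), 0 < d u e z.2 z.1 := Cu _ (lt_nbhsr du).
  have nv : \forall z \near (x, mu), 0 < d v e z.2 z.1 := Cv _ (lt_nbhsr dv).
  have nuv : \forall z \near (x, mu), 0 < d u e z.2 z.1 /\ 0 < d v e z.2 z.1.
    by apply: filterS2 nu nv.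
  exact: nuv.
have [eps /= eps0 Heps] := (nbhs_ballP _ _).1 near_mu.
pose eps' := Num.min eps (Num.min (a^-1 / 2) mu).
have e'0 : 0 < eps' by rewrite !lt_min eps0 mu0 divr_gt0.
exists eps' => // mu' lo hi.
have : mu - mu' < eps' by lra.
rewrite !lt_min => /and3P[l1 l2 l3].
have mu'0 : 0 <= mu' by lra.
apply: H => // x xr xs xe.
have Kx : K x by split => /=; lra.
have bm : ball mu eps mu' by rewrite /ball/= ger0_norm ?subr_ge0.
by have [? ?] := Heps mu' bm x Kx; split; exact: ltW.
Qed.

(** Points of the plane itself are fixed by the reflection. A point strictly beyond it stays beyond
    the planes [mu'] slightly above [mu], and its reflections depend continuously on [mu']. *)
Lemma ordered_closed e mu mu1 : dot e e = 1 -> 0 <= mu -> mu < mu1 ->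
  (forall mu', mu < mu' -> mu' < mu1 -> ordered e mu') -> ordered e mu.
Proof.
move=> ee mu0 mu01 ord.
suff aux (w : V -> R) : {within [set x : V | dot x x <= r ^+ 2], continuous w} ->
    (forall mu', mu < mu' -> mu' < mu1 -> forall x, dot x x <= r ^+ 2 ->
       mu' <= dot x e -> 0 <= d w e mu' x) ->
    forall x, dot x x <= r ^+ 2 -> mu <= dot x e -> 0 <= d w e mu x.
  move=> x xr xe; split.
    apply: (aux u (dirichlet_within r0 sol)) => // mu' h1 h2 y yr ye.
    by have [] := ord mu' h1 h2 y yr ye.
  apply: (aux v (dirichlet_within r0 sol')) => // mu' h1 h2 y yr ye.
  by have [] := ord mu' h1 h2 y yr ye.
move=> cw pos x xr; rewrite le_eqVlt => /predU1P[xe|xe].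
  by rewrite /d refl_hyperplane// subrr.
rewrite leNgt; apply/negP => neg.
have rxr := le_trans (refl_in_ball ee mu0 (ltW xe)) xr.
have wlt : w (refl e mu x) < w x by rewrite -subr_lt0.
have n1 := (within_continuousP _ _).1 cw _ rxr _ (lt_nbhsl wlt).
have cr : (fun m => refl e m x) @ mu --> refl e mu x.
  rewrite /refl; apply: cvgD; first exact: cvg_cst.
  apply: cvgZr_tmp; apply: cvgM; first exact: cvg_cst.
  by apply: cvgB; [exact: cvg_id|exact: cvg_cst].
have n2 : \forall m \near mu, dot (refl e m x) (refl e m x) <= r ^+ 2 -> w (refl e m x) < w x.
  exact: cr _ n1.
have [eps /= eps0 Heps] := (nbhs_ballP _ _).1 n2.
pose m0 := Num.min eps (Num.min (mu1 - mu) (dot x e - mu)).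
have m00 : 0 < m0 by rewrite !lt_min eps0 !subr_gt0 mu01.
have : m0 / 2 < m0 by lra.
rewrite !lt_min => /and3P[l1 l2 l3].
have lt0 : 0 < m0 / 2 by rewrite divr_gt0.
pose mu' := mu + m0 / 2.
have mu'x : mu' <= dot x e by rewrite /mu' -lerBrDl ltW.
have bm : ball mu eps mu'.
  by rewrite /ball/= /mu' opprD addrA subrr add0r normrN gtr0_norm.
have mu'0 : 0 <= mu' by rewrite addr_ge0// ltW.
have := Heps mu' bm (le_trans (refl_in_ball ee mu'0 mu'x) xr).
rewrite ltNge => /negP; apply; rewrite -subr_ge0.
by apply: pos; rewrite // /mu' ?ltrDl// -ltrBrDl.
Qed.

(** The supremum of the planes where the order fails is below [r] by [ordered_near_boundary]; the
    order holds there by closedness, hence slightly below by openness, contrary to the choice of the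
    supremum. *)
Lemma ordered_all e mu : dot e e = 1 -> 0 < mu -> mu < r -> ordered e mu.
Proof.
move=> ee mu0 mur; apply: contrapT => nord.
have [b br Hb] := ordered_near_boundary lam0 lamLam r0 p0 q0 sol ee.
pose A := [set m | 0 < m < r /\ ~ ordered e m].
have A0 : nonempty A by exists mu; split => //; rewrite mu0.
have ubA : ubound A b.
  move=> m [/andP[m0 mr] nm]; rewrite leNgt; apply/negP => bm.
  by apply: nm; exact: Hb (ltW m0) bm.
have hA : has_sup A by split => //; exists b.
pose s := sup A.
have mus : mu <= s by apply: ub_le_sup; [exists b|split; rewrite ?mu0].
have sb : s <= b by apply: ge_sup.
have s0 : 0 < s by exact: lt_le_trans mus.
have sr : s < r by exact: le_lt_trans br.
have ords : ordered e s.
  apply: (ordered_closed ee (ltW s0) sr) => m sm mr; apply: contrapT => nm.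
  have : m <= s by apply: ub_le_sup; [exists b|split; rewrite // mr (lt_trans s0)].
  by rewrite leNgt sm.
have [eps eps0 Heps] := ordered_open ee s0 sr ords.
have [m [/andP[m0 mr] nm] sm] := sup_adherent eps0 hA.
have ms : m <= s by apply: ub_le_sup; [exists b|split => //; rewrite m0].
exact: (nm (Heps m sm ms)).
Qed.

(** [ordered_open] asks for [0 < mu], so the central plane is reached as a limit. *)
Lemma ordered0 e : dot e e = 1 -> ordered e 0.
Proof.
by move=> ee; apply: (ordered_closed ee (lexx 0) r0) => m m0 mr; exact: ordered_all.
Qed.

(** The central plane for [e] and for [- e] is the same, and the two orders are opposite
    inequalities. *)
Lemma dirichlet_refl_invariant e x : dot e e = 1 -> dot x x <= r ^+ 2 ->
  u (refl e 0 x) = u x /\ v (refl e 0 x) = v x.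
Proof.
move=> ee; have nee : dot (- e) (- e) = 1 by rewrite dotNl dotNr opprK.
suff H y : dot y y <= r ^+ 2 -> 0 <= dot y e ->
    u (refl e 0 y) = u y /\ v (refl e 0 y) = v y.
  move=> xr; have [xe|/ltW xe] := leP 0 (dot x e); first exact: H.
  have xe' : 0 <= dot (refl e 0 x) e by rewrite dot_refl_normal// mulr0 sub0r oppr_ge0.
  have xr' : dot (refl e 0 x) (refl e 0 x) <= r ^+ 2 by rewrite dot_refl// mulr0 mul0r subr0.
  by have := H _ xr' xe'; rewrite refl0K// => -[-> ->].
move=> yr ye.
have [h1 h2] := ordered0 ee yr ye.
have yr' : dot (refl e 0 y) (refl e 0 y) <= r ^+ 2 by rewrite dot_refl// mulr0 mul0r subr0.
have ye' : 0 <= dot (refl e 0 y) (- e).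
  by rewrite dotNr dot_refl_normal// mulr0 sub0r opprK.
have := ordered0 nee yr' ye'; rewrite refl0_opp refl0K// !subr_ge0 => -[h3 h4].
by move: h1 h2; rewrite !subr_ge0 => h1 h2; split; apply: le_anti; apply/andP.
Qed.

(** Two points of equal norm are exchanged by the reflection through the origin in the direction of
    [x - y]. *)
Theorem dirichlet_radial x y : dot x x <= r ^+ 2 -> dot x x = dot y y ->
  u x = u y /\ v x = v y.
Proof.
move=> xr xy; have [->//|neq] := eqVneq x y.
have z0 : 0 < dot (x - y) (x - y).
  by rewrite lt_neqAle eq_sym dot_eq0 subr_eq0 neq dot_ge0.
pose n := enorm (x - y).
have nn : n ^+ 2 = dot (x - y) (x - y) by rewrite enorm_sqr.
have n0 : 0 < n by rewrite /n enormE sqrtr_gt0.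
pose e := n^-1 *: (x - y).
have ee : dot e e = 1.
  by rewrite dotZl dotZr -nn; field; rewrite gt_eqF.
have [E1 E2] := dirichlet_refl_invariant ee xr.
suff <- : refl e 0 x = y by rewrite E1 E2.
have xe : 2 * dot x e = n.
  rewrite /e dotZr mulrCA; apply: (mulfI (lt0r_neq0 n0)).
  rewrite mulVKf ?gt_eqF// -expr2 nn dotBl !dotBr -xy (dotC y x); ring.
rewrite /refl sub0r mulrN xe /e scalerA mulNr divff ?gt_eqF//.
by rewrite scaleN1r opprB addrC subrK.
Qed.

End RadialSymmetry.

(** * Radial profiles and rescaling *)

Section RadialProfile.
Variables (R : realType) (N : nat) (i0 : 'I_N).
Local Notation V := 'rV[R]_N.
Implicit Types (x y h : V) (r t : R).
Let e1 : V := delta_mx ord0 i0.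

Definition profile (u : V -> R) : R -> R := fun t => u (t *: e1).

Lemma dot_e1 r : dot (r *: e1) (r *: e1) = r ^+ 2.
Proof. by rewrite dotZl dotZr dot_delta mxE !eqxx mulr1 expr2. Qed.

Lemma qform_sym_inj (A B : 'M[R]_N) : A^T = A -> B^T = B ->
  (forall h, qform A h = qform B h) -> A = B.
Proof.
move=> As Bs AB.
have ent (C : 'M[R]_N) (i j : 'I_N) :
    (delta_mx ord0 i : V) *m C *m (delta_mx ord0 j : V)^T = (C i j)%:M.
  by rewrite trmx_delta -rowE -colE; apply/matrixP => k l; rewrite !ord1 !mxE eqxx.
have qe (C : 'M[R]_N) (i j : 'I_N) : qform C (delta_mx ord0 i + delta_mx ord0 j) =
    C i i + C j j + (C i j + C j i).
  rewrite qform_mx mulmxDl linearD/= mulmxDr !mulmxDl !ent !mxE eqxx !mulr1n; ring.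
have diag i : A i i = B i i.
  have := AB (delta_mx ord0 i + delta_mx ord0 i); rewrite !qe => h; lra.
apply/matrixP => i j; have := AB (delta_mx ord0 i + delta_mx ord0 j).
have hA : A j i = A i j by rewrite -[in LHS]As mxE.
have hB : B j i = B i j by rewrite -[in LHS]Bs mxE.
by rewrite !qe !diag hA hB => h; lra.
Qed.

(** The quadratic form forces [H] to be diagonal, with [a] once and [b] on the other [N - 1] axes.
    For a radial function with profile [f] these are [f''] and [f' / r]. *)
Lemma pucci_radial (lam Lam : R) sgn (H : 'M[R]_N) (a b : R) : H^T = H ->
  (forall h, qform H h = (a - b) * h ord0 i0 ^+ 2 + b * dot h h) ->
  pucci sgn lam Lam H = m_fun sgn lam Lam a + (N%:R - 1) * m_fun sgn lam Lam b.
Proof.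
move=> Hs Hq.
pose d (i : 'I_N) := if i == i0 then a else b.
have -> : H = diag_mx (\row_i d i).
  apply: qform_sym_inj => //; first by rewrite tr_diag_mx.
  move=> h; rewrite Hq /qform.
  have E (j : 'I_N) : \sum_k diag_mx (\row_i d i) j k * (h ord0 j * h ord0 k) =
      d j * (h ord0 j * h ord0 j).
    rewrite (bigD1 j)//= big1 ?addr0; first by rewrite !mxE eqxx mulr1n.
    by move=> k kj; rewrite !mxE eq_sym (negbTE kj) mulr0n mul0r.
  under [RHS]eq_bigr do rewrite E.
  rewrite (bigD1 i0)//= {1}/d eqxx /dot (bigD1 i0)//= mulrDr addrA.
  congr (_ + _); first by rewrite expr2; ring.
  by rewrite mulr_sumr; apply: eq_bigr => j ji; rewrite /d (negbTE ji).
rewrite (@pucci_char_poly _ _ _ _ _ _ d); last first.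
  rewrite char_poly_trig ?diag_mx_is_trig//; apply: eq_bigr => i _.
  by rewrite !mxE eqxx mulr1n.
rewrite (bigD1 i0)//= {1}/d eqxx; congr (_ + _).
rewrite (eq_bigr (fun=> m_fun sgn lam Lam b)); last by move=> i ii0; rewrite /d (negbTE ii0).
rewrite sumr_const cardC1 card_ord -[LHS]mulr_natl; congr (_ * _).
by rewrite -subn1 natrB//; case: (N) i0 => [[]//|].
Qed.

Variables (T : R) (u : V -> R).
Hypothesis T0 : 0 < T.
Hypothesis C2u : C2_on (@eball R N T) u.
Hypothesis rad : forall x y, dot x x < T ^+ 2 -> dot x x = dot y y -> u x = u y.
Let f := profile u.
Let f1 t := partial i0 u (t *: e1).
Let f2 t := hessian u (t *: e1) i0 i0.

Let inball t : - T < t < T -> @eball R N T (t *: e1).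
Proof.
move=> tT; rewrite /eball/= enorm_lt ?(ltW T0)// dot_e1 -[t ^+ 2]real_normK ?num_real//.
by rewrite ltr_pXn2r ?nnegrE ?(ltW T0)// ltr_norml.
Qed.

Lemma profile_is_derive t : - T < t < T -> is_derive t 1 f (f1 t).
Proof.
move=> tT; have [_ /(_ i0)[du _]] := C2u (inball tT).
have H : is_derive (0 + t *: e1) e1 u (f1 t) by rewrite add0r; exact/derivableP.
have := (line_is_deriveP _ _ _ _ _).1 H.
by rewrite (_ : (fun s => _) = f)//; apply/funext => s; rewrite add0r.
Qed.

Let near_itv t : - T < t < T -> \forall s \near t, - T < s < T.
Proof.
by move=> tT; have /near_in_itvoo : t \in `]-T, T[ by rewrite in_itv.
Qed.

Lemma profile_is_derive2 t : - T < t < T -> is_derive t 1 (derive1 f) (f2 t).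
Proof.
move=> tT; have [_ /(_ i0)[_ [_ /(_ i0)[du _]]]] := C2u (inball tT).
have H : is_derive (0 + t *: e1) e1 (partial i0 u) (f2 t).
  by rewrite add0r /f2 mxE; exact/derivableP.
have H1 : is_derive t 1 f1 (f2 t).
  have := (line_is_deriveP _ _ _ _ _).1 H.
  by rewrite (_ : (fun s => _) = f1)//; apply/funext => s; rewrite add0r.
apply: near_eq_is_derive H1; apply: filterS (near_itv tT) => s sT.
by rewrite derive1E; have [_ ->] := profile_is_derive sT.
Qed.

Lemma profile_derive1 t : - T < t < T -> derive1 f t = f1 t.
Proof. by move=> tT; rewrite derive1E; have [_ ->] := profile_is_derive tT. Qed.

Lemma profile_derive2 t : - T < t < T -> derive1 (derive1 f) t = f2 t.
Proof. by move=> tT; rewrite derive1E; have [_ ->] := profile_is_derive2 tT. Qed.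

Let zero_in : - T < 0 < T. Proof. by rewrite oppr_lt0 T0. Qed.

(** The profile is defined for negative [t] as well and is even by radial symmetry. *)
Lemma profile_derive0 : f1 0 = 0.
Proof.
have D0 := profile_is_derive zero_in.
have DN : is_derive (0 : R) 1 (fun t => - t) (- 1).
  exact: (is_derive1N (is_derive_id (0 : R) 1)).
have D0' : is_derive (- (0 : R)) 1 f (f1 0) by rewrite oppr0.
have D1 := @is_derive1_comp _ f (fun t => - t) 0 _ _ D0' DN.
have E : \forall t \near (0 : R), (f \o (fun t => - t)) t = f t.
  apply: filterS (near_itv zero_in) => t tT; rewrite /f /profile/=; apply: rad.
    have := inball tT; rewrite /eball/= enorm_lt ?(ltW T0)//.
    by rewrite !dot_e1 sqrrN.
  by rewrite !dot_e1 sqrrN.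
have [_ e1'] := near_eq_is_derive E D1; have [_ e2] := D0.
by move: e1'; rewrite e2; lra.
Qed.

Lemma profile_is_derive0 : is_derive (0 : R) 1 f 0.
Proof. by rewrite -[X in is_derive _ _ _ X]profile_derive0; exact: profile_is_derive zero_in. Qed.

Lemma profile_starts : starts 0 f (u 0).
Proof.
split.
  have : f r @[r --> 0^'+] --> f 0.
    by apply: cvg_at_right_filter; exact: is_derive_continuous (profile_is_derive zero_in).
  by rewrite {2}/f /profile scale0r.
have : derive1 f r @[r --> 0^'+] --> derive1 f 0.
  by apply: cvg_at_right_filter; exact: is_derive_continuous (profile_is_derive2 zero_in).
by rewrite (profile_derive1 zero_in) profile_derive0.
Qed.

(** Near the point, [u] is a function [F = f (sqrt z)] of [z = |x|^2], so the formula for radial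
    test functions gives the second derivative along [h]; it is unique, hence equal to the quadratic
    form of the Hessian. *)
Lemma profile_hessian r h : 0 < r < T ->
  qform (hessian u (r *: e1)) h =
  (f2 r - f1 r / r) * h ord0 i0 ^+ 2 + f1 r / r * dot h h.
Proof.
move=> /andP[r0 rT]; have rTT : - T < r < T by rewrite rT andbT (lt_trans _ r0)// oppr_lt0.
have rN0 : r != 0 by rewrite gt_eqF.
have sr : Num.sqrt (r ^+ 2) = r by rewrite sqrtr_sqr gtr0_norm.
have rr : 0 < r ^+ 2 by rewrite exprn_gt0.
have H1 := C2_second_derive (@open_eball R N T) C2u h (inball rTT).
apply: (second_derive0_unique H1).
pose F z := f (Num.sqrt z).
pose F1 z := f1 (Num.sqrt z) * (2 * Num.sqrt z)^-1.
have sqT z : 0 < z < T ^+ 2 -> - T < Num.sqrt z < T.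
  move=> /andP[z0 zT]; have sz : 0 <= Num.sqrt z by exact: sqrtr_ge0.
  rewrite (lt_le_trans _ sz) ?oppr_lt0//=.
  by rewrite -(@ltr_pXn2r _ 2)// ?nnegrE ?(ltW T0)// sqr_sqrtr// ltW.
have DF z : 0 < z < T ^+ 2 -> is_derive z 1 F (F1 z).
  move=> zT; have [z0 _] := andP zT.
  exact: (@is_derive1_comp _ f Num.sqrt z _ _ (profile_is_derive (sqT z zT)) (is_derive1_sqrt z0)).
have rrT : 0 < r ^+ 2 < T ^+ 2 by rewrite rr/= ltr_pXn2r ?nnegrE ?(ltW r0) ?(ltW T0).
have near_rr : \forall z \near r ^+ 2, 0 < z < T ^+ 2.
  by have /near_in_itvoo : r ^+ 2 \in `]0, T ^+ 2[ by rewrite in_itv.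
have D1 : is_derive (r ^+ 2) 1 F1
    (f2 r * (2 * r)^-1 * (2 * r)^-1 + f1 r * - (2 * (2 * r)^-1 / (2 * r) ^+ 2)).
  have Ds := is_derive1_sqrt rr; rewrite sr in Ds.
  have Df1 : is_derive (Num.sqrt (r ^+ 2)) 1 f1 (f2 r).
    rewrite sr; apply: near_eq_is_derive (profile_is_derive2 rTT).
    by apply: filterS (near_itv rTT) => s /profile_derive1.
  have A := @is_derive1_comp _ f1 Num.sqrt (r ^+ 2) _ _ Df1 Ds.
  have B2 := is_derive1Zl 2 Ds.
  have sN0 : 2 * Num.sqrt (r ^+ 2) != 0 by rewrite sr mulf_neq0.
  have B := @is_deriveV _ (fun z : R => 2 * Num.sqrt z) (r ^+ 2) _ 1 sN0 B2.
  have := is_derive1M A B; rewrite /= sr.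
  move=> H; apply: (is_derive_eq H); rewrite /GRing.scale/=; field.
  by rewrite rN0.
have dre : dot (r *: e1) (r *: e1) = r ^+ 2 by exact: dot_e1.
have H2 := @second_derive0_radial0 _ _ F F1 _ (r *: e1) h.
rewrite dre in H2.
have nDF : \forall z \near r ^+ 2, is_derive (z : R) 1 F (F1 z).
  by apply: filterS near_rr => z; exact: DF.
have := H2 _ nDF D1.
have cont : \forall t \near (0 : R),
    0 < dot (r *: e1 + t *: h) (r *: e1 + t *: h) < T ^+ 2.
  have nx : \forall y \near r *: e1, 0 < dot y y < T ^+ 2.
    have c : {for r *: e1, continuous (fun y : V => dot y y)}.
      by apply: continuous_dot; exact: cvg_id.
    have nd : \forall z \near dot (r *: e1) (r *: e1), 0 < z < T ^+ 2 by rewrite dre.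
    exact: (c _ nd).
  exact: (near_line h nx).
have E : \forall t \near (0 : R),
    F (dot (r *: e1 + t *: h) (r *: e1 + t *: h)) = u (r *: e1 + t *: h).
  apply: filterS cont => t /andP[t0 tT]; rewrite /F /f /profile; apply: rad.
    by rewrite dot_e1 sqr_sqrtr// ltW.
  by rewrite dot_e1 sqr_sqrtr// ltW.
move=> /(second_derive0_near E) /second_derive0_eq; apply.
rewrite dotZl dot_delta /F1 sr; field.
by rewrite rN0.
Qed.

End RadialProfile.

Section ProfileEquation.
Variables (R : realType) (N : nat) (i0 : 'I_N).
Local Notation V := 'rV[R]_N.

Lemma profile_radial_sol sgn (lam Lam p q T : R) (u v : V -> R) :
  0 < lam -> lam <= Lam -> 0 < T ->
  solves_system sgn lam Lam p q (@eball R N T) u v ->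
  (forall x y, dot x x < T ^+ 2 -> dot x x = dot y y -> u x = u y /\ v x = v y) ->
  radial_sol sgn lam Lam (N%:R - 1) p q 0 T (profile i0 u) (profile i0 v).
Proof.
move=> lam0 lamLam T0 [C2u [C2v eqs]] rad r rT.
have [r0 rltT] := andP rT.
have rTT : - T < r < T by rewrite rltT andbT (lt_trans _ r0)// oppr_lt0.
have rB : @eball R N T (r *: delta_mx ord0 i0).
  by rewrite /eball/= enorm_lt ?(ltW T0)// dot_e1 ltr_pXn2r ?nnegrE ?(ltW r0) ?(ltW T0).
have [u0 [v0 [eu ev]]] := eqs _ rB.
have radu x y : dot x x < T ^+ 2 -> dot x x = dot y y -> u x = u y.
  by move=> h1 h2; have [] := rad x y h1 h2.
have radv x y : dot x x < T ^+ 2 -> dot x x = dot y y -> v x = v y.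
  by move=> h1 h2; have [] := rad x y h1 h2.
have key (a1 k1 m1 m2 r1 z1 : R) : m1 = r1 * m2 -> a1 + k1 * m1 + z1 = 0 ->
    a1 = - (r1 * k1 * m2) - z1.
  by move=> -> h; rewrite -[LHS]subr0 -h; ring.
have main s (w z : V -> R) : C2_on (@eball R N T) w ->
    (forall x y, dot x x < T ^+ 2 -> dot x x = dot y y -> w x = w y) ->
    pucci sgn lam Lam (hessian w (r *: delta_mx ord0 i0)) +
      z (r *: delta_mx ord0 i0) `^ s = 0 ->
    radial_eq sgn lam Lam (N%:R - 1) s (profile i0 w) (profile i0 z) r.
  move=> C2w radw ew.
  have Hs := hessian_sym (@open_eball R N T) C2w rB.
  have Hq h := @profile_hessian _ _ i0 T w T0 C2w radw r h rT.
  rewrite (pucci_radial lam Lam sgn Hs Hq) in ew.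
  have D1 := @profile_is_derive _ _ i0 T w T0 C2w r rTT.
  have D2 := @profile_is_derive2 _ _ i0 T w T0 C2w r rTT.
  split; [by case: D1|by case: D2|].
  rewrite (profile_derive2 i0 T0 C2w rTT) (profile_derive1 i0 T0 C2w rTT).
  rewrite -[LHS](M_mK sgn lam0 lamLam); congr (M_fun _ _ _ _).
  apply: (key _ _ _ _ _ _ _ ew).
  by rewrite [X in m_fun _ _ _ X]mulrC m_funZ// invr_gt0.
by split => //; exact: main.
Qed.

End ProfileEquation.

(** * Scaling invariance and uniqueness up to scaling for profiles *)

Section Rescaling.
Variables (R : realType) (sgn : pucci_sign) (lam Lam k p q : R).
Hypotheses (lam0 : 0 < lam) (lamLam : lam <= Lam) (k0 : 0 <= k).
Hypotheses (p0 : 0 < p) (q0 : 0 < q) (pq1 : 1 < p * q).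
Implicit Types (u v U V f : R -> R) (a b r s t T gam xi eta : R).

Let sol := radial_sol sgn lam Lam k.
Let al := alpha p q.
Let be := beta p q.

Let pqN0 : p * q - 1 != 0. Proof. by rewrite subr_eq0 gt_eqF. Qed.
Let p1 : 0 < p + 1. Proof. by rewrite ltr_wpDl// ltW. Qed.
Let q1 : 0 < q + 1. Proof. by rewrite ltr_wpDl// ltW. Qed.

Lemma alpha_gt0 : 0 < al.
Proof. by rewrite /al /alpha divr_gt0 ?mulr_gt0 ?subr_gt0. Qed.

(** With [betaD2], the exponent relations behind the hypothesis [d ^ s = c * gam ^ 2] of
    [radial_scale_eq]. *)
Lemma alphaD2 : al + 2 = be * p.
Proof. by rewrite /al /be /alpha /beta; field. Qed.

Lemma betaD2 : be + 2 = al * q.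
Proof. by rewrite /al /be /alpha /beta; field. Qed.

(** The ratio of the two scaling exponents is the exponent of the shooting curve. *)
Lemma beta_alpha : be = al * ((q + 1) / (p + 1)).
Proof. by rewrite /al /be /alpha /beta; field; rewrite pqN0 gt_eqF. Qed.

Lemma powR_alpha_root (x : R) : 0 < x -> (x `^ al^-1) `^ al = x.
Proof.
by move=> x0; rewrite -powRrM mulVf ?gt_eqF ?alpha_gt0// powRr1// ltW.
Qed.

Lemma powR_beta_root (x : R) : 0 < x ->
  (x `^ al^-1) `^ be = x `^ ((q + 1) / (p + 1)).
Proof. by move=> x0; rewrite beta_alpha powRrM powR_alpha_root. Qed.

(** The action of [rescale] on profiles. *)
Definition dilate a gam f : R -> R := fun t => gam `^ a * f (gam * t).

Lemma cvg_mul_at_right gam : 0 < gam -> gam * r @[r --> 0^'+] --> (0 : R)^'+.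
Proof.
move=> g0 A /near_right_ex[d d0 Ad].
suff : \forall r \near (0 : R)^'+, A (gam * r) by [].
have : \forall r \near (0 : R)^'+, 0 < r < d / gam.
  by apply: near_right_oo; rewrite divr_gt0.
apply: filterS => r /andP[r0 rd]; apply: Ad.
by rewrite mulr_gt0//= mulrC -ltr_pdivlMr.
Qed.

Lemma cvg_mul_at_left gam b : 0 < gam -> gam * r @[r --> (b / gam)^'-] --> b^'-.
Proof.
move=> g0 A hA; have {}hA : \forall t \near b, t < b -> A t := hA.
have {}hA : \forall t \near gam * (b / gam), t < b -> A t by rewrite mulrC divfK// gt_eqF.
have c := is_derive_continuous (is_derive1Zl gam (is_derive_id (b / gam) 1)).
have H : \forall r \near b / gam, gam * r < b -> A (gam * r) := c _ hA.
suff : \forall r \near b / gam, r < b / gam -> A (gam * r) by [].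
by apply: filterS H => r h rb; apply: h; rewrite mulrC -ltr_pdivlMr.
Qed.

Lemma dilate_sol gam T u v : 0 < gam -> sol p q 0 T u v ->
  forall r, 0 < r < T / gam ->
  derive1 (dilate al gam u) r = gam `^ al * gam * derive1 u (gam * r) /\
  derive1 (dilate be gam v) r = gam `^ be * gam * derive1 v (gam * r) /\
  [/\ 0 < dilate al gam u r, 0 < dilate be gam v r,
      radial_eq sgn lam Lam k p (dilate al gam u) (dilate be gam v) r &
      radial_eq sgn lam Lam k q (dilate be gam v) (dilate al gam u) r].
Proof.
move=> g0 S r /andP[r0]; rewrite ltr_pdivlMr// mulrC => rT.
have grT : 0 < gam * r < T by rewrite rT mulr_gt0.
have ga : 0 < gam `^ al by exact: powR_gt0.
have gb : 0 < gam `^ be by exact: powR_gt0.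
have g2 : gam ^+ 2 = gam `^ 2 by rewrite powR_mulrn// ltW.
have gN a b : gam `^ (a + b) = gam `^ a * gam `^ b.
  by rewrite powRD// (gt_eqF g0) implybT.
have [u0 v0 eu ev] := S _ grT.
have [e1 E1] : derive1 (dilate al gam u) r = gam `^ al * gam * derive1 u (gam * r) /\
    radial_eq sgn lam Lam k p (dilate al gam u) (dilate be gam v) r.
  apply: (radial_scale_eq g0 ga r0 gb _ _ grT v0 eu).
    by rewrite -powRrM -alphaD2 gN g2.
  by move=> t /S[_ _ []].
have [e2 E2] : derive1 (dilate be gam v) r = gam `^ be * gam * derive1 v (gam * r) /\
    radial_eq sgn lam Lam k q (dilate be gam v) (dilate al gam u) r.
  apply: (radial_scale_eq g0 gb r0 ga _ _ grT u0 ev).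
    by rewrite -powRrM -betaD2 gN g2.
  by move=> t /S[_ _ _ []].
by split => //; split => //; split => //; rewrite /dilate mulr_gt0.
Qed.

Lemma dilate_radial_sol gam T u v : 0 < gam -> sol p q 0 T u v ->
  sol p q 0 (T / gam) (dilate al gam u) (dilate be gam v).
Proof. by move=> g0 S r /(dilate_sol g0 S)[_ []]. Qed.

Lemma dilate_starts_for a gam T f xi : 0 < gam -> 0 < T ->
  (forall r, 0 < r < T / gam ->
    derive1 (dilate a gam f) r = gam `^ a * gam * derive1 f (gam * r)) ->
  starts 0 f xi -> starts 0 (dilate a gam f) (gam `^ a * xi).
Proof.
move=> g0 T0 E [cf cf'].
have dil (h : R -> R) (c l : R) : h r @[r --> (0 : R)^'+] --> l ->
    c * h (gam * r) @[r --> (0 : R)^'+] --> c * l.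
  move=> ch; apply: cvgM; first exact: cvg_cst.
  exact: (cvg_comp (fun r => gam * r) h (cvg_mul_at_right g0) ch).
split.
  exact: dil cf.
have c : gam `^ a * gam * derive1 f (gam * r) @[r --> 0^'+] --> 0.
  by rewrite -[X in _ --> X](mulr0 (gam `^ a * gam)); exact: dil cf'.
apply: cvg_trans c; apply: near_eq_cvg.
have : \forall r \near (0 : R)^'+, 0 < r < T / gam.
  by apply: near_right_oo; rewrite divr_gt0.
by apply: filterS => r /E ->.
Qed.

Lemma dilate_starts gam T u v xi eta : 0 < gam -> 0 < T -> sol p q 0 T u v ->
  starts 0 u xi -> starts 0 v eta ->
  starts 0 (dilate al gam u) (gam `^ al * xi) /\
  starts 0 (dilate be gam v) (gam `^ be * eta).
Proof.
move=> g0 T0 S su sv; split.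
  by apply: (dilate_starts_for g0 T0) su => r /(dilate_sol g0 S)[].
by apply: (dilate_starts_for g0 T0) sv => r /(dilate_sol g0 S)[_ []].
Qed.

Lemma dilate_cvg0 a gam T f : 0 < gam -> f r @[r --> T^'-] --> (0 : R) ->
  dilate a gam f r @[r --> (T / gam)^'-] --> (0 : R).
Proof.
move=> g0 cf.
have : dilate a gam f r @[r --> (T / gam)^'-] --> gam `^ a * 0.
  apply: cvgM; first exact: cvg_cst.
  have A := @cvg_comp _ _ _ (fun r => gam * r) f _ _ _ (@cvg_mul_at_left gam T g0).
  by have := A _ cf.
by rewrite mulr0.
Qed.

(** The factor [gam] is chosen so that the dilation carries [u(0) = xi] to [Xi]; two solutions with
    the same first datum coincide by [entire_unique]. *)
Lemma entire_dilate u v U V xi eta Xi Eta : 0 < xi -> 0 < eta -> 0 < Xi ->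
  (forall T, sol p q 0 T u v) -> (forall T, sol p q 0 T U V) ->
  starts 0 u xi -> starts 0 v eta -> starts 0 U Xi -> starts 0 V Eta ->
  let gam := (Xi / xi) `^ al^-1 in
  [/\ 0 < gam, gam `^ al * xi = Xi, gam `^ be * eta = Eta & forall r, 0 < r ->
    U r = dilate al gam u r /\ V r = dilate be gam v r].
Proof.
move=> xi0 eta0 Xi0 S1 S2 su sv sU sV gam.
have g0 : 0 < gam by rewrite powR_gt0// divr_gt0.
have gx : gam `^ al * xi = Xi.
  by rewrite /gam powR_alpha_root ?divr_gt0// divfK// gt_eqF.
have [su' sv'] := dilate_starts g0 ltr01 (S1 1) su sv.
have S1' T : sol p q 0 T (dilate al gam u) (dilate be gam v).
  by have := dilate_radial_sol g0 (S1 (T * gam)); rewrite mulfK// gt_eqF.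
have ge0 : 0 < gam `^ be * eta by rewrite mulr_gt0// powR_gt0.
rewrite gx in su'.
have [e H] := entire_unique lam0 lamLam k0 p0 q0 Xi0 ge0 S1' S2 su' sU sv' sV.
by split => // r r0; have [-> ->] := H r r0.
Qed.

Lemma dirichlet_dilate S T u v U V xi eta Xi Eta : 0 < S -> 0 < T ->
  0 < xi -> 0 < eta -> 0 < Xi ->
  sol p q 0 S u v -> sol p q 0 T U V ->
  starts 0 u xi -> starts 0 v eta -> starts 0 U Xi -> starts 0 V Eta ->
  u r @[r --> S^'-] --> (0 : R) -> v r @[r --> S^'-] --> (0 : R) ->
  U r @[r --> T^'-] --> (0 : R) -> V r @[r --> T^'-] --> (0 : R) ->
  let gam := (Xi / xi) `^ al^-1 in
  [/\ 0 < gam, gam `^ al * xi = Xi, gam `^ be * eta = Eta, S = gam * T &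
    forall r, 0 < r < T -> U r = dilate al gam u r /\ V r = dilate be gam v r].
Proof.
move=> S0 T0 xi0 eta0 Xi0 S1 S2 su sv sU sV zu zv zU zV gam.
have g0 : 0 < gam by rewrite powR_gt0// divr_gt0.
have gx : gam `^ al * xi = Xi.
  by rewrite /gam powR_alpha_root ?divr_gt0// divfK// gt_eqF.
have [su' sv'] := dilate_starts g0 S0 S1 su sv.
have S1' := dilate_radial_sol g0 S1.
have ge0 : 0 < gam `^ be * eta by rewrite mulr_gt0// powR_gt0.
rewrite gx in su'.
have Sg : 0 < S / gam by rewrite divr_gt0.
have [e eT H] := dirichlet_unique lam0 lamLam k0 p0 q0 Sg T0 Xi0 ge0 S1' S2
  su' sU sv' sV (dilate_cvg0 al g0 zu) (dilate_cvg0 be g0 zv) zU zV.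
split => //; first by rewrite -eT mulrC divfK// gt_eqF.
by move=> r rT; have [-> ->] := H r rT.
Qed.

End Rescaling.

(** * Smoothness of the power curve *)

Section PowerCurve.
Variable R : realType.

(** On the half line every derivative is again a multiple of a power, which is what the induction
    carries. *)
Lemma smooth_on_power (c b : R) (g : R -> R) :
  (forall t, 0 < t -> g t = c * t `^ b) -> smooth_on [set t : R | 0 < t] g.
Proof.
move=> E; have H n : exists a d, forall t, 0 < t -> derive1n n g t = a * t `^ d.
  elim: n => [|n [a [d IH]]]; first by exists c, b.
  exists (a * d), (d - 1) => t t0; rewrite derive1nS derive1E.
  have D : is_derive t 1 (derive1n n g) (a * (d * t `^ (d - 1))).
    apply: near_eq_is_derive (is_derive1Zl a (is_derive1_powR d t0)).
    by near=> s; rewrite IH//; near: s; exact: lt_nbhsr.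
  by have [_ ->] := D; rewrite mulrA.
move=> n t /= t0; have [a [d {}H]] := H n.
have D : is_derive t 1 (derive1n n g) (a * (d * t `^ (d - 1))).
  apply: near_eq_is_derive (is_derive1Zl a (is_derive1_powR d t0)).
  by near=> s; rewrite H//; near: s; exact: lt_nbhsr.
by case: D.
Unshelve. all: by end_near. Qed.

Lemma power_graph_smooth (c b : R) :
  simple_smooth_curve [set t : R | 0 < t] (fun t => (t, c * t `^ b)).
Proof.
split; first by move=> s t _ _ [].
split; last split.
- by apply: (@smooth_on_power 1 1) => t t0; rewrite mul1r powRr1// ltW.
- exact: (@smooth_on_power c b).
- by move=> t _ [+ _]; rewrite derive1_id => /eqP; rewrite oner_eq0.
Qed.

End PowerCurve.

(** * From profiles back to solutions in the whole space and in balls *)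

Section Classification.
Variables (R : realType) (N : nat) (lam Lam p q : R) (sgn : pucci_sign).
Hypotheses (lam0 : 0 < lam) (lamLam : lam <= Lam).
Hypotheses (p0 : 0 < p) (q0 : 0 < q) (pq1 : 1 < p * q).
Variable i0 : 'I_N.
Local Notation V := 'rV[R]_N.
Implicit Types (x y : V) (u v : V -> R) (r t gam xi eta : R).

Let e1 : V := delta_mx ord0 i0.
Let prof := @profile R N i0.
Let k : R := N%:R - 1.
Let al := alpha p q.
Let be := beta p q.
Let sol := radial_sol sgn lam Lam k.
Let entire := @radial_regular_entire_solution R sgn lam Lam p q N.
Let dirichlet := @dirichlet_solution R sgn lam Lam p q N.

Let k0 : 0 <= k.
Proof. by rewrite subr_ge0 ler1n (leq_ltn_trans (leq0n i0)). Qed.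

Lemma enorm_gt0 x : x != 0 -> 0 < enorm x.
Proof. by move=> xN0; rewrite enormE sqrtr_gt0 lt_neqAle eq_sym dot_eq0 xN0 dot_ge0. Qed.

Lemma rescale_dilate a gam u U x : 0 < gam ->
  u (gam *: x) = prof u (gam * enorm x) -> U x = prof U (enorm x) ->
  prof U (enorm x) = dilate a gam (prof u) (enorm x) ->
  U x = rescale a gam u x.
Proof. by move=> g0 hu -> ->; rewrite /rescale hu. Qed.

Lemma rescale0 a gam u : rescale a gam u 0 = gam `^ a * u 0.
Proof. by rewrite /rescale scaler0. Qed.

Lemma dirichlet_profile r u v x : 0 < r -> dirichlet r u v -> dot x x <= r ^+ 2 ->
  u x = prof u (enorm x) /\ v x = prof v (enorm x).
Proof.
move=> r0 S xr; apply: (dirichlet_radial lam0 lamLam r0 p0 q0 S xr).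
by rewrite dot_e1 enorm_sqr.
Qed.

Lemma profile_boundary p' q' r u v : 0 < r ->
  dirichlet_solution sgn lam Lam p' q' r u v -> prof u t @[t --> r^'-] --> (0 : R).
Proof.
move=> r0 S P P0; pose A := [set t : R | 0 <= t <= r].
have cf : {within A, continuous prof u}.
  apply: (within_continuous_comp (g := fun t : R => t *: e1)) (dirichlet_within r0 S).
    by move=> t; apply: cvgZr_tmp; exact: cvg_id.
  by move=> t /andP[t0 tr]; rewrite /= dot_e1 ler_pXn2r ?nnegrE ?(ltW r0).
have Ar : A r by rewrite /A/= lexx ltW.
have Pr : nbhs (prof u r) P.
  by rewrite /prof /profile (dirichlet_zero r0 S)// dot_e1.
have H : \forall t \near r, A t -> P (prof u t) := (within_continuousP _ _).1 cf r Ar P Pr.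
suff : \forall t \near r, t < r -> P (prof u t) by [].
have t0 : \forall t \near r, 0 < t := lt_nbhsr r0.
by apply: filterS2 H t0 => t h t0 tr; apply: h; rewrite /A/= !ltW.
Qed.

Lemma dirichlet_sol r u v : 0 < r -> dirichlet r u v ->
  [/\ sol p q 0 r (prof u) (prof v), starts 0 (prof u) (u 0), starts 0 (prof v) (v 0),
      0 < u 0 & 0 < v 0].
Proof.
move=> r0 S; have S' := dirichlet_sym S; have [sys _] := S; have [C2u [C2v _]] := sys.
have rad x y : dot x x < r ^+ 2 -> dot x x = dot y y -> u x = u y /\ v x = v y.
  by move=> /ltW xr; exact: (dirichlet_radial lam0 lamLam r0 p0 q0 S).
have z : dot (0 : V) 0 < r ^+ 2 by rewrite dot0r exprn_gt0.
split.
- exact: (profile_radial_sol i0 lam0 lamLam r0 sys rad).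
- by apply: (profile_starts i0 r0 C2u) => x y xr xy; have [] := rad x y xr xy.
- by apply: (profile_starts i0 r0 C2v) => x y xr xy; have [] := rad x y xr xy.
- exact: (dirichlet_pos r0 S z).
- exact: (dirichlet_pos r0 S' z).
Qed.

Lemma dirichlet_rescale r r' u v u' v' : 0 < r -> 0 < r' ->
  dirichlet r u v -> dirichlet r' u' v' ->
  exists gam, 0 < gam /\ r = gam * r' /\ forall x, @ecball R N r' x ->
    u' x = rescale al gam u x /\ v' x = rescale be gam v x.
Proof.
move=> r0 r'0 S S'; have [s1 su sv u0 v0] := dirichlet_sol r0 S.
have [s1' su' sv' u'0 v'0] := dirichlet_sol r'0 S'.
have [g0 gx ge rE H] := dirichlet_dilate lam0 lamLam k0 p0 q0 pq1 r0 r'0 u0 v0 u'0 s1 s1'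
  su sv su' sv' (profile_boundary r0 S) (profile_boundary r0 (dirichlet_sym S))
  (profile_boundary r'0 S') (profile_boundary r'0 (dirichlet_sym S')).
set gam := (_ `^ _) in g0 gx ge rE H.
exists gam; split => //; split => // x; rewrite ecballE// => /= xr.
(* The radial result covers only [0 < |x| < r']; the centre is settled by the matched initial
   values, the sphere by the boundary conditions. *)
have [->|xN0] := eqVneq x 0; first by rewrite !rescale0 gx ge.
have gxr : dot (gam *: x) (gam *: x) = gam ^+ 2 * dot x x by rewrite dotZl dotZr; ring.
move: xr; rewrite le_eqVlt => /predU1P[xr|xr].
  rewrite (dirichlet_zero r'0 S' xr) (dirichlet_zero r'0 (dirichlet_sym S') xr) /rescale.
  have gr : dot (gam *: x) (gam *: x) = r ^+ 2 by rewrite gxr xr rE exprMn.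
  by rewrite (dirichlet_zero r0 S gr) (dirichlet_zero r0 (dirichlet_sym S) gr) !mulr0.
have [E1 E2] := dirichlet_profile r'0 S' (ltW xr).
have gr : dot (gam *: x) (gam *: x) <= r ^+ 2.
  by rewrite gxr rE exprMn ler_wpM2l ?sqr_ge0// ltW.
have [E3 E4] := dirichlet_profile r0 S gr.
have eg : enorm (gam *: x) = gam * enorm x.
  by rewrite !enormE gxr sqrtrM ?sqr_ge0// sqrtr_sqr gtr0_norm.
rewrite eg in E3 E4.
have ex : 0 < enorm x < r' by rewrite enorm_gt0// enorm_lt// ltW.
have [H1 H2] := H _ ex.
by split; [exact: rescale_dilate E3 E1 H1|exact: rescale_dilate E4 E2 H2].
Qed.

Lemma entire_radial u v x y : entire u v -> dot x x = dot y y ->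
  u x = u y /\ v x = v y.
Proof.
move=> [_ [[f hf] [[g hg] _]]] xy.
have e : enorm x = enorm y by rewrite !enormE xy.
by rewrite !hf// !hg// e.
Qed.

Lemma entire_profile u v x : entire u v ->
  u x = prof u (enorm x) /\ v x = prof v (enorm x).
Proof. by move=> S; apply: (entire_radial S); rewrite dot_e1 enorm_sqr. Qed.

Lemma entire_C2 u v T : entire u v ->
  solves_system sgn lam Lam p q (@eball R N T) u v.
Proof.
move=> [[C2u [C2v eqs]] _].
by split; [move=> x _; exact: C2u|split; [move=> x _; exact: C2v|move=> x _; exact: eqs]].
Qed.

Lemma entire_sol u v : entire u v ->
  [/\ forall T, sol p q 0 T (prof u) (prof v),
      starts 0 (prof u) (u 0), starts 0 (prof v) (v 0) &
      forall x, 0 < u x /\ 0 < v x].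
Proof.
move=> S; have [C2u [C2v _]] := entire_C2 1 S.
split.
- move=> T; have [T0|T0] := ltP 0 T.
    apply: (profile_radial_sol i0 lam0 lamLam T0 (entire_C2 T S)) => x y _.
    exact: entire_radial S.
  by move=> r /andP[r0 rT]; have := lt_trans r0 rT; rewrite ltNge T0.
- by apply: (profile_starts i0 ltr01 C2u) => x y _ xy; have [] := entire_radial S xy.
- by apply: (profile_starts i0 ltr01 C2v) => x y _ xy; have [] := entire_radial S xy.
- by move=> x; have [[_ [_ /(_ x I)[h1 [h2 _]]]] _] := S.
Qed.

Lemma entire_rescale u v u' v' : entire u v -> entire u' v' ->
  exists gam, 0 < gam /\ (forall x, u' x = rescale al gam u x) /\
    forall x, v' x = rescale be gam v x.
Proof.
move=> S S'; have [s1 su sv pos] := entire_sol S; have [s1' su' sv' pos'] := entire_sol S'.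
have [g0 gx ge H] := entire_dilate lam0 lamLam k0 p0 q0 pq1 (pos 0).1 (pos 0).2 (pos' 0).1
  s1 s1' su sv su' sv'.
set gam := (_ `^ _) in g0 gx ge H.
exists gam; split => //.
suff E x : u' x = rescale al gam u x /\ v' x = rescale be gam v x.
  by split => x; have [] := E x.
have [->|xN0] := eqVneq x 0; first by rewrite !rescale0 gx ge.
have [E1 E2] := entire_profile x S'; have [E3 E4] := entire_profile (gam *: x) S.
have eg : enorm (gam *: x) = gam * enorm x.
  rewrite !enormE dotZl dotZr mulrA -expr2.
  by rewrite sqrtrM ?sqr_ge0// sqrtr_sqr gtr0_norm.
rewrite eg in E3 E4.
have [H1 H2] := H _ (enorm_gt0 xN0).
by split; [exact: rescale_dilate E3 E1 H1|exact: rescale_dilate E4 E2 H2].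
Qed.

Lemma positive_ivp_sol xi eta (U W : R -> R) :
  positive_ivp_solution sgn lam Lam p q N xi eta U W ->
  [/\ forall T, sol p q 0 T U W, starts 0 U xi & starts 0 W eta].
Proof.
move=> [[_ [cU [_ cU']]] [[_ [cW [_ cW']]] [pos eqs]]]; split => //.
move=> T r /andP[r0 _]; have [u0 w0] := pos r (ltW r0).
have [h1 [h2 [h3 [h4 [h5 h6]]]]] := eqs r r0.
split => //; split => //.
  by rewrite h5 gtr0_norm// [_ * W r]mulrC mulr_powRB1// ltW.
by rewrite h6 gtr0_norm// [_ * U r]mulrC mulr_powRB1// ltW.
Qed.

Lemma sol_positive_ivp xi eta (U W : R -> R) :
  (forall r, 0 <= r -> 0 < U r /\ 0 < W r) -> (forall T, sol p q 0 T U W) ->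
  initial_data U xi -> initial_data W eta ->
  positive_ivp_solution sgn lam Lam p q N xi eta U W.
Proof.
move=> pos S iU iW; split; [exact: iU|split; [exact: iW|split; [exact: pos|]]] => r r0.
have [u0 w0 [h1 h2 h3] [h4 h5 h6]] : [/\ 0 < U r, 0 < W r,
    radial_eq sgn lam Lam k p U W r & radial_eq sgn lam Lam k q W U r].
  by apply: (S (r + 1)); rewrite r0 ltrDl ltr01.
split; [exact: h1|split; [exact: h2|split; [exact: h4|split; [exact: h5|]]]].
split; first by rewrite h3 gtr0_norm// [_ * W r]mulrC mulr_powRB1// ltW.
by rewrite h6 gtr0_norm// [_ * U r]mulrC mulr_powRB1// ltW.
Qed.

Lemma dilate_initial_data a gam u xi :
  0 < gam -> is_derive (0 : R) 1 (prof u) 0 ->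
  starts 0 (dilate a gam (prof u)) xi -> gam `^ a * u 0 = xi ->
  initial_data (dilate a gam (prof u)) xi.
Proof.
move=> g0 D [c c'] E; have z : dilate a gam (prof u) 0 = xi.
  by rewrite /dilate mulr0 /prof /profile scale0r.
have D0 : is_derive (gam * 0) 1 (prof u) 0 by rewrite mulr0.
have Dl : is_derive (0 : R) 1 (fun t => gam * t) gam.
  by have := is_derive1Zl gam (is_derive_id (0 : R) 1); rewrite mulr1.
have D1 : is_derive (0 : R) 1 (dilate a gam (prof u)) 0.
  rewrite -[X in is_derive _ _ _ X](mulr0 (gam `^ a)) -[X in _ * X](mul0r gam).
  exact: (is_derive1Zl (gam `^ a)
    (@is_derive1_comp _ (prof u) (fun t => gam * t) 0 _ _ D0 Dl)).
move: D1; set w := dilate _ _ _ => -[dw dE].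
have c0 : (w h - w 0) / h @[h --> (0 : R)^'] --> (0 : R).
  rewrite -[X in _ --> X]dE.
  have -> : (fun h => (w h - w 0) / h) =
      (fun h => h^-1 *: ((w \o shift 0) (h *: (1 : R)) - w 0)).
    by apply/funext => h; rewrite /= addr0 /GRing.scale/= mulr1 mulrC.
  exact: dw.
by split; [exact: z|split; [exact: c|split; [exact: cvg_dnbhs_at_right c0|exact: c']]].
Qed.

(** Every positive solution of the initial value problem is a dilation of the profiles of [(u, v)]
    by [entire_dilate], and every dilation of them is such a solution. With
    [gam = (xi / u 0) ^ (1 / alpha)] the second datum [gam ^ beta * v 0] is the stated multiple of a
    power of [xi]. *)
Lemma shooting_curve u v : entire u v ->
  shooting_set sgn lam Lam p q N =
  (fun xi => (xi, v 0 / u 0 `^ ((q + 1) / (p + 1)) * xi `^ ((q + 1) / (p + 1))))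
    @` [set xi | 0 < xi].
Proof.
move=> S; have [s1 su sv pos] := entire_sol S.
have [u0 v0] := pos 0; set kap := (q + 1) / (p + 1).
have curve xi : 0 < xi ->
    v 0 / u 0 `^ kap * xi `^ kap = (xi / u 0) `^ al^-1 `^ be * v 0.
  move=> xi0; rewrite powR_beta_root ?divr_gt0// -/kap powRM ?invr_ge0 ?ltW//.
  have -> : (u 0)^-1 `^ kap = (u 0 `^ kap)^-1.
    by rewrite -powR_inv1 ?ltW// powRAC powR_inv1 ?powR_ge0.
  ring.
apply/seteqP; split => [[xi eta] [/= xi0 [eta0 [U [W ivp]]]]|_ [xi /= xi0 <-]].
  have [S1 sU sW] := positive_ivp_sol ivp.
  have [_ _ e _] := entire_dilate lam0 lamLam k0 p0 q0 pq1 u0 v0 xi0 s1 S1 su sv sU sW.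
  by exists xi => //=; rewrite curve// e.
split => //=; split; first by rewrite mulr_gt0 ?powR_gt0 ?divr_gt0 ?powR_gt0.
pose gam := (xi / u 0) `^ al^-1.
have g0 : 0 < gam by rewrite powR_gt0// divr_gt0.
have gx : gam `^ al * u 0 = xi.
  by rewrite /gam powR_alpha_root ?divr_gt0// divfK// gt_eqF.
have [su' sv'] := dilate_starts pq1 g0 ltr01 (s1 1) su sv.
have [C2u [C2v _]] := entire_C2 1 S.
have Du : is_derive (0 : R) 1 (prof u) 0.
  by apply: (profile_is_derive0 i0 ltr01 C2u) => x y _ xy; have [] := entire_radial S xy.
have Dv : is_derive (0 : R) 1 (prof v) 0.
  by apply: (profile_is_derive0 i0 ltr01 C2v) => x y _ xy; have [] := entire_radial S xy.
exists (dilate al gam (prof u)), (dilate be gam (prof v)).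
apply: sol_positive_ivp.
- move=> r _; have [pu pv] := pos ((gam * r) *: e1).
  by split; apply: mulr_gt0 => //; exact: powR_gt0.
- move=> T; have := dilate_radial_sol pq1 g0 (s1 (T * gam)).
  by rewrite mulfK// gt_eqF.
- by rewrite gx in su'; exact: dilate_initial_data g0 Du su' gx.
- by rewrite curve//; exact: dilate_initial_data g0 Dv sv' erefl.
Qed.

End Classification.

Unset Implicit Arguments.

Theorem theorem1p1 (R : realType) (N : nat) (lam Lam p q : R)
    (sgn : pucci_sign)
    (hN : (3 <= N)%N) (hlam : 0 < lam) (hLam : lam <= Lam)
    (hp : 0 < p) (hq : 0 < q) (hpq : 1 < p * q) :
  ((forall u v u' v' : 'rV[R]_N -> R,
      radial_regular_entire_solution sgn lam Lam p q u v ->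
      radial_regular_entire_solution sgn lam Lam p q u' v' ->
      exists gamma : R, 0 < gamma /\
        (forall x, u' x = rescale (alpha p q) gamma u x) /\
        (forall x, v' x = rescale (beta p q) gamma v x)) /\
   ((exists u v : 'rV[R]_N -> R,
       radial_regular_entire_solution sgn lam Lam p q u v) ->
    exists c : R,
      let curve := fun xi : R => (xi, c * xi `^ ((q + 1) / (p + 1))) in
      simple_smooth_curve [set xi : R | 0 < xi] curve /\
      shooting_set sgn lam Lam p q N = curve @` [set xi : R | 0 < xi]))
  /\
  (forall r : R, 0 < r ->
    (forall u v : 'rV[R]_N -> R,
      dirichlet_solution sgn lam Lam p q r u v ->
      radial_on (@ecball R N r) u /\ radial_on (@ecball R N r) v) /\
    (forall u v u' v' : 'rV[R]_N -> R,
      dirichlet_solution sgn lam Lam p q r u v ->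
      dirichlet_solution sgn lam Lam p q r u' v' ->
      forall x, @ecball R N r x -> u' x = u x /\ v' x = v x) /\
    (forall (r' : R) (u v u' v' : 'rV[R]_N -> R), 0 < r' ->
      dirichlet_solution sgn lam Lam p q r u v ->
      dirichlet_solution sgn lam Lam p q r' u' v' ->
      exists gamma : R, 0 < gamma /\ r = gamma * r' /\
        (forall x, @ecball R N r' x ->
          u' x = rescale (alpha p q) gamma u x /\
          v' x = rescale (beta p q) gamma v x))).
Proof.
pose i0 : 'I_N := Ordinal (leq_trans (isT : 0 < 3)%N hN).
split; [split|].
- by move=> u v u' v'; exact: (entire_rescale hlam hLam hp hq hpq i0).
- move=> [u [v S]]; exists (v 0 / u 0 `^ ((q + 1) / (p + 1))); split.
    exact: power_graph_smooth.
  exact: (shooting_curve hlam hLam hp hq hpq i0 S).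
move=> r r0; split; [|split].
- move=> u v S; have H := dirichlet_profile hlam hLam hp hq i0 r0 S.
  split; [exists (profile i0 u)|exists (profile i0 v)] => x; rewrite ecballE// => /H[].
    by [].
  by [].
- move=> u v u' v' S S' x xr.
  have [g [g0 [rE H]]] := dirichlet_rescale hlam hLam hp hq hpq i0 r0 r0 S S'.
  have g1 : g = 1 by apply: (mulIf (lt0r_neq0 r0)); rewrite mul1r -rE.
  by have [-> ->] := H x xr; rewrite g1 /rescale !powR1 scale1r !mul1r.
- move=> r' u v u' v' r'0 S S'.
  exact: (dirichlet_rescale hlam hLam hp hq hpq i0 r0 r'0 S S').
Qed.
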